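(* Fix an initial state $(t,x,y)\in[0,T)\times\mathbb R^d\times\mathbb R^d$. The feedback control $$\xi^*(s,x,y)=-\Lambda^{-1}\begin{bmatrix}-I_d&\gamma\end{bmatrix}Q(s)\begin{bmatrix}x\\ y\end{bmatrix}$$ is an admissible liquidation strategy; that is, the process $\xi^*(s,X^*(s),Y^*(s))$ along the associated state process $(X^*,Y^* )$ started at $(x,y)$ at time $t$ belongs to $L^2_{\mathcal F}(t,T;\mathbb R^d)$ and $X^*(T)=0$ a.s.
   Context: Setting: $T\in(0,\infty)$, $d\in\mathbb N$; $(\Omega,\mathcal F,(\mathcal F_t)_{t\in[0,T]},\mathbb P)$ is a filtered probability space carrying a one-dimensional standard Brownian motion $W$; $(\mathcal F_t)$ is the filtration generated by $W$ completed by the null sets and $\mathcal F=\mathcal F_T$. All equations and inequalities are understood $\mathbb P$-a.s. $\mathcal S^d$ (resp. $\mathcal S^d_+$) is the set of symmetric (resp. symmetric nonnegative definite) $d\times d$ real matrices, $I_d$ the identity. $L^2_{\mathcal F}(s,T;H)$: adapted $H$-valued processes on $[s,T]$ with $\mathbb E\int_s^T|f|^2dt<\infty$. $L^\infty_{\mathcal F}(\Omega;C([0,T];H))$: progressively measurable continuous processes with $\operatorname{ess\,sup}_\omega\max_t|f(t,\omega)|<\infty$. Data: $\Lambda\in\mathcal S^d$ positive definite; $\gamma=\mathrm{diag}(\gamma_i)$ positive definite diagonal with largest entry $\gamma_{\max}$; $\rho=\mathrm{diag}(\rho_i)$ and $\Sigma$ progressively measurable, essentially bounded $\mathcal S^d_+$-valued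 processes. For $n\ge\gamma_{\max}$, $(Q^n,M^n)\in L^\infty_{\mathcal F}(\Omega;C([0,T];\mathcal S^{2d}_+))\times L^2_{\mathcal F}(0,T;\mathcal S^{2d})$ is the unique solution of $$\begin{aligned}-dQ(t)=&\Bigg\{-Q(t)\begin{bmatrix}-I_d\\ \gamma\end{bmatrix}\Lambda^{-1}\begin{bmatrix}-I_d&\gamma\end{bmatrix}Q(t)+Q(t)\begin{bmatrix}0&0\\0&-\rho(t)\end{bmatrix}+\begin{bmatrix}0&0\\0&-\rho(t)\end{bmatrix}Q(t)\\&\quad+\begin{bmatrix}\Sigma(t)&0\\0&\gamma^{-1}\rho(t)+\rho(t)\gamma^{-1}\end{bmatrix}\Bigg\}\,dt-M(t)\,dW(t),\qquad Q(T)=\begin{bmatrix}nI_d&I_d\\ I_d&\gamma^{-1}\end{bmatrix},\end{aligned}$$ and $Q(t)=\lim_{n\to\infty}Q^n(t)$ for $t\in[0,T)$ (the limit exists, uniformly on compact subintervals of $[0,T)$). The state process $(X^*,Y^* )$ solves, on $[t,T)$, $dX=-\xi\,ds$, $dY=\{-\rho Y+\gamma\xi\}\,ds$, $(X(t),Y(t))=(x,y)$, with $\xi(s)=\xi^*(s,X(s),Y(s))$; $X^*(T)$ is the limit of $X^*(s)$ as $s\to T$. An admissible liquidation strategy for the initial state is a process $\xi\in L^2_{\mathcal F}(t,T;\mathbb R^d)$ whose associated $X$ satisfies $X(T)=0$ a.s. *)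

(* Defs.v *)
From HB Require Import structures.
From mathcomp Require Import all_boot all_order all_algebra.
From mathcomp Require Import all_classical all_reals all_analysis.

Set Implicit Arguments.
Unset Strict Implicit.
Unset Printing Implicit Defensive.

Import Order.TTheory GRing.Theory Num.Theory.
Import numFieldNormedType.Exports.

Local Open Scope classical_set_scope.
Local Open Scope ring_scope.

(* Conventions: a process is a function [f : Omega -> R -> V], with [f w s] its
   value at time [s] for the outcome [w]; matrix-valued processes are treated
   entrywise. *)

(** * Matrices *)

Section Matrices.
Variable R : realType.

Definition sym_mx n : set 'M[R]_n := [set A | A^T = A].

Definition psd_mx n : set 'M[R]_n :=
  [set A | A^T = A /\ forall v : 'cV[R]_n, 0 <= (v^T *m A *m v) 0 0].

Definition pd_mx n : set 'M[R]_n :=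
  [set A | A^T = A /\
     forall v : 'cV[R]_n, v != 0 -> 0 < (v^T *m A *m v) 0 0].

Definition sqr_frobenius m n (A : 'M[R]_(m, n)) : R :=
  \sum_i \sum_j A i j ^+ 2.

Definition mx_integral m n (D : set R) (f : R -> 'M[R]_(m, n)) : 'M[R]_(m, n) :=
  \matrix_(i, j) \int[@lebesgue_measure R]_(s in D) f s i j.

Definition mx_path_continuous m n (D : set R) (f : R -> 'M[R]_(m, n)) : Prop :=
  forall i j, {within D, continuous (fun s => f s i j)}.

End Matrices.

(** * Processes *)

Section Processes.
Context d (Omega : measurableType d) (R : realType) (P : probability Omega R).
Local Notation mu := (@lebesgue_measure R).

Definition brownian_filtration (W : Omega -> R -> R) (t : R) :
    set (set Omega) :=
  <<s [set A | exists s B, [/\ 0 <= s <= t, measurable B &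
                              A = (fun w => W w s) @^-1` B]]
      `|` P.-negligible >>.

Variable F : R -> set (set Omega).

Definition measurable_at (t : R) (Z : Omega -> R) : Prop :=
  measurable_fun [set: g_sigma_algebraType (F t)]
    (Z : g_sigma_algebraType (F t) -> R).

Definition adapted (I : set R) (f : Omega -> R -> R) : Prop :=
  forall t, I t -> measurable_at t (fun w => f w t).

Definition progressive (I : set R) (f : Omega -> R -> R) : Prop :=
  forall t, I t ->
    measurable_fun ([set: g_sigma_algebraType (F t)] `*` (I `&` `]-oo, t]))
      (fun z : g_sigma_algebraType (F t) * R => f z.1 z.2).

Definition brownian_motion (T : R) (W : Omega -> R -> R) : Prop :=
  [/\ adapted `[0, T] W,
      \forall w \ae P, W w 0 = 0,
      \forall w \ae P, {within `[0, T], continuous (W w)},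
      forall s t : R, 0 <= s -> s < t -> t <= T -> forall B : set R, measurable B ->
        P ((fun w => W w t - W w s) @^-1` B) =
        normal_prob 0 (Num.sqrt (t - s)) B &
      forall s t : R, 0 <= s -> s < t -> t <= T -> forall B : set R, measurable B ->
        forall A, F s A ->
        P (A `&` (fun w => W w t - W w s) @^-1` B) =
        (P A * P ((fun w => (W w t - W w s)%R) @^-1` B))%E].

Definition mx_progressive m n (I : set R) (f : Omega -> R -> 'M[R]_(m, n)) :
    Prop :=
  forall i j, progressive I (fun w s => f w s i j).

(* Progressively measurable, with values in [H], bounded up to a
   [P \x mu]-null set. *)
Definition ess_bounded_process m n (T : R) (H : set 'M[R]_(m, n))
    (f : Omega -> R -> 'M[R]_(m, n)) : Prop :=
  [/\ mx_progressive `[0, T] f,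
      \forall z \ae (P \x mu)%E, 0 <= z.2 <= T -> H (f z.1 z.2) &
      exists C : R, \forall z \ae (P \x mu)%E, 0 <= z.2 <= T ->
        forall i j, `|f z.1 z.2 i j| <= C].

(* L^\infty_F(Omega; C([0,T]; H)) *)
Definition Linf_continuous_process m n (T : R) (H : set 'M[R]_(m, n))
    (f : Omega -> R -> 'M[R]_(m, n)) : Prop :=
  [/\ mx_progressive `[0, T] f,
      \forall w \ae P, mx_path_continuous `[0, T] (f w),
      \forall w \ae P, forall s, 0 <= s <= T -> H (f w s) &
      exists C : R, \forall w \ae P, forall s, 0 <= s <= T ->
        forall i j, `|f w s i j| <= C].

(* L^2_F(s,T;H). The time interval is taken right-open: the endpoint T is
   dt-null, and a feedback control need not be defined there. *)
Definition L2_process m n (s T : R) (H : set 'M[R]_(m, n))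
    (f : Omega -> R -> 'M[R]_(m, n)) : Prop :=
  [/\ forall i j, adapted `[s, T[ (fun w r => f w r i j),
      forall i j, measurable_fun ([set: Omega] `*` `[s, T[)
                    (fun z : Omega * R => f z.1 z.2 i j),
      \forall z \ae (P \x mu)%E, s <= z.2 < T -> H (f z.1 z.2) &
      (\int[P]_w \int[mu]_(r in `[s, T[) (sqr_frobenius (f w r))%:E < +oo)%E].

(** * Ito integral *)

(* The step process \sum_(i < size) coef_i 1_{]time_i, time_{i+1}]}. *)
Record step_process := StepProcess {
  step_size : nat;
  step_time : nat -> R;
  step_coef : nat -> Omega -> R }.

Definition simple_process (T : R) (H : step_process) : Prop :=
  [/\ forall i, (i <= step_size H)%N -> 0 <= step_time H i <= T,
      forall i, (i < step_size H)%N -> step_time H i <= step_time H i.+1,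
      forall i, (i < step_size H)%N ->
        measurable_at (step_time H i) (step_coef H i) &
      forall i, (i < step_size H)%N ->
        exists C : R, forall w, `|step_coef H i w| <= C].

Definition step_value (H : step_process) (w : Omega) (s : R) : R :=
  \sum_(i < step_size H)
    step_coef H i w * \1_(`]step_time H i, step_time H i.+1]) s.

Definition step_integral (W : Omega -> R -> R) (H : step_process)
    (w : Omega) (t : R) : R :=
  \sum_(i < step_size H) step_coef H i w *
    (W w (Num.min (step_time H i.+1) t) - W w (Num.min (step_time H i) t)).

(* [N] is (a continuous version of) the process t |-> \int_0^t H dW, obtained as
   the L^2-limit of the integrals of simple processes converging to [H] in
   L^2(Omega x [0,T]). *)
Definition ito_integral (T : R) (W H N : Omega -> R -> R) : Prop :=
  [/\ adapted `[0, T] N,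
      \forall w \ae P, {within `[0, T], continuous (N w)} &
      exists S : nat -> step_process,
        [/\ forall k, simple_process T (S k),
            (\int[P]_w \int[mu]_(s in `[0%R, T])
               ((step_value (S k) w s - H w s) ^+ 2)%R%:E)%E
               @[k --> \oo] --> 0%E &
            forall t, 0 <= t <= T ->
              (\int[P]_w ((step_integral W (S k) w t - N w t) ^+ 2)%R%:E)%E
                @[k --> \oo] --> 0%E]].

End Processes.

(** * Liquidation problem *)

Section Liquidation.
Context dO (Omega : measurableType dO) (R : realType).
Variables (P : probability Omega R) (F : R -> set (set Omega)).
Variables (d : nat) (T : R).
Variables (Lambda : 'M[R]_d) (gamma : 'rV[R]_d).
(* The matrix-valued coefficients are \rho = diag_mx rho and Sigma. *)
Variables (rho : Omega -> R -> 'rV[R]_d) (Sigma : Omega -> R -> 'M[R]_d).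
Local Notation Gamma := (diag_mx gamma).

Definition gamma_max : R := \big[Num.max/0]_(i < d) gamma 0 i.

Definition bsde_driver (rho_t : 'rV[R]_d) (Sigma_t : 'M[R]_d)
    (Q : 'M[R]_(d + d)) : 'M[R]_(d + d) :=
  - (Q *m col_mx (- 1%:M) Gamma *m invmx Lambda *m row_mx (- 1%:M) Gamma *m Q)
  + Q *m block_mx 0 0 0 (- diag_mx rho_t)
  + block_mx 0 0 0 (- diag_mx rho_t) *m Q
  + block_mx Sigma_t 0 0
      (invmx Gamma *m diag_mx rho_t + diag_mx rho_t *m invmx Gamma).

Definition bsde_terminal (n : nat) : 'M[R]_(d + d) :=
  block_mx (n%:R%:M) 1%:M 1%:M (invmx Gamma).

(* Integral form of -dQ = driver dt - M dW, Q(T) = terminal, where [N] is the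
   Ito integral process of [M]. *)
Definition bsde_solution (W : Omega -> R -> R) (n : nat)
    (Q M : Omega -> R -> 'M[R]_(d + d)) : Prop :=
  [/\ Linf_continuous_process P F T (@psd_mx R (d + d)) Q,
      L2_process P F 0 T (@sym_mx R (d + d)) M &
      exists N : Omega -> R -> 'M[R]_(d + d),
        (forall i j, ito_integral P F T W
           (fun w s => M w s i j) (fun w s => N w s i j)) /\
        \forall w \ae P, forall t, 0 <= t <= T ->
          Q w t = bsde_terminal n
            + mx_integral `[t, T]
                (fun s => bsde_driver (rho w s) (Sigma w s) (Q w s))
            - (N w T - N w t)].

Definition bsde_limit (Qn : nat -> Omega -> R -> 'M[R]_(d + d))
    (w : Omega) (s : R) : 'M[R]_(d + d) :=
  \matrix_(i, j) lim ((Qn n w s i j) @[n --> \oo]).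

Definition feedback_control (Q : Omega -> R -> 'M[R]_(d + d))
    (w : Omega) (s : R) (x y : 'cV[R]_d) : 'cV[R]_d :=
  - (invmx Lambda *m row_mx (- 1%:M) Gamma *m Q w s *m col_mx x y).

(* State process of the control [xi] on [t,T): dX = - xi ds and
   dY = (- rho Y + gamma xi) ds with (X(t), Y(t)) = (x, y). *)
Definition state_process (xi : Omega -> R -> 'cV[R]_d) (t : R)
    (x y : 'cV[R]_d) (X Y : Omega -> R -> 'cV[R]_d) : Prop :=
  [/\ mx_progressive F `[t, T[ X, mx_progressive F `[t, T[ Y,
      \forall w \ae P, mx_path_continuous `[t, T[ (X w) /\
                       mx_path_continuous `[t, T[ (Y w) &
      \forall w \ae P, forall s, t <= s < T ->
        X w s = x - mx_integral `[t, s] (xi w) /\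
        Y w s = y + mx_integral `[t, s]
          (fun r => - (diag_mx (rho w r) *m Y w r) + Gamma *m xi w r)].

(* Here [X] is the first component of the state process of [xi], and X(T) is
   the limit of X(s) as s tends to T. *)
Definition admissible_liquidation (t : R) (xi X : Omega -> R -> 'cV[R]_d) :
    Prop :=
  L2_process P F t T setT xi /\
  \forall w \ae P, forall i, X w s i 0 @[s --> T^'-] --> (0 : R).

End Liquidation.

(* Main.v *)
From mathcomp Require Import all_boot all_order all_algebra.
From mathcomp Require Import all_classical all_reals all_analysis measurable_realfun.
From mathcomp Require Import ring lra.
Require Import Defs.
Set Implicit Arguments.
Unset Strict Implicit.
Unset Printing Implicit Defensive.
Import Order.TTheory GRing.Theory Num.Theory.
Import numFieldNormedType.Exports.
Local Open Scope classical_set_scope.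
Local Open Scope ring_scope.

(** Write [Z = (X, Y)] for the state under the feedback control [xi] and let
    [Q] be the limit of the penalized solutions [Q^n].

    Energy. On [[0, u]] with [u < T] the limit [Q] is bounded and still solves
    the Riccati equation, whose driver is a completed square
    ([riccati_square]). The feedback makes that square vanish, so the mean of
    [Z^T Q Z] decreases at least as fast as the cost of trading accumulates
    ([energy_inequality]):

      E (Z_u^T Q_u Z_u) + E (int_t^u xi^T Lambda xi) <= z^T Q_t z.

    The right-hand side does not depend on [u]. As [Q >= 0] and [Lambda] is
    positive definite, letting [u] tend to [T] shows that [xi] is square
    integrable. In particular [X] has a limit [X_T] at [T].

    Terminal constraint. By comparison [Q^n <= Q], hence
    [E (Z_u^T Q^n_u Z_u)] is bounded by the same constant for all [n] and all
    [u < T]. As [u] tends to [T], the matrix [Q^n_u] tends to its terminal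
    value, whose quadratic form is at least a multiple of [|x|^2] growing with
    [n] ([penalization]). Therefore [n * E (min 1 |X_T|^2)] stays bounded and
    [X_T = 0] ([terminal_constraint]).

    Bounds on [Q]. The [Q^n] are bounded uniformly in [n], by
    [al / (T - s) + m] at time [s]: this is the cost of the linear strategy
    that liquidates just after [T], encoded as an explicit supersolution
    ([uniform_quadratic_bound]).

    Stochastic calculus. Of the martingale part of the backward equation only
    one property is used: the increment of an Ito integral after time [s] is
    orthogonal to bounded variables known at [s] ([ito_orthogonal]). This turns
    the equation into a weak form ([weak_equation]) that passes to the limit
    in [n]. The weak form determines the derivative of [E (V^T Q V)] for every
    [V] of bounded speed, because freezing the factors over a step of length
    [h] costs an error of order [h^2] ([quadratic_step]). Both the comparison
    of Riccati solutions and the energy inequality are obtained from it by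
    summing over finer and finer grids. *)

(** * Integrals of bounded measurable functions *)

Section BoundedMeasurable.
Context d (S : measurableType d) (R : realType).
Implicit Types (D : set S) (f g : S -> R).

(** Processes and coefficients are cut off to be bounded before they are
    integrated: integrals are then finite and linear without further
    conditions. *)
Definition bounded_measurable D f : Prop :=
  measurable_fun D f /\ exists C : R, forall x, D x -> `|f x| <= C.

Lemma bm_cst D c : bounded_measurable D (fun=> c).
Proof. by split; [exact: measurable_cst|exists `|c|]. Qed.

Lemma bmD D f g : bounded_measurable D f -> bounded_measurable D g ->
  bounded_measurable D (fun x => f x + g x).
Proof.
move=> [mf [A fA]] [mg [B gB]]; split; first exact: measurable_funD.
exists (A + B) => x Dx; apply: (le_trans (ler_normD _ _)).
by rewrite lerD ?fA ?gB.
Qed.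

Lemma bmM D f g : bounded_measurable D f -> bounded_measurable D g ->
  bounded_measurable D (fun x => f x * g x).
Proof.
move=> [mf [A fA]] [mg [B gB]]; split; first exact: measurable_funM.
exists (A * B) => x Dx; rewrite normrM.
by rewrite ler_pM ?fA ?gB.
Qed.

Lemma bm_sqr D f : bounded_measurable D f ->
  bounded_measurable D (fun x => f x ^+ 2).
Proof. by move=> bf; exact: (bmM bf bf). Qed.

Lemma bmN D f : bounded_measurable D f -> bounded_measurable D (fun x => - f x).
Proof.
move=> [mf [A fA]]; split; first exact: (measurable_funN mf).
by exists A => x Dx; rewrite normrN fA.
Qed.

Lemma bmB D f g : bounded_measurable D f -> bounded_measurable D g ->
  bounded_measurable D (fun x => f x - g x).
Proof. by move=> bf bg; apply: bmD => //; exact: bmN. Qed.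

Lemma bm_sum D (I : Type) (r : seq I) (p : pred I) (F : I -> S -> R) :
  (forall i, bounded_measurable D (F i)) ->
  bounded_measurable D (fun x => \sum_(i <- r | p i) F i x).
Proof.
move=> bF; elim: r => [|i r ih].
  by under eq_fun do rewrite big_nil; exact: bm_cst.
under eq_fun do rewrite big_cons.
case: (p i) => //; exact: bmD.
Qed.

Lemma bmS D D' f : measurable D -> D' `<=` D ->
  bounded_measurable D f -> bounded_measurable D' f.
Proof.
move=> mD sD [mf [C fC]]; split; first exact: measurable_funS mf.
by exists C => x D'x; apply: fC; exact: sD.
Qed.

Lemma eq_bm D f g : (forall x, D x -> f x = g x) ->
  bounded_measurable D f -> bounded_measurable D g.
Proof.
move=> fg [mf [C fC]]; split.
  by apply: eq_measurable_fun mf => x /set_mem; exact: fg.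
by exists C => x Dx; rewrite -fg// fC.
Qed.

Section integral.
Variables (m : {measure set S -> \bar R}) (D : set S).
Hypotheses (mD : measurable D) (fin : (m D < +oo)%E).
Local Notation bm := (bounded_measurable D).

Lemma bm_integrable f : bm f -> m.-integrable D (EFin \o f).
Proof.
move=> [mf [C fC]]; apply: measurable_bounded_integrable => //.
exists C; split; first exact: num_real.
by move=> M CM x Dx; exact: (le_trans (fC _ Dx) (ltW CM)).
Qed.

Lemma bm_intD f g : bm f -> bm g ->
  \int[m]_(x in D) (f x + g x) = \int[m]_(x in D) f x + \int[m]_(x in D) g x.
Proof. by move=> bf bg; rewrite RintegralD//; exact: bm_integrable. Qed.

Lemma bm_intB f g : bm f -> bm g ->
  \int[m]_(x in D) (f x - g x) = \int[m]_(x in D) f x - \int[m]_(x in D) g x.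
Proof. by move=> bf bg; rewrite RintegralB//; exact: bm_integrable. Qed.

Lemma bm_intZ c f : bm f ->
  \int[m]_(x in D) (c * f x) = c * \int[m]_(x in D) f x.
Proof. by move=> bf; rewrite RintegralZl//; exact: bm_integrable. Qed.

Lemma bm_intN f : bm f ->
  \int[m]_(x in D) (- f x) = - \int[m]_(x in D) f x.
Proof.
move=> bf; rewrite -mulN1r -bm_intZ//.
by congr Rintegral; apply/funext => x; rewrite mulN1r.
Qed.

Lemma bm_int_sum (I : Type) (r : seq I) (p : pred I) (F : I -> S -> R) :
  (forall i, bm (F i)) ->
  \int[m]_(x in D) (\sum_(i <- r | p i) F i x) =
  \sum_(i <- r | p i) \int[m]_(x in D) F i x.
Proof.
move=> bF; elim: r => [|i r ih].
  under eq_Rintegral do rewrite big_nil.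
  by rewrite big_nil Rintegral_cst// mul0r.
under eq_Rintegral do rewrite big_cons.
rewrite big_cons; case: (p i) => //.
by rewrite bm_intD ?ih//; exact: bm_sum.
Qed.

Lemma bm_le_int f g : bm f -> bm g -> (forall x, D x -> f x <= g x) ->
  \int[m]_(x in D) f x <= \int[m]_(x in D) g x.
Proof. by move=> bf bg fg; apply: le_Rintegral => //; exact: bm_integrable. Qed.

Lemma bm_norm_int f C : bm f -> (forall x, D x -> `|f x| <= C) ->
  `|\int[m]_(x in D) f x| <= C * fine (m D).
Proof.
move=> bf fC; rewrite -Rintegral_cst//.
rewrite ler_norml; apply/andP; split.
  rewrite -bm_intN; last exact: bm_cst.
  apply: bm_le_int => //; first by apply: bmN; exact: bm_cst.
  by move=> x /fC; rewrite ler_norml => /andP[].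
apply: bm_le_int => //; first exact: bm_cst.
by move=> x /fC; rewrite ler_norml => /andP[].
Qed.

Lemma bm_ae_eq_int f g : measurable_fun D f -> measurable_fun D g ->
  (\forall x \ae m, D x -> f x = g x) ->
  \int[m]_(x in D) f x = \int[m]_(x in D) g x.
Proof.
move=> mf mg fg; congr fine; apply: ae_eq_integral => //.
- exact/measurable_EFinP.
- exact/measurable_EFinP.
- by apply: filterS fg => x h Dx /=; rewrite h.
Qed.

Lemma bm_ae_le_int f g : bm f -> bm g ->
  (\forall x \ae m, D x -> f x <= g x) ->
  \int[m]_(x in D) f x <= \int[m]_(x in D) g x.
Proof.
move=> bf bg fg.
have mm : measurable_fun D (fun x => Num.max (f x) (g x)).
  by apply: measurable_maxr; [case: bf|case: bg].
have bmx : bm (fun x => Num.max (f x) (g x)).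
  split=> //; case: bf => _ [A fA]; case: bg => _ [B gB].
  exists (Num.max A B) => x Dx; rewrite le_max /Num.max.
  by case: ifP => _; rewrite ?gB ?fA ?orbT.
rewrite (@bm_ae_eq_int g (fun x => Num.max (f x) (g x)))//.
- by apply: bm_le_int => // x Dx; rewrite le_max lexx.
- by case: bg.
by apply: filterS fg => x h Dx; apply/esym/max_idPr; exact: h.
Qed.

Lemma bm_cvg_int (f_ : nat -> S -> R) f C :
  (forall n, measurable_fun D (f_ n)) -> measurable_fun D f ->
  (\forall x \ae m, D x -> f_ n x @[n --> \oo] --> f x) ->
  (forall n x, D x -> `|f_ n x| <= C) ->
  \int[m]_(x in D) f_ n x @[n --> \oo] --> \int[m]_(x in D) f x.
Proof.
move=> mf_ mf cf bf_.
have [|||||fint _] := @dominated_convergence _ S R m D mD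
  (fun n => EFin \o f_ n) (EFin \o f) (EFin \o fun=> C).
- by move=> n; apply/measurable_EFinP.
- exact/measurable_EFinP.
- by apply: filterS cf => x h Dx; apply/fine_cvgP; split; [exact: nearW|exact: h].
- by apply: bm_integrable; exact: bm_cst.
- by apply: aeW => x n Dx /=; rewrite lee_fin bf_.
by move=> h; apply: fine_cvg; rewrite fineK//; exact: integrable_fin_num.
Qed.
End integral.
End BoundedMeasurable.

(** * Fubini's theorem on a time interval *)

Section IntervalFubini.
Context d (S : measurableType d) (R : realType).
Local Notation mu := (@lebesgue_measure R).
Implicit Types (f : S -> R -> R) (a b : R).

Lemma lebesgue_itv a b : a <= b -> fine (mu `[a, b]) = b - a.
Proof.
move=> ab; rewrite lebesgue_measure_itv/= lte_fin; case: ltP => //= ba.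
by apply/esym/eqP; rewrite subr_eq0 eq_le ab ba.
Qed.

Lemma lebesgue_itv_fin a b : (mu `[a, b] < +oo)%E.
Proof. by rewrite lebesgue_measure_itv/=; case: ifP => _; rewrite ltry. Qed.

Definition jointly_bm a b f :=
  bounded_measurable ([set: S] `*` `[a, b]) (fun z : S * R => f z.1 z.2).

Lemma measurable_strip a b : measurable ([set: S] `*` `[a, b] : set (S * R)).
Proof. exact: measurableX. Qed.

Lemma measurable_time_section (I : set R) f r : measurable I ->
  measurable_fun ([set: S] `*` I) (fun z : S * R => f z.1 z.2) -> I r ->
  measurable_fun [set: S] (f ^~ r).
Proof.
move=> mI mf Ir.
apply: (@measurable_comp _ _ _ _ _ _ ([set: S] `*` I)
  (fun z : S * R => f z.1 z.2) setT (fun w => (w, r))) => //.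
- exact: measurableX.
- by move=> _ [w _ <-]; split.
Qed.

Lemma measurable_path_section (I : set R) f w : measurable I ->
  measurable_fun ([set: S] `*` I) (fun z : S * R => f z.1 z.2) ->
  measurable_fun I (f w).
Proof.
move=> mI mf.
apply: (@measurable_comp _ _ _ _ _ _ ([set: S] `*` I)
  (fun z : S * R => f z.1 z.2) I (fun r => (w, r))) => //.
- exact: measurableX.
- by move=> _ [r Ir <-]; split.
- by apply: measurable_funTS; exact: pair1_measurable.
Qed.

Lemma jbm_time a b f r : jointly_bm a b f -> a <= r <= b ->
  bounded_measurable setT (f ^~ r).
Proof.
move=> [mf [C fC]] rab; split.
  by apply: measurable_time_section mf _ => //=; rewrite in_itv.
by exists C => w _; apply: (fC (w, r)); split => //=; rewrite in_itv.
Qed.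

Lemma jbm_path a b f w : jointly_bm a b f -> bounded_measurable `[a, b] (f w).
Proof.
move=> [mf [C fC]]; split; first exact: measurable_path_section mf.
by exists C => r rab; apply: (fC (w, r)); split.
Qed.

Let extend a b f (z : S * R) : R :=
  ((fun z => f z.1 z.2) \_ ([set: S] `*` `[a, b])) z.

Let extendE a b f w r : extend a b f (w, r) = (f w \_ `[a, b]) r.
Proof.
rewrite /extend /patch; congr (if _ then _ else _).
by apply/idP/idP; rewrite !inE => -[].
Qed.

Let measurable_extend a b f : jointly_bm a b f ->
  measurable_fun setT (extend a b f).
Proof.
move=> [mf _]; apply: (measurable_restrictT _ _).1 => //.
exact: measurable_strip.
Qed.

Let extend_int a b f w :
  (\int[mu]_(r in `[a, b]) (f w r)%:E)%E = (\int[mu]_r (extend a b f (w, r))%:E)%E.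
Proof.
rewrite integral_mkcond; apply: eq_integral => r _.
by rewrite restrict_EFin /= extendE.
Qed.

Lemma bm_path_integral a b f : a <= b -> jointly_bm a b f ->
  bounded_measurable setT (fun w => \int[mu]_(r in `[a, b]) f w r).
Proof.
move=> ab bf; have mg := measurable_extend bf; split.
  pose g := EFin \o extend a b f.
  have mg' : measurable_fun setT g by exact/measurable_EFinP.
  suff : measurable_fun setT (fun w => \int[mu]_r g (w, r))%E.
    move=> mI; apply: (eq_measurable_fun (fun w => fine (\int[mu]_r g (w, r))%E)).
      by move=> w _; rewrite /Rintegral extend_int.
    exact: measurableT_comp.
  have -> : (fun w => \int[mu]_r g (w, r))%E =
      ((fun w => \int[mu]_r (g^\+ (w, r))) \- (fun w => \int[mu]_r (g^\- (w, r))))%E.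
    apply/funext => w; rewrite [LHS]integralE.
    under eq_integral do rewrite funepos_comp/=.
    by under [X in (_ - X)%E = _]eq_integral do rewrite funeneg_comp/=.
  apply: emeasurable_funB; apply: measurable_fun_fubini_tonelli_F => //.
  - exact: measurable_funepos.
  - exact: measurable_funeneg.
have [_ [C fC]] := bf; exists (C * (b - a)) => w _.
rewrite -lebesgue_itv//; apply: bm_norm_int => //.
- exact: lebesgue_itv_fin.
- exact: jbm_path bf.
- by move=> r rab; apply: (fC (w, r)).
Qed.

Variable P : probability S R.

Let extend_intP a b f r : r \in `[a, b] ->
  (\int[P]_w (f w r)%:E)%E = (\int[P]_w (extend a b f (w, r))%:E)%E.
Proof.
move=> rab; apply: eq_integral => w _; rewrite extendE patchE mem_set//.
Qed.

Let integrable_extend a b f : jointly_bm a b f ->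
  (P \x mu)%E.-integrable setT (EFin \o extend a b f).
Proof.
move=> bf; have [mf [C fC]] := bf.
have -> : EFin \o extend a b f =
    (EFin \o fun z : S * R => f z.1 z.2) \_ ([set: S] `*` `[a, b]).
  by rewrite restrict_EFin.
pose mI := @measurable_strip a b.
refine (iffLR (@integrable_mkcond _ _ _ (P \x mu)%E _ _ mI) _).
refine (@bm_integrable _ (S * measurableTypeR R)%type R (P \x mu)%E _ mI _ _ bf).
have mJ : @measurable _ (measurableTypeR R) `[a, b] by exact: measurable_itv.
have E := @product_measure1E _ _ S (measurableTypeR R) R P mu setT _ measurableT mJ.
have E1 := etrans E (congr1 (fun x => x * mu `[a, b])%E (probability_setT P)).
refine (eq_ind_r (fun x => (x < +oo)%E) _ E1).
by rewrite mul1e; exact: lebesgue_itv_fin.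
Qed.

Lemma bm_mean a b f : jointly_bm a b f ->
  bounded_measurable `[a, b] (fun r => \int[P]_w f w r).
Proof.
move=> bf; have [mf [C fC]] := bf; split.
  have := measurable_fubini_G (integrable_extend bf).
  move=> mG; apply: (eq_measurable_fun
    (fun r => fine (\int[P]_w (extend a b f (w, r))%:E)%E)).
    by move=> r /set_mem rab; rewrite /Rintegral -extend_intP.
  apply: measurable_funTS; exact: measurableT_comp mG.
exists C => r rab; rewrite -[C]mulr1.
have -> : 1 = fine (P setT) :> R by rewrite probability_setT.
apply: bm_norm_int => //.
- by rewrite /= probability_setT ltry.
- exact: jbm_time bf rab.
- by move=> w _; apply: (fC (w, r)).
Qed.

Lemma Rfubini a b f : jointly_bm a b f ->
  \int[P]_w \int[mu]_(r in `[a, b]) f w r =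
  \int[mu]_(r in `[a, b]) \int[P]_w f w r.
Proof.
move=> bf.
have /(congr1 fine) := Fubini (integrable_extend bf) => /= h.
transitivity (fine (\int[P]_w \int[mu]_r (extend a b f (w, r))%:E)%E).
  congr fine; apply: eq_integral => w _; rewrite -extend_int.
  rewrite fineK//; apply: integrable_fin_num => //.
  apply: bm_integrable => //; [exact: lebesgue_itv_fin|exact: jbm_path bf].
rewrite h; congr fine.
rewrite [RHS]integral_mkcond; apply: eq_integral => r _.
rewrite patchE; case: ifPn => rab; last first.
  by rewrite integral0_eq// => w _; rewrite extendE patchE (negbTE rab).
rewrite -extend_intP ?fineK//; last by rewrite inE in rab.
apply: integrable_fin_num => //; apply: bm_integrable => //.
  by rewrite /= probability_setT ltry.
by apply: jbm_time bf _; rewrite inE in rab.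
Qed.
End IntervalFubini.

(** * Bounded adapted processes *)

Section ChangeSigma.
Context d (S : measurableType d) (R : realType).

Lemma measurable_identity (G : set (set S)) : G `<=` @measurable d S ->
  measurable_fun [set: S] (fun w : S => w : g_sigma_algebraType G).
Proof.
move=> GS _ B mB; rewrite setTI preimage_id.
have : sigma_algebra setT (@measurable d S) by exact: sigma_algebra_measurable.
by move=> h; apply: (smallest_sub h GS).
Qed.

Lemma bm_identity (G : set (set S)) (f : S -> R) : G `<=` @measurable d S ->
  bounded_measurable [set: g_sigma_algebraType G] f ->
  bounded_measurable [set: S] f.
Proof.
move=> GS [mf [C fC]]; split; last by exists C.
apply: (measurableT_comp (f := f : g_sigma_algebraType G -> R)) => //.
exact: measurable_identity.
Qed.

Lemma jointly_measurable_identity (G : set (set S)) (I : set R) (f : S -> R -> R) :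
  measurable I -> G `<=` @measurable d S ->
  measurable_fun ([set: g_sigma_algebraType G] `*` I)
    (fun z : g_sigma_algebraType G * R => f z.1 z.2) ->
  measurable_fun ([set: S] `*` I) (fun z : S * R => f z.1 z.2).
Proof.
move=> mI GS mf.
apply: (@measurable_comp _ _ _ _ _ _ ([set: g_sigma_algebraType G] `*` I)
  (fun z : g_sigma_algebraType G * R => f z.1 z.2) _
  (fun z : S * R => (z.1 : g_sigma_algebraType G, z.2))) => //.
- exact: measurableX.
- by move=> _ [[w r] [_ /= Ir] <-]; split.
apply: measurable_funTS; apply: measurable_fun_pair => //.
exact: (measurableT_comp (measurable_identity GS) measurable_fst).
Qed.
End ChangeSigma.

Section Adapted.
Context d (Omega : measurableType d) (R : realType) (P : probability Omega R).
Variables (F : R -> set (set Omega)) (T : R).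
Local Notation mu := (@lebesgue_measure R).

(** Bounded random variables known at time [t]; they serve as test variables.
    *)
Definition brv (t : R) (f : Omega -> R) : Prop :=
  bounded_measurable [set: g_sigma_algebraType (F t)] f.

(** A bounded form of progressive measurability. Quantifying over the right
    end [r] makes the value at time [r] known at time [r], and makes
    restriction to a subinterval immediate. *)
Definition bproc (a b : R) (f : Omega -> R -> R) : Prop :=
  forall r, a <= r <= b ->
    jointly_bm (S := g_sigma_algebraType (F r)) a r f.

Definition filtration : Prop :=
  (forall t, 0 <= t <= T -> F t `<=` @measurable d Omega) /\
  (forall s t, 0 <= s -> s <= t -> t <= T -> F s `<=` F t).

Hypothesis FF : filtration.

Let sub_meas s t : 0 <= s -> s <= t -> t <= T ->
  F s `<=` @measurable _ (g_sigma_algebraType (F t)).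
Proof.
move=> s0 st tT A FA; apply: sub_gen_smallest.
exact: (FF.2 s t).
Qed.

Lemma brv_mono s t f : 0 <= s -> s <= t -> t <= T -> brv s f -> brv t f.
Proof.
move=> s0 st tT.
by apply: (bm_identity (S := g_sigma_algebraType (F t))); exact: sub_meas.
Qed.

Lemma brv_bm t f : 0 <= t <= T -> brv t f -> bounded_measurable [set: Omega] f.
Proof. by move=> tT; apply: bm_identity; exact: FF.1. Qed.

Lemma brv_cst t c : brv t (fun=> c). Proof. exact: bm_cst. Qed.
Lemma brvD t f g : brv t f -> brv t g -> brv t (fun w => f w + g w).
Proof. exact: bmD. Qed.
Lemma brvB t f g : brv t f -> brv t g -> brv t (fun w => f w - g w).
Proof. exact: bmB. Qed.
Lemma brvM t f g : brv t f -> brv t g -> brv t (fun w => f w * g w).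
Proof. exact: bmM. Qed.
Lemma brv_sum t (I : Type) (r : seq I) (p : pred I) (f : I -> Omega -> R) :
  (forall i, brv t (f i)) -> brv t (fun w => \sum_(i <- r | p i) f i w).
Proof. exact: bm_sum. Qed.

Lemma bproc_cst a b c : bproc a b (fun _ _ => c).
Proof. by move=> r _; exact: bm_cst. Qed.
Lemma bprocD a b f g : bproc a b f -> bproc a b g ->
  bproc a b (fun w r => f w r + g w r).
Proof. by move=> bf bg r rab; exact: (bmD (bf r rab) (bg r rab)). Qed.
Lemma bprocM a b f g : bproc a b f -> bproc a b g ->
  bproc a b (fun w r => f w r * g w r).
Proof. by move=> bf bg r rab; exact: (bmM (bf r rab) (bg r rab)). Qed.
Lemma bprocN a b f : bproc a b f -> bproc a b (fun w r => - f w r).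
Proof. by move=> bf r rab; exact: (bmN (bf r rab)). Qed.
Lemma bprocB a b f g : bproc a b f -> bproc a b g ->
  bproc a b (fun w r => f w r - g w r).
Proof. by move=> bf bg r rab; exact: (bmB (bf r rab) (bg r rab)). Qed.
Lemma bproc_sum a b (I : Type) (s : seq I) (p : pred I)
    (f : I -> Omega -> R -> R) :
  (forall i, bproc a b (f i)) ->
  bproc a b (fun w r => \sum_(i <- s | p i) f i w r).
Proof.
move=> bf r rab.
by apply: (@bm_sum _ _ R _ I s p
  (fun i (z : g_sigma_algebraType (F r) * R) => f i z.1 z.2)) => i; exact: bf.
Qed.

Lemma eq_bproc a b f g : (forall w r, a <= r <= b -> f w r = g w r) ->
  bproc a b f -> bproc a b g.
Proof.
move=> fg bf r /andP[ar rb]; apply: eq_bm (bf r _) => [[w q] [_ /=]|].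
  rewrite in_itv/= => /andP[aq qr]; apply: fg.
  by rewrite aq (le_trans qr).
by rewrite ar rb.
Qed.

Lemma bproc_det (a b : R) (g : R -> R) : bounded_measurable (`[a, b]%classic : set R) g ->
  bproc a b (fun _ r => g r).
Proof.
move=> bg r /andP[ar rb].
have [mg [C gC]] : bounded_measurable (`[a, r]%classic : set R) g.
  by apply: bmS bg => //; apply: subset_itvl; rewrite bnd_simp.
split; last by exists C => -[w q] [_ /= qr]; exact: gC.
apply: (@measurable_comp _ _ _ _ _ _ `[a, r]%classic g _ snd) => //.
  by move=> _ [[w q] [_ /= qr] <-].
exact: measurable_funTS.
Qed.

Lemma bproc_sub a b a' b' f : a <= a' -> b' <= b -> bproc a b f -> bproc a' b' f.
Proof.
move=> aa bb bf r /andP[ar rb].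
apply: bmS (bf r _) => //.
- exact: (@measurable_strip _ (g_sigma_algebraType (F r))).
- move=> [w q] [_ /=]; rewrite !in_itv/= => /andP[aq qr]; split => //=.
  by rewrite qr (le_trans aa).
- by rewrite (le_trans aa)//= (le_trans rb).
Qed.

Section range.
Variables (a b : R) (a0 : 0 <= a) (ab : a <= b) (bT : b <= T).

Lemma bproc_brv f : brv a f -> bproc a b (fun w _ => f w).
Proof.
move=> bf r /andP[ar rb].
have [mf [C fC]] : brv r f by apply: brv_mono bf => //; exact: le_trans bT.
split; last by exists C => z _; exact: fC.
apply: measurable_funTS.
exact: (measurableT_comp (f := f : g_sigma_algebraType (F r) -> R)).
Qed.

Lemma bproc_time f r : a <= r <= b -> bproc a b f -> brv r (f ^~ r).
Proof.
move=> rab bf; apply: (jbm_time (S := g_sigma_algebraType (F r)) (bf r rab)).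
by rewrite lexx andbT; case/andP: rab.
Qed.

Lemma bproc_joint f : bproc a b f -> jointly_bm (S := Omega) a b f.
Proof.
move=> bf; have [] := bf b; first by rewrite ab lexx.
move=> mf [C fC]; split; last by exists C => -[w r] wr; exact: (fC (w, r)).
apply: jointly_measurable_identity mf => //.
by apply: FF.1; rewrite bT (le_trans a0).
Qed.

Lemma bproc_bound f : bproc a b f ->
  exists C, forall w r, a <= r <= b -> `|f w r| <= C.
Proof.
move=> /bproc_joint[_ [C fC]]; exists C => w r rab.
by apply: (fC (w, r)); split => //=; rewrite in_itv.
Qed.

Lemma bproc_int f : bproc a b f ->
  brv b (fun w => \int[mu]_(r in `[a, b]) f w r).
Proof.
move=> bf; apply: (bm_path_integral (S := g_sigma_algebraType (F b))) => //.
by apply: bf; rewrite ab lexx.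
Qed.

End range.
End Adapted.

(** * Backward equations in weak form *)

Section Expectation.
Context d (Omega : measurableType d) (R : realType) (P : probability Omega R).
Local Notation E f := (\int[P]_w f w).
Local Notation bm := (bounded_measurable [set: Omega]).
Implicit Types f g : Omega -> R.

Lemma prob_fin : (P setT < +oo)%E.
Proof. by rewrite /= probability_setT ltry. Qed.

Lemma E_D f g : bm f -> bm g -> E (fun w => f w + g w) = E f + E g.
Proof. by apply: bm_intD => //; exact: prob_fin. Qed.
Lemma E_B f g : bm f -> bm g -> E (fun w => f w - g w) = E f - E g.
Proof. by apply: bm_intB => //; exact: prob_fin. Qed.
Lemma E_Z c f : bm f -> E (fun w => c * f w) = c * E f.
Proof. by apply: bm_intZ => //; exact: prob_fin. Qed.
Lemma E_sum (I : Type) (r : seq I) (p : pred I) (F : I -> Omega -> R) :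
  (forall i, bm (F i)) ->
  E (fun w => \sum_(i <- r | p i) F i w) = \sum_(i <- r | p i) E (F i).
Proof. by apply: bm_int_sum => //; exact: prob_fin. Qed.
Lemma E_le f g : bm f -> bm g -> (forall w, f w <= g w) -> E f <= E g.
Proof. by move=> bf bg fg; apply: bm_le_int => //; exact: prob_fin. Qed.
Lemma E_ae_le f g : bm f -> bm g -> (\forall w \ae P, f w <= g w) -> E f <= E g.
Proof.
move=> bf bg fg; apply: bm_ae_le_int => //; first exact: prob_fin.
by apply: filterS fg => w h _.
Qed.
Lemma E_ae_eq f g : bm f -> bm g -> (\forall w \ae P, f w = g w) -> E f = E g.
Proof.
move=> [mf _] [mg _] fg; apply: bm_ae_eq_int => //.
by apply: filterS fg => w h _.
Qed.
Lemma E_cst c : E (fun=> c) = c.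
Proof. by rewrite Rintegral_cst//= probability_setT mulr1. Qed.
Lemma E_norm f C : bm f -> (forall w, `|f w| <= C) -> `|E f| <= C.
Proof.
move=> bf fC; have := @bm_norm_int _ _ _ P setT measurableT prob_fin f C bf.
by rewrite /= probability_setT mulr1; apply.
Qed.
End Expectation.

Section TimeIntegral.
Context (R : realType).
Local Notation mu := (@lebesgue_measure R).
Variables (a b : R).
Local Notation bm := (bounded_measurable (`[a, b]%classic : set R)).
Local Notation int f := (\int[mu]_(r in `[a, b]) f r).
Implicit Types f g : R -> R.

Lemma int_D f g : bm f -> bm g -> int (fun w => f w + g w) = int f + int g.
Proof. by move=> *; apply: (@bm_intD _ (measurableTypeR R) R mu) => //; exact: lebesgue_itv_fin. Qed.
Lemma int_B f g : bm f -> bm g -> int (fun w => f w - g w) = int f - int g.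
Proof. by move=> *; apply: (@bm_intB _ (measurableTypeR R) R mu) => //; exact: lebesgue_itv_fin. Qed.
Lemma int_N f : bm f -> int (fun w => - f w) = - int f.
Proof. by move=> *; apply: (@bm_intN _ (measurableTypeR R) R mu) => //; exact: lebesgue_itv_fin. Qed.
Lemma int_Z c f : bm f -> int (fun w => c * f w) = c * int f.
Proof. by move=> *; apply: (@bm_intZ _ (measurableTypeR R) R mu) => //; exact: lebesgue_itv_fin. Qed.
Lemma int_sum (I : Type) (r : seq I) (p : pred I) (F : I -> R -> R) :
  (forall i, bm (F i)) ->
  int (fun w => \sum_(i <- r | p i) F i w) = \sum_(i <- r | p i) int (F i).
Proof. by move=> *; apply: (@bm_int_sum _ (measurableTypeR R) R mu) => //; exact: lebesgue_itv_fin. Qed.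
Lemma int_le f g : bm f -> bm g -> (forall r, a <= r <= b -> f r <= g r) ->
  int f <= int g.
Proof.
move=> bf bg fg; by apply: (@bm_le_int _ (measurableTypeR R) R mu) => //; exact: lebesgue_itv_fin.
Qed.
Lemma int_norm f C : a <= b -> bm f -> (forall r, a <= r <= b -> `|f r| <= C) ->
  `|int f| <= C * (b - a).
Proof.
move=> ab bf fC; rewrite -lebesgue_itv//; apply: (@bm_norm_int _ (measurableTypeR R) R mu) => //.
exact: lebesgue_itv_fin.
Qed.
Lemma int_cst c : a <= b -> int (fun=> c) = c * (b - a).
Proof. by move=> ab; rewrite Rintegral_cst//= lebesgue_itv. Qed.
End TimeIntegral.

Section WeakEquation.
Context d (Omega : measurableType d) (R : realType) (P : probability Omega R).
Variables (F : R -> set (set Omega)) (T : R).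
Hypothesis FF : filtration F T.
Local Notation mu := (@lebesgue_measure R).
Local Notation E f := (\int[P]_w f w).
Local Notation brv := (brv F).
Local Notation bproc := (bproc F).

(** What remains of [dD = - f dt + M dW] after testing against bounded
    variables known at time [s]: the martingale part has mean zero. The form
    mentions no stochastic integral and is stable under bounded limits of [D]
    and [f]. *)
Definition weak_equation (a b : R) (D f : Omega -> R -> R) : Prop :=
  forall s r phi, a <= s -> s <= r -> r <= b -> brv s phi ->
  E (fun w => phi w * (D w r - D w s)) =
  - \int[mu]_(q in `[s, r]) E (fun w => phi w * f w q).

Lemma bproc_mean a b f : 0 <= a -> a <= b -> b <= T -> bproc a b f ->
  bounded_measurable (`[a, b]%classic : set R) (fun q => E (fun w => f w q)).
Proof.
by move=> a0 ab bT bf; apply: bm_mean; exact: (bproc_joint FF).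
Qed.

Lemma bproc_fubini a b f : 0 <= a -> a <= b -> b <= T -> bproc a b f ->
  E (fun w => \int[mu]_(r in `[a, b]) f w r) =
  \int[mu]_(r in `[a, b]) E (fun w => f w r).
Proof.
by move=> a0 ab bT bf; apply: Rfubini; exact: (bproc_joint FF).
Qed.

Section step.
Variables (s r M : R) (s0 : 0 <= s) (sr : s <= r) (rT : r <= T) (M0 : 0 <= M).
Variables (q f : Omega -> R -> R).
Hypotheses (bq : bproc s r q) (bf : bproc s r f).
Hypothesis fM : forall w p, s <= p <= r -> `|f w p| <= M.
Hypothesis qM : forall w p, s <= p <= r -> `|q w p| <= M.
Hypothesis qf : weak_equation s r q f.

Let sT : s <= T := le_trans sr rT.
Let r0 : 0 <= r := le_trans s0 sr.

Let norm3 (x y z : R) : `|x| <= M -> `|y| <= M -> `|z| <= M ->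
  `|x * y * z| <= M ^+ 3.
Proof.
move=> xM yM zM; rewrite !normrM (_ : M ^+ 3 = M * M * M); last by ring.
by rewrite !ler_pM// mulr_ge0.
Qed.

(** Freezing [q] at the end of the step costs only the square of the step
    length: [beta p * u] is known at time [p], so it can test the equation of
    [q] on [[p, r]]. *)
Let drift_step u beta : brv s u -> (forall w, `|u w| <= M) -> bproc s r beta ->
  (forall w p, s <= p <= r -> `|beta w p| <= M) ->
  `|E (fun w => (\int[mu]_(p in `[s, r]) beta w p) * u w * q w r) -
    \int[mu]_(p in `[s, r]) E (fun w => beta w p * u w * q w p)|
  <= M ^+ 3 * (r - s) ^+ 2.
Proof.
move=> bu uM bb bM.
have bpu : bproc s r (fun w _ => u w) by apply: (bproc_brv FF).
have bqr : bounded_measurable [set: Omega] (q ^~ r).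
  apply: (brv_bm FF (t := r)); first by rewrite r0.
  by apply: (bproc_time (a := s) (b := r)) => //; rewrite sr lexx.
have jqr : jointly_bm (S := Omega) s r (fun w _ => q w r).
  have [mq [C qC]] := bqr; split; last by exists C => z _; exact: qC.
  by apply: measurable_funTS; exact: (measurableT_comp mq measurable_fst).
have bbu : bproc s r (fun w p => beta w p * u w) by exact: bprocM.
have jbu := bproc_joint FF s0 sr rT bbu.
have jb := bproc_joint FF s0 sr rT bb.
have jbuq : jointly_bm (S := Omega) s r (fun w p => beta w p * u w * q w r).
  exact: (bmM jbu jqr).
have bbuq : bproc s r (fun w p => beta w p * u w * q w p) by exact: bprocM.
have -> : E (fun w => (\int[mu]_(p in `[s, r]) beta w p) * u w * q w r) =
    \int[mu]_(p in `[s, r]) E (fun w => beta w p * u w * q w r).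
  rewrite -Rfubini//; congr Rintegral; apply/funext => w.
  rewrite -mulrA mulrC -int_Z; last exact: jbm_path jb.
  by congr Rintegral; apply/funext => p; rewrite mulrC mulrA.
rewrite -int_B; [|exact: bm_mean|exact: bproc_mean].
rewrite expr2 mulrA; apply: int_norm => //.
  by apply: bmB; [exact: bm_mean|exact: bproc_mean].
move=> p /andP[sp pr].
have b1 : brv p (fun w => beta w p * u w).
  by apply: (bproc_time (a := s) (b := r) _ (f := fun w p => beta w p * u w)); rewrite ?sp.
have pT : 0 <= p <= T by rewrite (le_trans s0)// (le_trans pr).
have bmp := brv_bm FF pT b1.
have bqp : bounded_measurable [set: Omega] (q ^~ p).
  by apply: (brv_bm FF pT); apply: (bproc_time (a := s) (b := r)); rewrite ?sp.
rewrite -E_B; [|exact: (bmM bmp bqr)|exact: (bmM bmp bqp)].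
have -> : E (fun w => beta w p * u w * q w r - beta w p * u w * q w p) =
    E (fun w => (beta w p * u w) * (q w r - q w p)).
  by congr Rintegral; apply/funext => w; ring.
rewrite (qf sp pr (lexx r) b1) normrN.
apply: (@le_trans _ _ (M ^+ 3 * (r - p))); last first.
  by rewrite ler_wpM2l ?exprn_ge0// lerB.
have p0 := le_trans s0 sp.
have bpf : bproc p r (fun w x => beta w p * u w * f w x).
  apply: bprocM; first exact: (bproc_brv FF).
  exact: bproc_sub bf.
apply: int_norm => //; first exact: bproc_mean.
move=> x /andP[px xr]; apply: E_norm.
  apply: (brv_bm FF (t := x)).
    by rewrite (le_trans p0 px)/= (le_trans xr).
  by apply: (bproc_time (a := p) (b := r) _ bpf); rewrite px.
move=> w; apply: norm3 => //; first by apply: bM; rewrite sp.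
by apply: fM; rewrite xr (le_trans sp).
Qed.

(** The product rule over one step, up to a quadratic error. The factors [u]
    and [v] are absolutely continuous, so there is no bracket with the
    martingale part of [q], and the product of their increments is itself
    quadratic. *)
Lemma product_step u v u' v' beta eta :
  brv s u -> brv s v -> bproc s r beta -> bproc s r eta ->
  (forall w, `|u w| <= M) -> (forall w, `|v w| <= M) ->
  (forall w p, s <= p <= r -> `|beta w p| <= M) ->
  (forall w p, s <= p <= r -> `|eta w p| <= M) ->
  brv r u' -> brv r v' ->
  (\forall w \ae P, u' w = u w + \int[mu]_(p in `[s, r]) beta w p) ->
  (\forall w \ae P, v' w = v w + \int[mu]_(p in `[s, r]) eta w p) ->
  `|E (fun w => u' w * v' w * q w r) - E (fun w => u w * v w * q w s)
    - \int[mu]_(p in `[s, r]) E (fun w => beta w p * v w * q w p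
        + eta w p * u w * q w p - u w * v w * f w p)|
  <= 3 * M ^+ 3 * (r - s) ^+ 2.
Proof.
move=> bu bv bb be uM vM bM eM bu' bv' u'E v'E.
have rr : 0 <= r <= T by rewrite r0.
have ss : 0 <= s <= T by rewrite s0.
have tu := brv_bm FF ss bu; have tv := brv_bm FF ss bv.
have tu' := brv_bm FF rr bu'; have tv' := brv_bm FF rr bv'.
have tqr : bounded_measurable [set: Omega] (q ^~ r).
  by apply: (brv_bm FF rr); apply: (bproc_time (a := s) (b := r)); rewrite ?sr//=.
have tqs : bounded_measurable [set: Omega] (q ^~ s).
  by apply: (brv_bm FF ss); apply: (bproc_time (a := s) (b := r)); rewrite ?lexx//=.
have jb := bproc_joint FF s0 sr rT bb; have je := bproc_joint FF s0 sr rT be.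
pose B w := \int[mu]_(p in `[s, r]) beta w p.
pose H w := \int[mu]_(p in `[s, r]) eta w p.
have tB : bounded_measurable [set: Omega] B by exact: bm_path_integral.
have tH : bounded_measurable [set: Omega] H by exact: bm_path_integral.
have -> : E (fun w => u' w * v' w * q w r) =
    E (fun w => u w * v w * q w r) + E (fun w => B w * v w * q w r)
    + E (fun w => H w * u w * q w r) + E (fun w => B w * H w * q w r).
  rewrite -!E_D; do ?[exact: bmM|apply: bmM|apply: bmD] => //.
  apply: E_ae_eq; do ?[apply: bmM|apply: bmD] => //.
  by apply: filterS2 u'E v'E => w -> ->; rewrite -/(B w) -/(H w); ring.
have bpu : bproc s r (fun w _ => u w) by apply: (bproc_brv FF).
have bpv : bproc s r (fun w _ => v w) by apply: (bproc_brv FF).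
have b1 : bproc s r (fun w p => beta w p * v w * q w p) by do 2 apply: bprocM => //.
have b2 : bproc s r (fun w p => eta w p * u w * q w p) by do 2 apply: bprocM => //.
have b3 : bproc s r (fun w p => u w * v w * f w p) by do 2 apply: bprocM => //.
have -> : \int[mu]_(p in `[s, r]) E (fun w => beta w p * v w * q w p
        + eta w p * u w * q w p - u w * v w * f w p) =
   \int[mu]_(p in `[s, r]) E (fun w => beta w p * v w * q w p) +
   \int[mu]_(p in `[s, r]) E (fun w => eta w p * u w * q w p) -
   \int[mu]_(p in `[s, r]) E (fun w => u w * v w * f w p).
  rewrite -int_D; [|exact: bproc_mean|exact: bproc_mean].
  rewrite -int_B; [|by apply: bmD; exact: bproc_mean|exact: bproc_mean].
  apply: eq_Rintegral => p /set_mem/=; rewrite in_itv/= => /andP[sp pr].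
  have pT : 0 <= p <= T by rewrite (le_trans s0 sp) (le_trans pr).
  have tp g : bproc s r g -> bounded_measurable [set: Omega] (g ^~ p).
    by move=> bg; apply: (brv_bm FF pT); apply: (bproc_time (a := s) (b := r)) => //; rewrite sp.
  rewrite -E_D; [|exact: tp b1|exact: tp b2].
  by rewrite -E_B//; [apply: bmD; [exact: tp b1|exact: tp b2]|exact: tp b3].
have h0 : E (fun w => u w * v w * q w r) - E (fun w => u w * v w * q w s) =
   - \int[mu]_(p in `[s, r]) E (fun w => u w * v w * f w p).
  rewrite -(qf (lexx s) sr (lexx r) (brvM bu bv)) -E_B; do ?apply: bmM => //.
  by congr Rintegral; apply/funext => w; ring.
have h1 := drift_step bv vM bb bM.
have h2 := drift_step bu uM be eM.
have h3 : `|E (fun w => B w * H w * q w r)| <= M ^+ 3 * (r - s) ^+ 2.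
  apply: E_norm; first by do 2 apply: bmM => //.
  have bnd g w : bproc s r g -> (forall w p, s <= p <= r -> `|g w p| <= M) ->
      `|\int[mu]_(p in `[s, r]) g w p| <= M * (r - s).
    move=> bg gM; apply: int_norm => //; last by move=> p; exact: gM.
    by apply: jbm_path; exact: (bproc_joint FF s0 sr rT bg).
  move=> w; rewrite !normrM.
  have -> : M ^+ 3 * (r - s) ^+ 2 = (M * (r - s)) * (M * (r - s)) * M by ring.
  have h : 0 <= r - s by rewrite subr_ge0.
  by rewrite !ler_pM ?mulr_ge0 ?bnd ?qM ?sr ?lexx.
rewrite -/(B _) in h1.
move: h1 h2 h3 h0; rewrite -/B -/H.
set e0 := E (fun w => u w * v w * q w r).
set e0' := E (fun w => u w * v w * q w s).
set e1 := E (fun w => B w * v w * q w r).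
set e2 := E (fun w => H w * u w * q w r).
set e3 := E (fun w => B w * H w * q w r).
set i0 := Rintegral mu _ (fun p => E (fun w => u w * v w * f w p)).
set i1 := Rintegral mu _ (fun p => E (fun w => beta w p * v w * q w p)).
set i2 := Rintegral mu _ (fun p => E (fun w => eta w p * u w * q w p)).
rewrite !ler_norml => /andP[h1 h1'] /andP[h2 h2'] /andP[h3 h3'] h0.
by apply/andP; split; lra.
Qed.
End step.
End WeakEquation.

(** * Quadratic forms along an absolutely continuous process *)

Section Bilinear.
Context (R : realType) (m : nat).
Implicit Types (A : 'M[R]_m) (u v : 'cV[R]_m).

Definition bilin u A v : R := (u^T *m A *m v) 0 0.

Lemma bilinE u A v :
  bilin u A v = \sum_i \sum_j u i 0 * v j 0 * A i j.
Proof.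
rewrite /bilin mxE exchange_big /=; apply: eq_bigr => j _.
rewrite mxE mulr_suml; apply: eq_bigr => i _.
by rewrite !mxE mulrAC.
Qed.

Lemma bilinDl u u' A v : bilin (u + u') A v = bilin u A v + bilin u' A v.
Proof. by rewrite /bilin linearD !mulmxDl mxE. Qed.
Lemma bilinDr u A v v' : bilin u A (v + v') = bilin u A v + bilin u A v'.
Proof. by rewrite /bilin mulmxDr mxE. Qed.
Lemma bilinDm u A B v : bilin u (A + B) v = bilin u A v + bilin u B v.
Proof. by rewrite /bilin mulmxDr mulmxDl mxE. Qed.
Lemma bilinNl u A v : bilin (- u) A v = - bilin u A v.
Proof. by rewrite /bilin linearN !mulNmx mxE. Qed.
Lemma bilinNr u A v : bilin u A (- v) = - bilin u A v.
Proof. by rewrite /bilin mulmxN mxE. Qed.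
Lemma bilinNm u A v : bilin u (- A) v = - bilin u A v.
Proof. by rewrite /bilin mulmxN mulNmx mxE. Qed.
Lemma bilinZl c u A v : bilin (c *: u) A v = c * bilin u A v.
Proof. by rewrite /bilin linearZ -!scalemxAl mxE. Qed.
Lemma bilinZr c u A v : bilin u A (c *: v) = c * bilin u A v.
Proof. by rewrite /bilin -scalemxAr mxE. Qed.
Lemma bilinT u A v : bilin u A v = bilin v A^T u.
Proof.
rewrite /bilin -[in RHS](trmxK u) -!trmx_mul mulmxA.
by rewrite [in RHS]mxE.
Qed.
Lemma bilin_sym u A v : A^T = A -> bilin u A v = bilin v A u.
Proof. by move=> AT; rewrite bilinT AT. Qed.
End Bilinear.

Section EulerSums.
Context (R : realType).

Lemma ge0_of_inv_lower_bound (K x : R) :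
  (forall N : nat, - (K / N.+1%:R) <= x) -> 0 <= x.
Proof.
move=> h; rewrite leNgt; apply/negP => x0.
have K0 : 0 < K.
  by have := h 0; rewrite divr1 => /le_lt_trans/(_ x0); rewrite oppr_lt0.
have [N] : exists N : nat, K / - x < N.+1%:R.
  exists (Num.truncn (K / - x)); apply: truncnS_gt.
rewrite ltr_pdivrMr ?oppr_gt0// => KN.
have := h N; rewrite lerNl ler_pdivlMr ?ltr0n// mulrC => /lt_le_trans.
by move=> /(_ _ KN); rewrite ltxx.
Qed.

(** Over [N] equal steps the errors add up to [K * (b - a) ^+ 2 / N], which
    vanishes. *)
Lemma quadratic_increment_nonincreasing (g : R -> R) (K a b : R) : a <= b ->
  (forall s r, a <= s -> s <= r -> r <= b -> g r - g s <= K * (r - s) ^+ 2) ->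
  g b <= g a.
Proof.
move=> ab gK; rewrite -subr_ge0; apply: (@ge0_of_inv_lower_bound (K * (b - a) ^+ 2)).
move=> N; set h := (b - a) / N.+1%:R.
have h0 : 0 <= h by rewrite divr_ge0// subr_ge0.
have Nh : N.+1%:R * h = b - a by rewrite mulrC divfK// pnatr_eq0.
have ind (j : nat) : (j <= N.+1)%N -> g (a + j%:R * h) - g a <= j%:R * (K * h ^+ 2).
  elim: j => [_|j ih jN]; first by rewrite !mul0r addr0 subrr.
  have step : g (a + j.+1%:R * h) - g (a + j%:R * h) <= K * h ^+ 2.
    have -> : h ^+ 2 = ((a + j.+1%:R * h) - (a + j%:R * h)) ^+ 2.
      by congr (_ ^+ 2); rewrite -natr1; ring.
    apply: gK.
    - by rewrite lerDl mulr_ge0.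
    - by rewrite lerD2l ler_wpM2r// ler_nat.
    - by rewrite -lerBrDl -Nh ler_wpM2r// ler_nat.
  have -> : j.+1%:R * (K * h ^+ 2) = j%:R * (K * h ^+ 2) + K * h ^+ 2.
    by rewrite -natr1; ring.
  by have := ih (ltnW jN); lra.
have := ind N.+1 (leqnn _); rewrite Nh (_ : a + (b - a) = b); last by ring.
have -> : N.+1%:R * (K * h ^+ 2) = K * (b - a) ^+ 2 / N.+1%:R.
  have : N.+1%:R != 0 :> R by rewrite pnatr_eq0.
  by rewrite /h; move: N.+1%:R => n n0; field.
by rewrite lerNl opprB.
Qed.
End EulerSums.

Lemma lebesgue_ae_filter (R : realType) :
  Filter (nbhs (almost_everywhere (@lebesgue_measure R))).
Proof. exact: (@ae_filter_ringOfSetsType _ (measurableTypeR R)). Qed.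
#[global] Hint Resolve lebesgue_ae_filter : typeclass_instances.

Section ProductNull.
Context d (S : measurableType d) (R : realType) (P : probability S R).
Local Notation mu := (@lebesgue_measure R).

Lemma ae_product_path (A : S * R -> Prop) :
  (\forall z \ae (P \x mu)%E, A z) ->
  \forall w \ae P, \forall r \ae mu, A (w, r).
Proof.
move=> [B [mB B0 AB]].
have mX := measurable_fun_xsection (mu) mB.
have : (\int[P]_w (mu \o xsection B) w = 0)%E by exact: B0.
have -> : (\int[P]_w (mu \o xsection B) w = \int[P]_(w in setT) `|(mu \o xsection B) w|)%E.
  by apply: eq_integral => w _; rewrite gee0_abs//; exact: measure_ge0.
move=> /(ae_eq_integral_abs P measurableT mX).1.
apply: filterS => w /(_ I) /= h; exists (xsection B w); split => //.
  exact: measurable_xsection.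
by move=> r /= Awr; rewrite /xsection/= inE; exact: AB.
Qed.
End ProductNull.

Section QuadraticStep.
Context d (Omega : measurableType d) (R : realType) (P : probability Omega R).
Variables (F : R -> set (set Omega)) (T : R).
Hypothesis FF : filtration F T.
Local Notation mu := (@lebesgue_measure R).
Local Notation E f := (\int[P]_w f w).

Definition mx_brv m n (t : R) (V : Omega -> 'M[R]_(m, n)) : Prop :=
  forall i j, brv F t (fun w => V w i j).

Definition mx_bproc m n (a b : R) (D : Omega -> R -> 'M[R]_(m, n)) : Prop :=
  forall i j, bproc F a b (fun w r => D w r i j).

Definition mx_weak_equation m (a b : R) (D f : Omega -> R -> 'M[R]_m) : Prop :=
  forall i j, weak_equation P F a b (fun w r => D w r i j) (fun w r => f w r i j).

Lemma mx_bproc_bound m n a b (D : Omega -> R -> 'M[R]_(m, n)) :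
  0 <= a -> a <= b -> b <= T -> mx_bproc a b D ->
  exists2 C, 0 <= C & forall w r i j, a <= r <= b -> `|D w r i j| <= C.
Proof.
move=> a0 ab bT bD.
have h (ij : 'I_m * 'I_n) : {C | forall w r, a <= r <= b -> `|D w r ij.1 ij.2| <= C}.
  by apply: cid; exact: (bproc_bound FF a0 ab bT (bD ij.1 ij.2)).
exists (\sum_ij `|sval (h ij)|); first by apply: sumr_ge0.
move=> w r i j rab; have /= := svalP (h (i, j)) w r rab => /le_trans; apply.
rewrite (bigD1 (i, j))//= (le_trans (ler_norm _))// lerDl.
exact: sumr_ge0.
Qed.

Lemma mx_brv_bound m n t (V : Omega -> 'M[R]_(m, n)) : mx_brv t V ->
  exists2 C, 0 <= C & forall w i j, `|V w i j| <= C.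
Proof.
move=> bV.
have h (ij : 'I_m * 'I_n) : {C | forall w, `|V w ij.1 ij.2| <= C}.
  by apply: cid; have [_ [C VC]] := bV ij.1 ij.2; exists C => w; exact: VC.
exists (\sum_ij `|sval (h ij)|); first by apply: sumr_ge0.
move=> w i j; have /= := svalP (h (i, j)) w => /le_trans; apply.
rewrite (bigD1 (i, j))//= (le_trans (ler_norm _))// lerDl.
exact: sumr_ge0.
Qed.

Lemma mx_bproc_brv m n a b (V : Omega -> 'M[R]_(m, n)) :
  0 <= a -> a <= b -> b <= T -> mx_brv a V -> mx_bproc a b (fun w _ => V w).
Proof. by move=> a0 ab bT bV i j; apply: (bproc_brv FF). Qed.

Lemma mx_bproc_mul m n p a b (A : Omega -> R -> 'M[R]_(m, n))
    (B : Omega -> R -> 'M[R]_(n, p)) :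
  mx_bproc a b A -> mx_bproc a b B -> mx_bproc a b (fun w r => A w r *m B w r).
Proof.
move=> bA bB i j; apply: (eq_bproc (f := fun w r => \sum_k A w r i k * B w r k j)).
  by move=> w r _; rewrite mxE.
by apply: bproc_sum => k; exact: bprocM.
Qed.

Lemma mx_bprocD m n a b (A B : Omega -> R -> 'M[R]_(m, n)) :
  mx_bproc a b A -> mx_bproc a b B -> mx_bproc a b (fun w r => A w r + B w r).
Proof.
move=> bA bB i j; apply: (eq_bproc (f := fun w r => A w r i j + B w r i j)).
  by move=> w r _; rewrite mxE.
exact: bprocD.
Qed.

Lemma mx_bprocN m n a b (A : Omega -> R -> 'M[R]_(m, n)) :
  mx_bproc a b A -> mx_bproc a b (fun w r => - A w r).
Proof.
move=> bA i j; apply: (eq_bproc (f := fun w r => - A w r i j)).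
  by move=> w r _; rewrite mxE.
exact: bprocN.
Qed.

Lemma mx_bprocT m n a b (A : Omega -> R -> 'M[R]_(m, n)) :
  mx_bproc a b A -> mx_bproc a b (fun w r => (A w r)^T).
Proof.
move=> bA i j; apply: (eq_bproc (f := fun w r => A w r j i)) => //.
by move=> w r _; rewrite mxE.
Qed.

Lemma mx_bproc_cst m n a b (A : 'M[R]_(m, n)) : mx_bproc a b (fun _ _ => A).
Proof. by move=> i j; exact: bproc_cst. Qed.

Lemma mx_bproc_sub m n a b a' b' (A : Omega -> R -> 'M[R]_(m, n)) :
  a <= a' -> b' <= b -> mx_bproc a b A -> mx_bproc a' b' A.
Proof. by move=> aa bb bA i j; exact: bproc_sub (bA i j). Qed.

Lemma mx_bproc_time m n a b (A : Omega -> R -> 'M[R]_(m, n)) r :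
  a <= r <= b -> mx_bproc a b A -> mx_brv r (A ^~ r).
Proof. by move=> rab bA i j; exact: bproc_time (bA i j). Qed.

Lemma bproc_bilin m a b (u v : Omega -> R -> 'cV[R]_m) A :
  mx_bproc a b u -> mx_bproc a b A -> mx_bproc a b v ->
  bproc F a b (fun w r => bilin (u w r) (A w r) (v w r)).
Proof.
move=> bu bA bv.
apply: (@mx_bproc_mul _ _ _ a b (fun w r => (u w r)^T *m A w r) v _ bv 0 0).
by apply: mx_bproc_mul => //; exact: mx_bprocT.
Qed.

Lemma brv_bilin m t (u v : Omega -> 'cV[R]_m) A :
  mx_brv t u -> mx_brv t A -> mx_brv t v ->
  brv F t (fun w => bilin (u w) (A w) (v w)).
Proof.
move=> bu bA bv; under eq_fun do rewrite bilinE.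
do 2 (apply: brv_sum => ?); apply: brvM => //; exact: brvM.
Qed.

Lemma int_mean_le0 a b g : 0 <= a -> a <= b -> b <= T -> bproc F a b g ->
  (\forall w \ae P, \forall p \ae mu, a <= p <= b -> g w p <= 0) ->
  \int[mu]_(p in `[a, b]) E (fun w => g w p) <= 0.
Proof.
move=> a0 ab bT bg g0; rewrite -(bproc_fubini P FF a0 ab bT bg).
have jg := bproc_joint FF a0 ab bT bg.
rewrite -[leRHS](E_cst P 0); apply: E_ae_le => //.
- exact: bm_path_integral.
- exact: bm_cst.
apply: filterS g0 => w gw.
rewrite -[leRHS](_ : \int[mu]_(p in `[a, b]) 0 = 0); last first.
  by rewrite int_cst// mul0r.
apply: (@bm_ae_le_int _ (measurableTypeR R) R mu) => //.
- exact: lebesgue_itv_fin.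
- exact: jbm_path jg.
- exact: bm_cst.
Qed.

(** The time derivative of [E (V^T D V)] when [V] moves with speed [beta]: the
    equation of [D] enters only through its drift [f], since [V] is absolutely
    continuous. The entries of [V V^T] are products of two absolutely
    continuous factors. *)
Lemma quadratic_step m s r M (D f : Omega -> R -> 'M[R]_m)
    (V V' : Omega -> 'cV[R]_m) (beta : Omega -> R -> 'cV[R]_m) :
  0 <= s -> s <= r -> r <= T -> 0 <= M ->
  mx_bproc s r D -> mx_bproc s r f -> mx_bproc s r beta ->
  mx_brv s V -> mx_brv r V' -> mx_weak_equation s r D f ->
  (forall w p i j, s <= p <= r -> `|D w p i j| <= M) ->
  (forall w p i j, s <= p <= r -> `|f w p i j| <= M) ->
  (forall w p i j, s <= p <= r -> `|beta w p i j| <= M) ->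
  (forall w i j, `|V w i j| <= M) ->
  (\forall w \ae P, V' w = V w + mx_integral `[s, r] (beta w)) ->
  `|E (fun w => bilin (V' w) (D w r) (V' w)) - E (fun w => bilin (V w) (D w s) (V w))
    - \int[mu]_(p in `[s, r]) E (fun w => bilin (beta w p) (D w p) (V w)
       + bilin (V w) (D w p) (beta w p) - bilin (V w) (f w p) (V w))|
  <= (m * m)%:R * (3 * M ^+ 3) * (r - s) ^+ 2.
Proof.
move=> s0 sr rT M0 bD bf bb bV bV' Df DM fM bM VM V'E.
have r0 := le_trans s0 sr; have sT := le_trans sr rT.
have rr : 0 <= r <= T by rewrite r0.
have ss : 0 <= s <= T by rewrite s0.
have bDr : mx_brv r (D ^~ r) by apply: (mx_bproc_time (a := s) (b := r)); rewrite ?sr ?lexx.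
have bDs : mx_brv s (D ^~ s) by apply: (mx_bproc_time (a := s) (b := r)); rewrite ?sr ?lexx.
have E_bilin t (U : Omega -> 'cV[R]_m) (A : Omega -> 'M[R]_m) : 0 <= t <= T ->
    mx_brv t U -> mx_brv t A ->
    E (fun w => bilin (U w) (A w) (U w)) =
    \sum_i \sum_j E (fun w => U w i 0 * U w j 0 * A w i j).
  move=> tT bU bA; under eq_Rintegral do rewrite bilinE.
  rewrite E_sum => [|i]; last first.
    apply: (brv_bm FF tT); apply: brv_sum => j; apply: brvM => //; exact: brvM.
  apply: eq_bigr => i _; rewrite E_sum// => j.
  by apply: (brv_bm FF tT); apply: brvM => //; exact: brvM.
have bVp : mx_bproc s r (fun w _ => V w) by exact: mx_bproc_brv.
pose g i j w p := beta w p i 0 * V w j 0 * D w p i j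
  + beta w p j 0 * V w i 0 * D w p i j - V w i 0 * V w j 0 * f w p i j.
have bg i j : bproc F s r (g i j).
  apply: bprocB; last by apply: bprocM => //; apply: bprocM; [exact: (bVp i)|exact: (bVp j)].
  by apply: bprocD; do 2 apply: bprocM => //.
rewrite (E_bilin r)// (E_bilin s)//.
have -> : \int[mu]_(p in `[s, r]) E (fun w => bilin (beta w p) (D w p) (V w)
       + bilin (V w) (D w p) (beta w p) - bilin (V w) (f w p) (V w)) =
    \sum_i \sum_j \int[mu]_(p in `[s, r]) E (fun w => g i j w p).
  under [RHS]eq_bigr => i _.
    rewrite -int_sum => [|j]; last by apply: (bproc_mean P FF).
    over.
  rewrite -int_sum => [|i]; last first.
    by apply: bm_sum => j; apply: (bproc_mean P FF).
  apply: eq_Rintegral => p /set_mem/=; rewrite in_itv/= => psr.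
  have pT : 0 <= p <= T.
    by case/andP: psr => sp pr; rewrite (le_trans s0 sp) (le_trans pr).
  have tg i j : bounded_measurable [set: Omega] (g i j ^~ p).
    by apply: (brv_bm FF pT); apply: bproc_time (bg i j).
  under [RHS]eq_bigr => i _ do rewrite -E_sum//.
  rewrite -E_sum => [|i]; last exact: bm_sum.
  apply: eq_Rintegral => w _; rewrite !bilinE -big_split /= -sumrB.
  apply: eq_bigr => i _; rewrite -big_split /= -sumrB; apply: eq_bigr => j _.
  by rewrite /g; ring.
rewrite -!sumrB.
under eq_bigr => i _ do rewrite -!sumrB.
apply: (le_trans (ler_norm_sum _ _ _)).
have -> : (m * m)%:R * (3 * M ^+ 3) * (r - s) ^+ 2 =
    \sum_(i < m) \sum_(j < m) 3 * M ^+ 3 * (r - s) ^+ 2.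
  by rewrite !sumr_const !card_ord -mulrnA -[RHS]mulr_natl -!mulrA.
apply: ler_sum => i _; apply: (le_trans (ler_norm_sum _ _ _)).
apply: ler_sum => j _.
have V'i k : \forall w \ae P, V' w k 0 = V w k 0 + \int[mu]_(p in `[s, r]) beta w p k 0.
  by apply: filterS V'E => w ->; rewrite !mxE.
apply: (@product_step _ _ _ P F T FF s r M s0 sr rT M0 (fun w p => D w p i j)
  (fun w p => f w p i j) (bD i j) (bf i j) _ _ _
  (fun w => V w i 0) (fun w => V w j 0) (fun w => V' w i 0) (fun w => V' w j 0)
  (fun w p => beta w p i 0) (fun w p => beta w p j 0)) => //.
- by move=> w p; exact: fM.
- by move=> w p; exact: DM.
- by move=> w p; exact: bM.
- by move=> w p; exact: bM.
Qed.
End QuadraticStep.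

(** * A comparison principle for linear equations *)

Section Comparison.
Context d (Omega : measurableType d) (R : realType) (P : probability Omega R).
Variables (F : R -> set (set Omega)) (T : R).
Hypothesis FF : filtration F T.
Local Notation mu := (@lebesgue_measure R).
Local Notation E f := (\int[P]_w f w).

Lemma mulmx_bound m n p (A : 'M[R]_(m, n)) (B : 'M[R]_(n, p)) a b :
  (forall i j, `|A i j| <= a) -> (forall i j, `|B i j| <= b) -> 0 <= a ->
  forall i j, `|(A *m B) i j| <= n%:R * (a * b).
Proof.
move=> Aa Bb a0 i j; rewrite mxE (le_trans (ler_norm_sum _ _ _))//.
have -> : n%:R * (a * b) = \sum_(k < n) a * b.
  by rewrite sumr_const card_ord mulr_natl.
by apply: ler_sum => k _; rewrite normrM ler_pM.
Qed.

Lemma mx_brv_integral m n s r (V : Omega -> 'M[R]_(m, n)) beta :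
  0 <= s -> s <= r -> r <= T -> mx_brv F s V -> mx_bproc F s r beta ->
  mx_brv F r (fun w => V w + mx_integral `[s, r] (beta w)).
Proof.
move=> s0 sr rT bV bb i j.
have -> : (fun w => (V w + mx_integral `[s, r] (beta w)) i j) =
    (fun w => V w i j + \int[mu]_(p in `[s, r]) beta w p i j).
  by apply/funext => w; rewrite !mxE.
apply: brvD; first by apply: (brv_mono FF (s := s)) => //; exact: bV.
exact: (bproc_int sr (bb i j)).
Qed.

Section linear.
Variables (m : nat) (s e : R) (s0 : 0 <= s) (se : s <= e) (eT : e <= T).
Variables (D f C : Omega -> R -> 'M[R]_m).
Hypotheses (bD : mx_bproc F s e D) (bf : mx_bproc F s e f)
  (bC : mx_bproc F s e C) (Df : mx_weak_equation P F s e D f).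
Hypothesis fC : \forall w \ae P, \forall p \ae mu, s <= p <= e ->
  forall v, bilin (C w p *m v) (D w p) v + bilin v (D w p) (C w p *m v)
    <= bilin v (f w p) v.
Hypothesis De : \forall w \ae P, forall v, 0 <= bilin v (D w e) v.

(** If [V] moved with [dV = C V dt], the function [E (V^T D V)] would be
    nonincreasing by the hypothesis on [f], and it is nonnegative at time [e].
    Euler polygons replace this flow, so no differential equation has to be
    solved; their total error is of the order of the mesh. *)
Lemma linear_comparison (V : Omega -> 'cV[R]_m) : mx_brv F s V ->
  0 <= E (fun w => bilin (V w) (D w s) (V w)).
Proof.
move=> bV.
have [V0 V00 VV0] := mx_brv_bound bV.
have [BD BD0 DB] := mx_bproc_bound FF s0 se eT bD.
have [Bf Bf0 fB] := mx_bproc_bound FF s0 se eT bf.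
have [BC BC0 CB] := mx_bproc_bound FF s0 se eT bC.
pose k := m%:R * BC; have k0 : 0 <= k by rewrite mulr_ge0.
(* Each Euler step multiplies the bound on the test vector by at most
   [1 + k * h]. *)
pose M' := V0 * expR (k * (e - s)).
have M'0 : 0 <= M' by rewrite mulr_ge0// expR_ge0.
pose M := BD + Bf + M' + m%:R * (BC * M').
have mM'0 : 0 <= m%:R * (BC * M') by rewrite !mulr_ge0.
have M0 : 0 <= M by rewrite /M !addr_ge0.
pose K := (m * m)%:R * (3 * M ^+ 3).
apply: (@ge0_of_inv_lower_bound _ (K * (e - s) ^+ 2)) => N.
set h := (e - s) / N.+1%:R.
have h0 : 0 <= h by rewrite divr_ge0// subr_ge0.
have Nh : N.+1%:R * h = e - s by rewrite mulrC divfK// pnatr_eq0.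
have kh0 : 0 < 1 + k * h by rewrite ltr_pwDl// mulr_ge0.
(* Backward induction over an Euler grid; the bound on the test vector
   shrinks so that every Euler iterate stays below [M']. *)
have ind (j : nat) : (j <= N.+1)%N -> forall U : Omega -> 'cV[R]_m,
    mx_brv F (e - j%:R * h) U ->
    (forall w i l, `|U w i l| * (1 + k * h) ^+ j <= M') ->
    - (j%:R * (K * h ^+ 2)) <=
    E (fun w => bilin (U w) (D w (e - j%:R * h)) (U w)).
  elim: j => [_ U bU _|j ih jN U bU UM].
    have e0 : e - 0%:R * h = e by rewrite mul0r subr0.
    rewrite mul0r oppr0 e0; rewrite e0 in bU.
    have ee : 0 <= e <= T by rewrite (le_trans s0).
    rewrite -[leLHS](E_cst P 0); apply: E_ae_le.
    - exact: bm_cst.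
    - apply: (brv_bm FF ee); apply: brv_bilin => //.
      by apply: mx_bproc_time bD; rewrite se lexx.
    - by apply: filterS De => w; exact.
  set s' := e - j.+1%:R * h; set r := e - j%:R * h.
  have rs' : r - s' = h by rewrite /r /s' -natr1; ring.
  have s's : s <= s' by rewrite /s' lerBrDr -lerBrDl -Nh ler_wpM2r// ler_nat.
  have s'r : s' <= r by rewrite -subr_ge0 rs'.
  have re : r <= e by rewrite /r gerBl mulr_ge0.
  have s'0 := le_trans s0 s's; have rT := le_trans re eT.
  have sub p : s' <= p <= r -> s <= p <= e.
    by case/andP => sp pr; rewrite (le_trans s's sp) (le_trans pr re).
  have bDr := mx_bproc_sub s's re bD; have bfr := mx_bproc_sub s's re bf.
  have bCr := mx_bproc_sub s's re bC.
  have UM' w i l : `|U w i l| <= M'.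
    apply: le_trans (UM w i l); rewrite ler_peMr// exprn_ege1//.
    by rewrite lerDl mulr_ge0.
  pose beta w p := C w p *m U w.
  have bb : mx_bproc F s' r beta.
    by apply: mx_bproc_mul => //; apply: (mx_bproc_brv FF).
  have betaM w p i l : s' <= p <= r -> `|beta w p i l| <= m%:R * (BC * M').
    move=> /sub pse; apply: mulmx_bound => // a b; exact: CB.
  pose U' w := U w + mx_integral `[s', r] (beta w).
  have bU' : mx_brv F r U' by exact: mx_brv_integral.
  have jb i l := bproc_joint FF s'0 s'r rT (bb i l).
  have U'M w i l : `|U' w i l| * (1 + k * h) ^+ j <= M'.
    pose x := M' / (1 + k * h) ^+ j.+1.
    have Ux a b : `|U w a b| <= x by rewrite ler_pdivlMr ?exprn_gt0.
    have x0 : 0 <= x by rewrite divr_ge0// exprn_ge0// ltW.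
    have : `|U' w i l| <= x * (1 + k * h).
      rewrite !mxE mulrDr mulr1 (le_trans (ler_normD _ _))// lerD//.
      rewrite (_ : x * (k * h) = m%:R * (BC * x) * (r - s')); last first.
        by rewrite rs' /k; ring.
      apply: int_norm => //; first exact: jbm_path (jb i l).
      by move=> p /sub pse; apply: mulmx_bound => // a b; exact: CB.
    move=> /le_trans U'x.
    apply: (@le_trans _ _ (x * (1 + k * h) * (1 + k * h) ^+ j)).
      by rewrite ler_wpM2r ?exprn_ge0 ?(ltW kh0)//; exact: U'x.
    by rewrite -mulrA -exprS /x divfK// expf_neq0// gt_eqF.
  have IH := ih (ltnW jN) U' bU' U'M.
  have step := quadratic_step (P := P) (M := M) FF s'0 s'r rT M0 bDr bfr bb bU bU'.
  have {step} : `|E (fun w => bilin (U' w) (D w r) (U' w))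
      - E (fun w => bilin (U w) (D w s') (U w))
      - \int[mu]_(p in `[s', r]) E (fun w => bilin (beta w p) (D w p) (U w)
       + bilin (U w) (D w p) (beta w p) - bilin (U w) (f w p) (U w))|
      <= K * (r - s') ^+ 2.
    apply: step.
    - move=> i l a b phi sa ab br; apply: (Df i l) => //.
        exact: le_trans sa.
      exact: le_trans br re.
    - move=> w p i l /sub /DB /le_trans; apply; rewrite /M -!addrA lerDl.
      by rewrite !addr_ge0.
    - move=> w p i l /sub /fB /le_trans; apply.
      by rewrite /M -!addrA addrCA lerDl !addr_ge0.
    - move=> w p i l /betaM /le_trans; apply.
      by rewrite /M lerDr !addr_ge0.
    - move=> w i l; apply: (le_trans (UM' w i l)).
      by rewrite /M -addrA addrCA lerDl !addr_ge0.
    - exact: aeW.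
  have int0 : \int[mu]_(p in `[s', r]) E (fun w => bilin (beta w p) (D w p) (U w)
       + bilin (U w) (D w p) (beta w p) - bilin (U w) (f w p) (U w)) <= 0.
    apply: (@int_mean_le0 _ _ _ P F T FF s' r
      (fun w p => bilin (beta w p) (D w p) (U w)
       + bilin (U w) (D w p) (beta w p) - bilin (U w) (f w p) (U w))) => //.
      have bUp : mx_bproc F s' r (fun w _ => U w) by apply: (mx_bproc_brv FF).
      apply: bprocB; last exact: bproc_bilin.
      by apply: bprocD; exact: bproc_bilin.
    apply: filterS fC => w; apply: filterS => p h1 /sub pse.
    by rewrite subr_le0; exact: h1.
  rewrite ler_norml rs' => /andP[_ stp].
  have -> : j.+1%:R * (K * h ^+ 2) = j%:R * (K * h ^+ 2) + K * h ^+ 2.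
    by rewrite -natr1; ring.
  by rewrite -/r in IH; lra.
have /= := ind N.+1 (leqnn _) V.
rewrite Nh (_ : e - (e - s) = s); last by ring.
have -> : N.+1%:R * (K * h ^+ 2) = K * (e - s) ^+ 2 / N.+1%:R.
  have : N.+1%:R != 0 :> R by rewrite pnatr_eq0.
  by rewrite /h; move: N.+1%:R => n n0; field.
apply => // w i l; rewrite /M'; apply: ler_pM => //; first by rewrite exprn_ge0 ?(ltW kh0)//.
rewrite -Nh (mulrCA k N.+1%:R h) expRM_natl lerXn2r ?nnegrE ?expR_ge0 ?(ltW kh0)//.
exact: expR_ge1Dx.
Qed.
End linear.
End Comparison.

(** * Gaussian increments *)

Section WeightedTransfer.
Local Open Scope ereal_scope.
Context d1 d2 d3 (S1 : measurableType d1) (S2 : measurableType d2)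
  (S : measurableType d3) (R : realType).
Variables (m1 : {measure set S1 -> \bar R}) (m2 : {measure set S2 -> \bar R}).
Variables (h1 : S1 -> S) (h2 : S2 -> S) (p1 : S1 -> R) (p2 : S2 -> R).
Hypotheses (mh1 : measurable_fun setT h1) (mh2 : measurable_fun setT h2).
Hypotheses (mp1 : measurable_fun setT p1) (mp2 : measurable_fun setT p2).
Hypotheses (p10 : forall x, (0 <= p1 x)%R) (p20 : forall x, (0 <= p2 x)%R).

Import HBNNSimple.

Let weighted d (U : measurableType d) (m : {measure set U -> \bar R})
    (h : U -> S) (p : U -> R) (f : {nnsfun S >-> R}) :
  measurable_fun setT h -> measurable_fun setT p -> (forall x, (0 <= p x)%R) ->
  \int[m]_x ((f (h x))%:E * (p x)%:E) =
  \sum_(k \in range f) k%:E * \int[m]_(x in h @^-1` (f @^-1` [set k])) (p x)%:E.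
Proof.
move=> mh mp p0.
have mB k : measurable (h @^-1` (f @^-1` [set k])).
  by rewrite -[X in measurable X]setTI; apply: mh => //; exact: measurable_sfunP.
transitivity (\int[m]_x (\sum_(k \in range f)
    (k%:E * (((EFin \o p) \_ (h @^-1` (f @^-1` [set k]))) x)))).
  apply: eq_integral => x _.
  rewrite fimfunE -fsumEFin// ge0_mule_fsuml; last first.
    by move=> k; rewrite EFinM; exact: nnfun_muleindic_ge0.
  apply: eq_fsbigr => k _; rewrite EFinM -muleA; congr (_ * _).
  rewrite patchE indicE; case: ifPn => hk.
    by rewrite (_ : _ \in _ = true) ?mul1e//; move: hk; rewrite !inE.
  by rewrite (_ : _ \in _ = false) ?mul0e//; apply/negbTE; move: hk; rewrite !notin_setE.
rewrite ge0_integral_fsum//; last 2 first.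
- move=> k; apply: emeasurable_funM => //.
  apply/(measurable_restrictT _ (mB k)).1.
  by apply/measurable_EFinP; exact: measurable_funTS.
- move=> k x _; have [k0|k0] := leP 0%R k.
    by apply: mule_ge0; rewrite ?lee_fin// patchE; case: ifP; rewrite ?lee_fin.
  rewrite patchE; case: ifPn => [|_]; last by rewrite mule0.
  by rewrite inE/= => fk; move: k0; rewrite -fk ltNge fun_ge0.
apply: eq_fsbigr => k /[!inE] -[s _ fs].
have k0 : (0 <= k)%R by rewrite -fs.
rewrite ge0_integralZl//; first by rewrite -integral_mkcond.
- apply/(measurable_restrictT _ (mB k)).1.
  by apply/measurable_EFinP; exact: measurable_funTS.
- by move=> x _; rewrite patchE; case: ifP; rewrite ?lee_fin.
Qed.

(** A density can be traded for another one that has the same image measure.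
    It serves twice: to express the law of an increment by the normal density,
    and to factor out a variable of a sub-sigma-algebra when independence is
    only known for events. *)
Lemma ge0_integral_weighted (f : S -> \bar R) :
  (forall B, measurable B ->
    \int[m1]_(x in h1 @^-1` B) (p1 x)%:E = \int[m2]_(x in h2 @^-1` B) (p2 x)%:E) ->
  measurable_fun setT f -> (forall x, 0 <= f x) ->
  \int[m1]_x (f (h1 x) * (p1 x)%:E) = \int[m2]_x (f (h2 x) * (p2 x)%:E).
Proof.
move=> p12 mf f0; pose f_ := nnsfun_approx measurableT mf.
have lim_ d (U : measurableType d) (m : {measure set U -> \bar R})
    (h : U -> S) (p : U -> R) :
  measurable_fun setT h -> measurable_fun setT p -> (forall x, (0 <= p x)%R) ->
  \int[m]_x (f (h x) * (p x)%:E) = limn (fun n => \int[m]_x ((f_ n (h x))%:E * (p x)%:E)).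
  move=> mh mp p0; rewrite -monotone_convergence//.
  - apply: eq_integral => x _; apply/esym/cvg_lim => //.
    have := @cvg_nnsfun_approx _ _ _ _ measurableT _ mf (fun x _ => f0 x) (h x) I.
    by apply: cvgeZr.
  - move=> n; apply: emeasurable_funM; apply/measurable_EFinP => //.
    exact: measurableT_comp.
  - by move=> n x _; apply: mule_ge0; rewrite lee_fin.
  - move=> x _ i j ij; apply: lee_wpmul2r; rewrite lee_fin//.
    exact/lefP/nd_nnsfun_approx.
rewrite lim_// [RHS]lim_//; congr (limn _); apply/funext => n.
by rewrite !weighted//; apply: eq_fsbigr => k _; rewrite p12.
Qed.
End WeightedTransfer.

Section NormalMoments.
Context (R : realType).
Local Notation mu := (@lebesgue_measure R).
Variables (s : R) (s0 : s != 0).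

Lemma normal_pdf_even x : normal_pdf 0 s (- x) = normal_pdf 0 s x.
Proof.
by rewrite /normal_pdf (negbTE s0) /normal_fun !subr0 sqrrN.
Qed.

(** The factor [`|x|] is absorbed by the normal density of twice the
    deviation. *)
Lemma normal_abs_moment :
  (\int[mu]_x (`|x|%:E * (normal_pdf 0 s x)%:E) < +oo)%E.
Proof.
have s20 : s * 2 != 0 by rewrite mulf_neq0// pnatr_eq0.
pose K := (1 + 8 * s ^+ 2) * (normal_peak s / normal_peak (s * 2)).
have K0 : 0 <= K.
  rewrite mulr_ge0// ?divr_ge0 ?normal_peak_ge0//.
  by rewrite addr_ge0// mulr_ge0// sqr_ge0.
apply: (@le_lt_trans _ _ (\int[mu]_x (K%:E * (normal_pdf 0 (s * 2) x)%:E))%E).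
  apply: ge0_le_integral => //.
  - by move=> x _; rewrite -EFinM lee_fin mulr_ge0// normal_pdf_ge0.
  - apply/measurable_EFinP; apply: measurable_funM => //.
    exact: measurable_normal_pdf.
  - apply/measurable_EFinP; apply: measurable_funM => //.
    exact: measurable_normal_pdf.
  move=> x _; rewrite -!EFinM lee_fin /normal_pdf (negbTE s0) (negbTE s20).
  rewrite /normal_fun !subr0.
  have p0 := normal_peak_gt0 s20.
  rewrite /K -!mulrA (mulrA (_^-1) (normal_peak (s * 2))) mulVf ?mul1r ?gt_eqF//.
  rewrite mulrCA [leRHS]mulrCA ler_wpM2l ?normal_peak_ge0//.
  pose y := x ^+ 2 / (8 * s ^+ 2).
  have s2 : 0 < s ^+ 2 by rewrite exprn_even_gt0.
  have y0 : 0 <= y by rewrite divr_ge0 ?sqr_ge0// mulr_ge0// ltW.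
  have -> : - x ^+ 2 / (s ^+ 2 *+ 2) = - (3 * y) - y.
    by rewrite /y; field.
  have -> : - x ^+ 2 / ((s * 2) ^+ 2 *+ 2) = - y.
    by rewrite /y; field.
  rewrite expRD mulrA ler_wpM2r ?expR_ge0// expRN ler_pdivrMr ?expR_gt0//.
  apply: (@le_trans _ _ ((1 + 8 * s ^+ 2) * (1 + 3 * y))); last first.
    by rewrite ler_wpM2l ?expR_ge1Dx// addr_ge0// mulr_ge0// ltW.
  have xy : x ^+ 2 = 8 * s ^+ 2 * y by rewrite /y; field.
  have xx : `|x| <= 1 + x ^+ 2.
    have := sqr_ge0 (1 - `|x|); rewrite -(real_normK (num_real x)).
    by have := normr_ge0 x; nra.
  apply: (le_trans xx); rewrite xy; nra.
rewrite ge0_integralZl//.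
- by rewrite integral_normal_pdf mule1 ltry.
- by apply/measurable_EFinP; exact: measurable_normal_pdf.
- by move=> x _; rewrite lee_fin normal_pdf_ge0.
Qed.

Lemma normal_half_moments :
  (\int[mu]_x ((Num.max (- x) 0)%:E * (normal_pdf 0 s x)%:E) =
   \int[mu]_x ((Num.max x 0)%:E * (normal_pdf 0 s x)%:E))%E.
Proof.
pose g x := ((Num.max x 0)%:E * (normal_pdf 0 s x)%:E)%E.
have mg : measurable_fun [set: measurableTypeR R] g.
  apply/measurable_EFinP; apply: measurable_funM.
    exact: measurable_maxr.
  exact: measurable_normal_pdf.
transitivity (\int[mu]_x (g \o -%R) x)%E.
  by apply: eq_integral => x _; rewrite /g /= normal_pdf_even.
have mN : measurable_fun setT (-%R : measurableTypeR R -> measurableTypeR R).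
  exact: oppr_measurable.
have := @ge0_integral_pushforward _ _ _ _ R _ mN mu setT g measurableT mg.
rewrite preimage_setT => <-; last first.
  by move=> x _; rewrite /g -EFinM lee_fin mulr_ge0 ?normal_pdf_ge0// le_max lexx orbT.
apply: eq_measure_integral => A mA _; exact: lebesgue_measureN.
Qed.
End NormalMoments.

Section GaussianIncrement.
Context d (Omega : measurableType d) (R : realType) (P : probability Omega R).
Local Notation mu := (@lebesgue_measure R).
Variables (G : set (set Omega)) (GS : sigma_algebra setT G)
  (Gm : G `<=` @measurable d Omega).
Variables (s : R) (s0 : s != 0) (D : Omega -> R).
Hypothesis mD : measurable_fun [set: Omega] D.
Hypothesis D_law : forall B : set R, measurable B -> P (D @^-1` B) = normal_prob 0 s B.
Hypothesis D_indep : forall B : set R, measurable B -> forall A, G A ->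
  P (A `&` D @^-1` B) = (P A * P (D @^-1` B))%E.

Let moment (f : R -> R) := (\int[mu]_x ((f x)%:E * (normal_pdf 0 s x)%:E))%E.

Let mpdf : measurable_fun [set: R] (normal_pdf 0 s).
Proof. exact: measurable_normal_pdf. Qed.

Lemma indep_event_integral A (f : R -> R) : G A -> measurable_fun setT f ->
  (forall x, 0 <= f x) ->
  (\int[P]_(w in A) (f (D w))%:E = P A * moment f)%E.
Proof.
move=> GA mf f0; have mA := Gm GA.
have PA : exists2 p, 0 <= p & P A = p%:E.
  exists (fine (P A)); first by rewrite fine_ge0.
  by rewrite fineK// fin_num_measure.
have [p p0 PAp] := PA.
rewrite integral_mkcond.
transitivity (\int[P]_w ((EFin \o f) (D w) * (\1_A w)%:E))%E.
  apply: eq_integral => w _; rewrite patchE indicE.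
  by case: ifP => wA; rewrite ?mule1 ?mule0.
rewrite (@ge0_integral_weighted _ _ _ Omega (measurableTypeR R) (measurableTypeR R) R
   P mu D id (\1_A) (fun x => p * normal_pdf 0 s x)) //.
- rewrite /moment PAp -ge0_integralZl//.
  + by apply: eq_integral => x _; rewrite EFinM muleCA.
  + apply/measurable_EFinP; exact: measurable_funM.
  + by move=> x _; rewrite -EFinM lee_fin mulr_ge0// normal_pdf_ge0.
- exact: measurable_funM.
- by move=> x; rewrite mulr_ge0// normal_pdf_ge0.
- move=> B mB.
  have mDB : measurable (D @^-1` B) by rewrite -[X in measurable X]setTI; exact: mD.
  rewrite integral_indic//.
  apply: (etrans (D_indep mB GA)); rewrite (D_law mB) PAp /normal_prob.
  under [RHS]eq_integral do rewrite EFinM.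
  rewrite ge0_integralZl//.
  + by apply/measurable_EFinP; exact: measurable_funTS.
  + by move=> x _; rewrite lee_fin normal_pdf_ge0.
- exact/measurable_EFinP.
Qed.

Lemma indep_integral (f : R -> R) (psi : Omega -> R) : measurable_fun setT f ->
  (forall x, 0 <= f x) -> (moment f < +oo)%E ->
  measurable_fun [set: g_sigma_algebraType G] psi -> (forall w, 0 <= psi w) ->
  (\int[P]_w ((psi w)%:E * (f (D w))%:E) = moment f * \int[P]_w (psi w)%:E)%E.
Proof.
move=> mf f0 fin mpsi psi0.
have mom0 : (0 <= moment f)%E.
  by apply: integral_ge0 => x _; rewrite -EFinM lee_fin mulr_ge0// normal_pdf_ge0.
have [c c0 mc] : exists2 c, 0 <= c & moment f = c%:E.
  exists (fine (moment f)); first exact: fine_ge0.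
  by rewrite fineK// ge0_fin_numE.
have mid := measurable_identity Gm.
rewrite mc.
rewrite (@ge0_integral_weighted _ _ _ Omega Omega (g_sigma_algebraType G) R P P
  id id (f \o D) (fun=> c) mid mid _ _ _ _ (EFin \o psi)).
- rewrite -ge0_integralZl//.
  + by apply: eq_integral => w _; rewrite muleC.
  + by apply/measurable_EFinP; exact: (measurableT_comp mpsi mid).
  + by move=> w _; rewrite lee_fin.
- exact: measurableT_comp.
- exact: measurable_cst.
- by move=> w; exact: f0.
- by [].
- move=> B mB; rewrite !preimage_id.
  have GB : G B by move: mB; rewrite /measurable /= sigma_algebra_id.
  rewrite indep_event_integral// mc integral_cst//; first by rewrite muleC.
  exact: Gm.
- exact/measurable_EFinP.
- by move=> w; rewrite lee_fin.
Qed.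

Let pos (x : R) := Num.max x 0.
Let neg (x : R) := Num.max (- x) 0.
Let mpos : measurable_fun setT pos. Proof. exact: measurable_maxr. Qed.
Let mneg : measurable_fun setT neg.
Proof. by apply: measurable_maxr => //; exact: oppr_measurable. Qed.
Let pos0 x : 0 <= pos x. Proof. by rewrite /pos le_max lexx orbT. Qed.
Let neg0 x : 0 <= neg x. Proof. by rewrite /neg le_max lexx orbT. Qed.

Let moment_fin (f : R -> R) : measurable_fun setT f -> (forall x, 0 <= f x <= `|x|) ->
  (moment f < +oo)%E.
Proof.
move=> mf fx; apply: le_lt_trans (normal_abs_moment s0).
apply: ge0_le_integral => //.
- move=> x _; rewrite -EFinM lee_fin mulr_ge0 ?normal_pdf_ge0//.
  by case/andP: (fx x).
- by apply/measurable_EFinP; exact: measurable_funM.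
- by apply/measurable_EFinP; apply: measurable_funM.
- move=> x _; rewrite -!EFinM lee_fin ler_wpM2r ?normal_pdf_ge0//.
  by case/andP: (fx x).
Qed.

Lemma gaussian_integrable : P.-integrable setT (EFin \o D).
Proof.
apply/integrableP; split; first exact/measurable_EFinP.
have GT : G setT.
  by case: GS => G0 GC _; rewrite -(setD0 setT); exact: GC.
have := @indep_event_integral setT (@Num.norm R R) GT.
rewrite probability_setT mul1e => /= -> //.
by apply: moment_fin => // x; rewrite normr_ge0 lexx.
Qed.

Lemma bounded_gaussian_integrable psi : bounded_measurable [set: Omega] psi ->
  P.-integrable setT (EFin \o (fun w => psi w * D w)).
Proof.
move=> [mpsi [C psiC]].
apply: (@le_integrable _ _ _ _ _ measurableT _ (fun w => (C * D w)%:E)).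
- by apply/measurable_EFinP; exact: measurable_funM.
- move=> w _ /=; rewrite lee_fin !normrM ler_wpM2r//.
  by rewrite (le_trans (psiC w I))// ler_norm.
- under eq_fun do rewrite EFinM.
  exact: (integrableZl measurableT C gaussian_integrable).
Qed.

(** By independence the positive and the negative part of [D] contribute the
    same half moment times the mean of [psi]. *)
Let gaussian_mean0_nneg (psi : Omega -> R) :
  bounded_measurable [set: g_sigma_algebraType G] psi -> (forall w, 0 <= psi w) ->
  \int[P]_w (psi w * D w) = 0.
Proof.
move=> bpsi psi0; have [mpsi [C psiC]] := bpsi.
have bpsi' := bm_identity Gm bpsi; have [mpsi' _] := bpsi'.
have fpos : (moment pos < +oo)%E.
  apply: moment_fin => // x; rewrite pos0 /pos ge_max normr_ge0 ler_norm//.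
have fneg : (moment neg < +oo)%E.
  by apply: moment_fin => // x; rewrite neg0 /neg ge_max normr_ge0 -normrN ler_norm.
have ipos := indep_integral mpos pos0 fpos mpsi psi0.
have ineg := indep_integral mneg neg0 fneg mpsi psi0.
have mm : moment neg = moment pos by exact: (normal_half_moments s0).
have iD := bounded_gaussian_integrable bpsi'.
rewrite /Rintegral integralE.
have -> : (\int[P]_w ((fun x => (psi x * D x)%:E)^\+ w) =
    \int[P]_w ((psi w)%:E * (pos (D w))%:E))%E.
  apply: eq_integral => w _; rewrite funeposE -EFinM -EFin_max /pos.
  by rewrite maxr_pMr// mulr0.
have -> : (\int[P]_w ((fun x => (psi x * D x)%:E)^\- w) =
    \int[P]_w ((psi w)%:E * (neg (D w))%:E))%E.
  apply: eq_integral => w _; rewrite funenegE -EFinN -EFinM -EFin_max /neg.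
  by rewrite maxr_pMr// mulr0 mulrN.
have psifin : (\int[P]_w (psi w)%:E)%E \is a fin_num.
  apply: integrable_fin_num => //; apply: bm_integrable => //.
  exact: prob_fin.
have momfin : moment pos \is a fin_num.
  rewrite ge0_fin_numE//; apply: integral_ge0 => x _.
  by rewrite -EFinM lee_fin mulr_ge0// normal_pdf_ge0.
by rewrite ipos ineg mm subee// fin_numM.
Qed.

Lemma gaussian_mean0 (psi : Omega -> R) : bounded_measurable [set: g_sigma_algebraType G] psi ->
  \int[P]_w (psi w * D w) = 0.
Proof.
move=> bpsi; have [mpsi [C psiC]] := bpsi.
(* Adding its bound makes [psi] nonnegative. *)
have bC : bounded_measurable [set: g_sigma_algebraType G] (fun=> `|C|) by exact: bm_cst.
have bpC := bmD bpsi bC.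
have shifted_ge0 : forall w, 0 <= psi w + `|C|.
  move=> w; rewrite -lerBlDr sub0r; have := psiC w I.
  by move=> /le_trans/(_ (ler_norm C)); rewrite ler_norml => /andP[].
have h1 := gaussian_mean0_nneg bpC shifted_ge0.
have h2 := gaussian_mean0_nneg bC (fun=> normr_ge0 C).
have -> : \int[P]_w (psi w * D w) =
    \int[P]_w ((psi w + `|C|) * D w) - \int[P]_w (`|C| * D w).
  rewrite -RintegralB//; last 2 first.
  - by apply: bounded_gaussian_integrable; exact: bm_identity Gm bpC.
  - by apply: bounded_gaussian_integrable; exact: bm_identity Gm bC.
  by apply: eq_Rintegral => w _; ring.
by rewrite h1 h2 subr0.
Qed.
End GaussianIncrement.

(** * Increments of Ito integrals *)

Section BrownianMartingale.
Context d (Omega : measurableType d) (R : realType) (P : probability Omega R).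
Variables (F : R -> set (set Omega)) (W : Omega -> R -> R) (T : R).
Hypotheses (F_def : forall t, F t = brownian_filtration P W t)
  (F_T : F T = @measurable d Omega) (W_bm : brownian_motion P F T W).

Lemma brownian_sigma_algebra t : sigma_algebra setT (F t).
Proof. by rewrite F_def; exact: smallest_sigma_algebra. Qed.

Lemma brownian_is_filtration : filtration F T.
Proof.
have mono s t : s <= t -> F s `<=` F t.
  move=> st; rewrite !F_def; apply: sub_smallest2r; first exact: smallest_sigma_algebra.
  move=> A [[p [B [/andP[p0 ps] mB ->]]]|NA].
    by left; exists p, B; split => //; rewrite p0 (le_trans ps).
  by right.
split=> [t /andP[_ tT]|s t _ st _]; last exact: mono.
by rewrite -F_T; exact: mono.
Qed.

Local Notation FF := brownian_is_filtration.

Lemma brownian_measurable t : 0 <= t <= T -> measurable_fun [set: Omega] (W ^~ t).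
Proof.
move=> tT; have [aW _ _ _ _] := W_bm.
have := aW t tT; rewrite /measurable_at => mW.
apply: (measurableT_comp (f := (W ^~ t) : g_sigma_algebraType (F t) -> R)) => //.
by apply: measurable_identity; exact: (FF.1 t).
Qed.

Lemma brownian_increment p q psi : 0 <= p -> p <= q -> q <= T -> brv F p psi ->
  P.-integrable setT (EFin \o (fun w => psi w * (W w q - W w p))) /\
  \int[P]_w (psi w * (W w q - W w p)) = 0.
Proof.
move=> p0 pq qT bpsi; move: pq; rewrite le_eqVlt => /predU1P[<-|pq].
  have -> : (fun w => psi w * (W w p - W w p)) = cst 0.
    by apply/funext => w; rewrite subrr mulr0.
  by split; [exact: integrable0|rewrite E_cst].
have [_ _ _ law indep] := W_bm.
have pT : 0 <= p <= T by rewrite p0 (le_trans (ltW pq)).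
have q0T : 0 <= q <= T by rewrite qT (le_trans p0 (ltW pq)).
have sd0 : Num.sqrt (q - p) != 0 by rewrite gt_eqF// sqrtr_gt0 subr_gt0.
have mD : measurable_fun [set: Omega] (fun w => W w q - W w p).
  by apply: measurable_funB; exact: brownian_measurable.
have Gm := FF.1 p pT; have GS := brownian_sigma_algebra p.
split.
  apply: (bounded_gaussian_integrable GS Gm sd0 mD (law p q p0 pq qT)
     (indep p q p0 pq qT)).
  exact: (brv_bm FF pT).
exact: (gaussian_mean0 GS Gm sd0 mD (law p q p0 pq qT) (indep p q p0 pq qT)).
Qed.

(** Clipping each step to [[a, b]] turns a summand into a bounded variable
    known at some time [p >= a] times an increment of [W] after [p]. *)
Lemma step_integral_increment S a b phi : simple_process F T S ->
  0 <= a -> a <= b -> b <= T -> brv F a phi ->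
  P.-integrable setT (EFin \o (fun w =>
    phi w * (step_integral W S w b - step_integral W S w a))) /\
  \int[P]_w (phi w * (step_integral W S w b - step_integral W S w a)) = 0.
Proof.
move=> [tT tle cm cb] a0 ab bT bphi.
have b0 := le_trans a0 ab.
pose incr (i : nat) w :=
  (W w (Num.min (step_time S i.+1) b) - W w (Num.min (step_time S i) b)) -
  (W w (Num.min (step_time S i.+1) a) - W w (Num.min (step_time S i) a)).
have one (i : 'I_(step_size S)) :
    P.-integrable setT (EFin \o (fun w => phi w * (step_coef S i w * incr i w))) /\
    \int[P]_w (phi w * (step_coef S i w * incr i w)) = 0.
  have /andP[ti0 tiT] := tT i (ltnW (ltn_ord i)).
  have /andP[tj0 tjT] := tT i.+1 (ltn_ord i).
  have tij := tle i (ltn_ord i).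
  have [p [q [ap tip pq qT incrE]]] : exists p q, [/\ a <= p, step_time S i <= p,
      p <= q, q <= T & forall w, incr i w = W w q - W w p].
    have aT := le_trans ab bT.
    have [tja|atj] := leP (step_time S i.+1) a.
      exists T, T; split => // w; rewrite subrr /incr.
      rewrite (min_idPl (le_trans tja ab)) (min_idPl tja).
      rewrite (min_idPl (le_trans tij (le_trans tja ab))).
      by rewrite (min_idPl (le_trans tij tja)) subrr.
    have [bti|tib] := leP b (step_time S i).
      exists T, T; split => // w; rewrite subrr /incr.
      rewrite (min_idPr (le_trans bti tij)) (min_idPr bti).
      by rewrite (min_idPr (le_trans ab (le_trans bti tij))) (min_idPr (le_trans ab bti)) !subrr.
    have qT : Num.min (step_time S i.+1) b <= T by rewrite ge_min bT orbT.
    have [tia|ati] := leP (step_time S i) a.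
      exists a, (Num.min (step_time S i.+1) b); split => //.
        by rewrite le_min ab (ltW atj).
      move=> w; rewrite /incr (min_idPl (ltW tib)) (min_idPr (ltW atj)).
      by rewrite (min_idPl tia); ring.
    exists (step_time S i), (Num.min (step_time S i.+1) b); split => //.
    - exact: ltW.
    - by rewrite le_min tij (ltW tib).
    - move=> w; rewrite /incr (min_idPl (ltW tib)) (min_idPr (ltW atj)).
      by rewrite (min_idPr (ltW ati)); ring.
  have p0 := le_trans a0 ap; have pT := le_trans pq qT.
  have bc : brv F (step_time S i) (step_coef S i).
    by split; [exact: cm|have [C cC] := cb i (ltn_ord i); exists C => w _; exact: cC].
  have bpc : brv F p (fun w => phi w * step_coef S i w).
    by apply: brvM; [exact: (brv_mono FF a0 ap pT bphi)|exact: (brv_mono FF ti0 tip pT bc)].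
  have -> : (fun w => phi w * (step_coef S i w * incr i w)) =
      (fun w => phi w * step_coef S i w * (W w q - W w p)).
    by apply/funext => w; rewrite incrE mulrA.
  exact: brownian_increment.
have sumE w : phi w * (step_integral W S w b - step_integral W S w a) =
    \sum_(i < step_size S) phi w * (step_coef S i w * incr i w).
  rewrite /step_integral -sumrB mulr_sumr; apply: eq_bigr => i _.
  by rewrite /incr; ring.
pose sm (r : seq 'I_(step_size S)) w :=
  \sum_(i <- r) phi w * (step_coef S i w * incr i w).
have ind r : P.-integrable setT (EFin \o sm r) /\ \int[P]_w sm r w = 0.
  elim: r => [|i r [ih1 ih2]].
    have -> : sm [::] = cst 0.
      by apply/funext => w; rewrite /sm big_nil.
    by split; [exact: integrable0|rewrite E_cst].
  have [i1 i2] := one i.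
  have -> : sm (i :: r) = (fun w => phi w * (step_coef S i w * incr i w) + sm r w).
    by apply/funext => w; rewrite /sm big_cons.
  split; last by rewrite RintegralD// i2 ih2 addr0.
  by have := integrableD measurableT i1 ih1; apply: eq_integrable.
have -> : (fun w => phi w * (step_integral W S w b - step_integral W S w a)) =
    sm (index_enum 'I_(step_size S)) by apply/funext => w; exact: sumE.
exact: ind.
Qed.

Lemma step_integral_measurable S t : simple_process F T S -> 0 <= t <= T ->
  measurable_fun [set: Omega] (fun w => step_integral W S w t).
Proof.
move=> [tT tle cm cb] t0T; apply: measurable_sum => i.
have mmin j : (j <= step_size S)%N -> 0 <= Num.min (step_time S j) t <= T.
  move=> jS; have /andP[j0 jT] := tT j jS; have /andP[t0 tT'] := t0T.
  by rewrite le_min j0 t0 ge_min jT.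
apply: measurable_funM.
  have tiT := tT i (ltnW (ltn_ord i)).
  apply: (measurableT_comp (f := step_coef S i : g_sigma_algebraType (F (step_time S i)) -> R)).
    exact: cm.
  by apply: measurable_identity; exact: (FF.1 _ tiT).
by apply: measurable_funB; apply: brownian_measurable; apply: mmin => //; exact: ltnW.
Qed.

(** The identity holds for step integrals and survives their limit in [L^2].
    The bounded version [Z] of the increment makes the mean of [phi * Z]
    meaningful. *)
Lemma ito_orthogonal H N a b phi Z : ito_integral P F T W H N ->
  0 <= a -> a <= b -> b <= T -> brv F a phi ->
  bounded_measurable [set: Omega] Z ->
  (\forall w \ae P, Z w = N w b - N w a) -> \int[P]_w (phi w * Z w) = 0.
Proof.
move=> [aN _ [S [simS _ cvgS]]] a0 ab bT bphi bZ ZN.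
have aT : 0 <= a <= T by rewrite a0 (le_trans ab).
have b0T : 0 <= b <= T by rewrite (le_trans a0).
have [mphi [C phiC]] := brv_bm FF aT bphi; have [mZ _] := bZ.
have C0 : 0 <= C by have := phiC point I; exact: le_trans.
have mN t : 0 <= t <= T -> measurable_fun [set: Omega] (N ^~ t).
  move=> tT; apply: (measurableT_comp (f := (N ^~ t) : g_sigma_algebraType (F t) -> R)).
    exact: aN.
  by apply: measurable_identity; exact: (FF.1 t).
apply/eqP; rewrite -normr_le0; apply/ler_addgt0Pr => e e0; rewrite add0r.
pose dl := e / (5 * (C + 1)).
have dl0 : 0 < dl by rewrite divr_gt0// mulr_gt0// ltr_pwDr.
have near_ t : 0 <= t <= T -> \forall k \near \oo,
    (\int[P]_w ((step_integral W (S k) w t - N w t) ^+ 2)%R%:E < (dl ^+ 2)%:E)%E.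
  move=> tT; apply: (cvgS t tT [set u | (u < (dl ^+ 2)%:E)%E]).
  by apply: open_ereal_lt'; rewrite lte_fin exprn_gt0.
have [k [ka kb]] : exists k,
    (\int[P]_w ((step_integral W (S k) w a - N w a) ^+ 2)%R%:E < (dl ^+ 2)%:E)%E /\
    (\int[P]_w ((step_integral W (S k) w b - N w b) ^+ 2)%R%:E < (dl ^+ 2)%:E)%E.
  have [k _ hk] := filterI (near_ a aT) (near_ b b0T).
  by exists k; exact: (hk k (leqnn _)).
pose D w := step_integral W (S k) w b - step_integral W (S k) w a.
have [iD D0] := step_integral_increment (simS k) a0 ab bT bphi.
have mS t : 0 <= t <= T -> measurable_fun [set: Omega] (fun w => step_integral W (S k) w t).
  by move=> tT; exact: step_integral_measurable.
have iZ : P.-integrable setT (EFin \o (fun w => phi w * Z w)).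
  apply: bm_integrable => //; first exact: prob_fin.
  by apply: bmM => //; exact: (brv_bm FF aT bphi).
have iZD : P.-integrable setT (EFin \o (fun w => phi w * Z w - phi w * D w)).
  by have := integrableB measurableT iZ iD; apply: eq_integrable.
have -> : \int[P]_w (phi w * Z w) = \int[P]_w (phi w * Z w - phi w * D w).
  by rewrite RintegralB// D0 subr0.
rewrite -lee_fin EFin_normr_Rintegral//.
have mg : measurable_fun [set: Omega] (fun w => phi w * Z w - phi w * D w).
  by move/measurable_int/measurable_EFinP : iZD.
apply: (le_trans (le_abse_integral P measurableT _)); first exact/measurable_EFinP.
pose sq t w := (step_integral W (S k) w t - N w t) ^+ 2.
have msq t : 0 <= t <= T -> measurable_fun [set: Omega] (sq t).
  by move=> tT; apply: measurable_funX; apply: measurable_funB; [exact: mS|exact: mN].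
have sq0 t w : 0 <= sq t w by exact: sqr_ge0.
(* By Young's inequality the errors in [L^2] at the two ends give an error of
   at most [5 * C * dl] in [L^1]. *)
pose K := 2 * C / dl.
have K0 : 0 <= K by rewrite /K divr_ge0 ?(ltW dl0)// mulr_ge0.
apply: (@le_trans _ _ (\int[P]_w ((C * dl)%:E + (K%:E * (sq a w)%:E + K%:E * (sq b w)%:E)))%E).
  apply: ae_ge0_le_integral => //.
  - by apply/measurable_EFinP; exact: measurableT_comp.
  - move=> w _; rewrite -!EFinM -!EFinD lee_fin.
    by rewrite !addr_ge0// mulr_ge0// ltW.
  - apply/measurable_EFinP; apply: measurable_funD => //.
    by apply: measurable_funD; apply: measurable_funM => //; exact: msq.
  apply: filterS ZN => w ZN _ /=; rewrite -!EFinM -!EFinD lee_fin.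
  rewrite -mulrBr normrM.
  apply: (@le_trans _ _ (C * `|Z w - D w|)); first by rewrite ler_wpM2r// phiC.
  have -> : K * sq a w + K * sq b w = C * (2 / dl * (sq a w + sq b w)).
    by rewrite /K; ring.
  rewrite -mulrDr ler_wpM2l// ZN.
  have -> : N w b - N w a - D w = (step_integral W (S k) w a - N w a)
      - (step_integral W (S k) w b - N w b) by rewrite /D; ring.
  rewrite /sq; move: (step_integral W (S k) w a - N w a) => u.
  move: (step_integral W (S k) w b - N w b) => v.
  rewrite -(ler_pM2l dl0).
  have -> : dl * (dl + 2 / dl * (u ^+ 2 + v ^+ 2)) = dl ^+ 2 + 2 * (u ^+ 2 + v ^+ 2).
    by field; rewrite gt_eqF.
  have := sqr_ge0 (dl - `|u - v|); have := sqr_ge0 (u + v).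
  have : `|u - v| ^+ 2 = (u - v) ^+ 2 by rewrite real_normK// num_real.
  have : 0 <= dl * `|u - v| by rewrite mulr_ge0// ltW.
  nra.
rewrite ge0_integralD//=; last 3 first.
- by move=> w _; rewrite lee_fin mulr_ge0// ltW.
- by move=> w _; rewrite -!EFinM -!EFinD lee_fin addr_ge0// mulr_ge0.
- by apply/measurable_EFinP; apply: measurable_funD; apply: measurable_funM => //; exact: msq.
rewrite ge0_integralD//=; last 4 first.
- by move=> w _; rewrite -!EFinM lee_fin mulr_ge0.
- by apply/measurable_EFinP; apply: measurable_funM => //; exact: msq.
- by move=> w _; rewrite -!EFinM lee_fin mulr_ge0.
- by apply/measurable_EFinP; apply: measurable_funM => //; exact: msq.
rewrite integral_cst//= probability_setT mule1.
rewrite !ge0_integralZl//=; last 4 first.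
- by apply/measurable_EFinP; exact: msq.
- by move=> w _; rewrite lee_fin.
- by apply/measurable_EFinP; exact: msq.
- by move=> w _; rewrite lee_fin.
apply: (@le_trans _ _ ((C * dl)%:E + (K%:E * (dl ^+ 2)%:E + K%:E * (dl ^+ 2)%:E))%E).
  apply: leeD2l; apply: leeD; apply: lee_wpmul2l => //; exact: ltW.
rewrite -!EFinM -!EFinD lee_fin.
have -> : C * dl + (K * dl ^+ 2 + K * dl ^+ 2) = 5 * C * dl.
  by rewrite /K; field; rewrite gt_eqF.
have -> : e = 5 * (C + 1) * dl by rewrite /dl; field; rewrite gt_eqF// ltr_pwDr.
by rewrite ler_wpM2r ?(ltW dl0)// ler_wpM2l// lerDl.
Qed.
End BrownianMartingale.

(** * Truncated coefficients *)

Section MatrixClosure.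
Context (R : realType) (X : Type).
Variable C : (X -> R) -> Prop.
Hypotheses (C_cst : forall c, C (fun=> c))
  (C_add : forall f g, C f -> C g -> C (fun x => f x + g x))
  (C_mul : forall f g, C f -> C g -> C (fun x => f x * g x)).

(** [C] will be a class of measurable, of bounded, of progressive or of
    convergent functions. Closure of [C] under sums and products passes to all
    matrix expressions, in particular to the driver. *)
Definition entrywise m n (f : X -> 'M[R]_(m, n)) : Prop :=
  forall i j, C (fun x => f x i j).

Lemma entrywise_cst m n (A : 'M[R]_(m, n)) : entrywise (fun=> A).
Proof. by move=> i j; exact: C_cst. Qed.

Lemma entrywise_eq m n (f : X -> 'M[R]_(m, n)) (g : 'I_m -> 'I_n -> X -> R) :
  (forall i j, C (g i j)) -> (forall x i j, f x i j = g i j x) -> entrywise f.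
Proof.
move=> Cg fg i j; rewrite (_ : (fun x => f x i j) = g i j)//.
by apply/funext => x; exact: fg.
Qed.

Lemma entrywiseD m n (f g : X -> 'M[R]_(m, n)) :
  entrywise f -> entrywise g -> entrywise (fun x => f x + g x).
Proof.
move=> Cf Cg; apply: (entrywise_eq (g := fun i j x => f x i j + g x i j)).
  by move=> i j; exact: C_add.
by move=> x i j; rewrite mxE.
Qed.

Lemma entrywiseN m n (f : X -> 'M[R]_(m, n)) :
  entrywise f -> entrywise (fun x => - f x).
Proof.
move=> Cf; apply: (entrywise_eq (g := fun i j x => -1 * f x i j)).
  by move=> i j; exact: C_mul.
by move=> x i j; rewrite mxE mulN1r.
Qed.

Lemma entrywiseM m n p (f : X -> 'M[R]_(m, n)) (g : X -> 'M[R]_(n, p)) :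
  entrywise f -> entrywise g -> entrywise (fun x => f x *m g x).
Proof.
move=> Cf Cg; apply: (entrywise_eq (g := fun i j x => \sum_k f x i k * g x k j)).
  move=> i j; elim: (index_enum _) => [|k r ih].
    by under eq_fun do rewrite big_nil; exact: C_cst.
  under eq_fun do rewrite big_cons.
  by apply: C_add => //; exact: C_mul.
by move=> x i j; rewrite mxE.
Qed.

Lemma entrywise_diag n (f : X -> 'rV[R]_n) :
  entrywise f -> entrywise (fun x => diag_mx (f x)).
Proof.
move=> Cf; apply: (entrywise_eq (g := fun i j x => (i == j)%:R * f x 0 j)).
  by move=> i j; exact: C_mul.
move=> x i j; rewrite mxE; case: eqP => [->|_]; first by rewrite mulr1n mul1r.
by rewrite mulr0n mul0r.
Qed.

Lemma entrywise_block m1 m2 n1 n2 (A : X -> 'M[R]_(m1, n1))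
    (B : X -> 'M[R]_(m1, n2)) (D : X -> 'M[R]_(m2, n1)) (E : X -> 'M[R]_(m2, n2)) :
  entrywise A -> entrywise B -> entrywise D -> entrywise E ->
  entrywise (fun x => block_mx (A x) (B x) (D x) (E x)).
Proof.
move=> CA CB CD CE i j.
case: (split_ordP i) => i' ->; case: (split_ordP j) => j' ->.
- by under eq_fun do rewrite block_mxEul.
- by under eq_fun do rewrite block_mxEur.
- by under eq_fun do rewrite block_mxEdl.
- by under eq_fun do rewrite block_mxEdr.
Qed.

Lemma entrywise_driver d (Lambda : 'M[R]_d) (gamma : 'rV[R]_d)
    (rho : X -> 'rV[R]_d) (Sigma : X -> 'M[R]_d) (Q : X -> 'M[R]_(d + d)) :
  entrywise rho -> entrywise Sigma -> entrywise Q ->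
  entrywise (fun x => bsde_driver Lambda gamma (rho x) (Sigma x) (Q x)).
Proof.
move=> Crho CSigma CQ; have C0 m n := @entrywise_cst m n 0.
have Cd := entrywise_diag Crho.
have CA : entrywise (fun x => (block_mx 0 0 0 (- diag_mx (rho x)) : 'M[R]_(d + d))).
  by apply: entrywise_block => //; exact: entrywiseN.
rewrite /bsde_driver; apply: entrywiseD; last first.
  apply: entrywise_block => //.
  by apply: entrywiseD; apply: entrywiseM => //; exact: entrywise_cst.
apply: entrywiseD; last exact: entrywiseM.
apply: entrywiseD; last exact: entrywiseM.
apply: entrywiseN; apply: entrywiseM => //; apply: entrywiseM; last exact: entrywise_cst.
apply: entrywiseM; last exact: entrywise_cst.
by apply: entrywiseM => //; exact: entrywise_cst.
Qed.
End MatrixClosure.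

Section Splitting.
Context (R : realType).
Local Notation mu := (@lebesgue_measure R).

Lemma int_split (a b c : R) (f : R -> R) : a <= b -> b <= c ->
  bounded_measurable (`[a, c]%classic : set R) f ->
  \int[mu]_(x in `[a, c]) f x =
  \int[mu]_(x in `[a, b]) f x + \int[mu]_(x in `[b, c]) f x.
Proof.
move=> ab bc bf.
have fi : mu.-integrable `[a, c] (EFin \o f).
  apply: (@bm_integrable _ (measurableTypeR R) R mu) => //; exact: lebesgue_itv_fin.
rewrite -(Rintegral_itv_obnd_cbnd (r := b)); last first.
  apply: integrableS fi => //; apply: subset_itv; rewrite ?bnd_simp//.
by rewrite -(@Rintegral_itvB _ f (BLeft a) (BRight c) b fi) ?bnd_simp// addrC subrK.
Qed.
End Splitting.

Section Truncation.
Context d (Omega : measurableType d) (R : realType) (P : probability Omega R).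
Variables (F : R -> set (set Omega)) (T : R).
Local Notation mu := (@lebesgue_measure R).

Definition clip (C x : R) : R := Num.max (- C) (Num.min x C).

Lemma clip_norm C x : 0 <= C -> `|clip C x| <= C.
Proof.
move=> C0; rewrite /clip ler_norml le_max lexx/= ge_max ge_min lexx orbT andbT.
by rewrite lerNl (le_trans _ C0)// oppr_le0.
Qed.

Lemma clip_id C x : `|x| <= C -> clip C x = x.
Proof.
by rewrite ler_norml => /andP[Cx xC]; rewrite /clip (min_idPl xC); exact/max_idPr.
Qed.

Lemma bproc_clip (I : set R) (a b C : R) (f : Omega -> R -> R) :
  measurable I -> `[a, b] `<=` I -> 0 <= C ->
  progressive F I f -> bproc F a b (fun w r => clip C (f w r)).
Proof.
move=> mI abI C0 pf r /andP[ar rb]; split; last first.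
  by exists C => z _; exact: clip_norm.
apply: measurable_maxr => //; apply: measurable_minr => //.
have Ir : I r by apply: abI => /=; rewrite in_itv/= ar rb.
apply: measurable_funS (pf r Ir).
  by apply: measurableX => //; exact: measurableI.
move=> [w q] [_ /=]; rewrite in_itv/= => /andP[aq qr]; split => //=; split.
  by apply: abI => /=; rewrite in_itv/= aq (le_trans qr).
by rewrite in_itv.
Qed.

Lemma mx_clip m n (I : set R) (a b C : R) (f : Omega -> R -> 'M[R]_(m, n)) :
  measurable I -> `[a, b] `<=` I -> 0 <= C -> mx_progressive F I f ->
  mx_bproc F a b (fun w r => \matrix_(i, j) clip C (f w r i j)).
Proof.
move=> mI abI C0 pf i j.
apply: (eq_bproc (f := fun w r => clip C (f w r i j))).
  by move=> w r _; rewrite mxE.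
exact: bproc_clip (pf i j).
Qed.

(** A change on a null set of outcomes and times affects neither the backward
    equation nor the state, and makes the coefficient bounded everywhere. *)
Lemma truncate_ess_bounded m n (H : set 'M[R]_(m, n)) f :
  ess_bounded_process P F T H f ->
  exists ft : Omega -> R -> 'M[R]_(m, n), mx_bproc F 0 T ft /\
    \forall w \ae P, \forall r \ae mu, 0 <= r <= T -> ft w r = f w r /\ H (f w r).
Proof.
move=> [pf Hf [C fC]].
exists (fun w r => \matrix_(i, j) clip `|C| (f w r i j)); split.
  exact: mx_clip pf.
apply: filterS2 (ae_product_path Hf) (ae_product_path fC) => w; apply: filterS2 => r /= h1 h2 rT.
split; last exact: h1.
apply/matrixP => i j; rewrite mxE clip_id//.
exact: le_trans (h2 rT i j) (ler_norm C).
Qed.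

(** The diagonal entries of a nonnegative definite matrix are nonnegative, so
    cutting them off at zero is harmless. *)
Lemma truncate_diag n (rho : Omega -> R -> 'rV[R]_n) :
  ess_bounded_process P F T (@psd_mx R n) (fun w s => diag_mx (rho w s)) ->
  exists rt : Omega -> R -> 'rV[R]_n, [/\ mx_bproc F 0 T rt,
    forall w r i, 0 <= rt w r 0 i &
    \forall w \ae P, \forall r \ae mu, 0 <= r <= T -> rt w r = rho w r].
Proof.
move=> /truncate_ess_bounded[ft [bft ftE]].
exists (fun w r => \row_i Num.max (ft w r i i) 0); split.
- move=> i j; apply: (eq_bproc (f := fun w r => Num.max (ft w r j j) 0)).
    by move=> w r _; rewrite mxE.
  move=> r rT; have [mf [C fC]] := bft j j r rT; split.
    exact: measurable_maxr.
  exists C => z zD; apply: le_trans (fC z zD).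
  by rewrite ger0_norm ?le_max ?lexx ?orbT// ge_max ler_norm normr_ge0.
- by move=> w r i; rewrite mxE le_max lexx orbT.
apply: filterS ftE => w; apply: filterS => r h /h[-> [_ psd]].
apply/rowP => i; rewrite !mxE eqxx mulr1n; apply/max_idPl.
have := psd (delta_mx i 0).
by rewrite trmx_delta -rowE -colE !mxE eqxx mulr1n.
Qed.

Lemma truncate_continuous m n (H : set 'M[R]_(m, n)) f :
  Linf_continuous_process P F T H f ->
  exists ft : Omega -> R -> 'M[R]_(m, n), mx_bproc F 0 T ft /\
    \forall w \ae P, forall r, 0 <= r <= T -> ft w r = f w r /\ H (f w r).
Proof.
move=> [pf _ Hf [C fC]].
exists (fun w r => \matrix_(i, j) clip `|C| (f w r i j)); split.
  exact: mx_clip pf.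
apply: filterS2 Hf fC => w h1 h2 r rT; split; last exact: h1.
apply/matrixP => i j; rewrite mxE clip_id//.
exact: le_trans (h2 r rT i j) (ler_norm C).
Qed.
End Truncation.

(** * The weak form of the backward Riccati equation *)

Section TruncatedBSDE.
Context dO (Omega : measurableType dO) (R : realType) (P : probability Omega R).
Variables (F : R -> set (set Omega)) (W : Omega -> R -> R) (d : nat) (T : R).
Variables (Lambda : 'M[R]_d) (gamma : 'rV[R]_d).
Variables (rho : Omega -> R -> 'rV[R]_d) (Sigma : Omega -> R -> 'M[R]_d).
Hypotheses (T_gt0 : 0 < T) (F_def : forall t, F t = brownian_filtration P W t)
  (F_T : F T = @measurable dO Omega) (W_bm : brownian_motion P F T W).
Hypotheses (rho_prog : mx_progressive F `[0, T] (fun w s => diag_mx (rho w s)))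
  (Sigma_prog : mx_progressive F `[0, T] Sigma).
Variables (rt : Omega -> R -> 'rV[R]_d) (St : Omega -> R -> 'M[R]_d).
Hypotheses (brt : mx_bproc F 0 T rt) (bSt : mx_bproc F 0 T St).
Local Notation mu := (@lebesgue_measure R).
Local Notation E f := (\int[P]_w f w).
Hypothesis rtE : \forall w \ae P, \forall r \ae mu, 0 <= r <= T -> rt w r = rho w r.
Hypothesis StE : \forall w \ae P, \forall r \ae mu, 0 <= r <= T -> St w r = Sigma w r.

Let FF := brownian_is_filtration F_def F_T.

Definition driver (Q : Omega -> R -> 'M[R]_(d + d)) w s :=
  bsde_driver Lambda gamma (rt w s) (St w s) (Q w s).

Lemma mx_bproc_driver a b Q : 0 <= a -> b <= T -> mx_bproc F a b Q ->
  mx_bproc F a b (driver Q).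
Proof.
move=> a0 bT bQ.
have brt' := mx_bproc_sub a0 bT brt; have bSt' := mx_bproc_sub a0 bT bSt.
apply: (@entrywise_driver R (Omega * R)
  (fun g => bproc F a b (fun w r => g (w, r))) _ _ _ d Lambda gamma
  (fun z => rt z.1 z.2) (fun z => St z.1 z.2) (fun z => Q z.1 z.2)) => //.
- by move=> c; exact: bproc_cst.
- by move=> f g; exact: bprocD.
- by move=> f g; exact: bprocM.
Qed.

Lemma progressive_path m n (f : Omega -> R -> 'M[R]_(m, n)) w i j :
  mx_progressive F `[0, T] f -> measurable_fun (`[0, T]%classic : set R) (fun r => f w r i j).
Proof.
move=> pf; have T0T : `[0, T]%classic T by rewrite /= in_itv/= lexx (ltW T_gt0).
have := pf i j T T0T => mf.
have mI : measurable (`[0, T] `&` `]-oo, T] : set R) by exact: measurableI.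
have := @measurable_path_section _ (g_sigma_algebraType (F T)) R _
  (fun w r => f w r i j) w mI mf.
apply: measurable_funS => // r /=; rewrite !in_itv/= => /andP[r0 rT].
by split => //; apply/andP.
Qed.

(** In the integrated equation the increment of the Ito integral is bounded
    because all other terms are; testing the equation with [phi] makes it
    disappear. *)
Lemma truncated_bsde n Q M : bsde_solution P F T Lambda gamma rho Sigma W n Q M ->
  exists Qt : Omega -> R -> 'M[R]_(d + d),
  [/\ mx_bproc F 0 T Qt,
      mx_weak_equation P F 0 T Qt (driver Qt),
      \forall w \ae P, forall s, 0 <= s <= T -> Qt w s = Q w s /\ psd_mx (Qt w s) &
      \forall w \ae P, Qt w T = bsde_terminal gamma n].
Proof.
move=> [solQ _ [N [itoN eqN]]].
have pQ : mx_progressive F `[0, T] Q by case: solQ.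
have [Qt [bQ QtQ]] := truncate_continuous solQ.
have bf := mx_bproc_driver (lexx 0) (lexx T) bQ.
exists Qt; split => //; last first.
- apply: filterS2 eqN QtQ => w eqw Qtw.
  have T0T : 0 <= T <= T by rewrite lexx ltW.
  have [-> _] := Qtw T T0T; rewrite eqw// subrr subr0.
  rewrite (_ : mx_integral _ _ = 0) ?addr0//.
  by apply/matrixP => i j; rewrite !mxE set_itv1 Rintegral_set1.
- by apply: filterS QtQ => w h s sT; have [-> ?] := h s sT.
move=> i j s r phi s0 sr rT bphi.
have jf := bproc_joint FF (lexx 0) (ltW T_gt0) (lexx T) (bf i j).
have bfsr : bproc F s r (fun w q => driver Qt w q i j) by exact: bproc_sub (bf i j).
have jfsr := bproc_joint FF s0 sr rT bfsr.
have sT : 0 <= s <= T by rewrite s0 (le_trans sr).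
have r0T : 0 <= r <= T by rewrite rT (le_trans s0).
have bQt t : 0 <= t <= T -> bounded_measurable [set: Omega] (fun w => Qt w t i j).
  by move=> tT; apply: (brv_bm FF tT); exact: bproc_time (bQ i j).
have bphi' := brv_bm FF sT bphi.
pose I w := \int[mu]_(q in `[s, r]) driver Qt w q i j.
have bI : bounded_measurable [set: Omega] I by exact: bm_path_integral.
pose Z w := Qt w r i j - Qt w s i j + I w.
have bZ : bounded_measurable [set: Omega] Z.
  by apply: bmD => //; apply: bmB; exact: bQt.
have ZN : \forall w \ae P, Z w = N w r i j - N w s i j.
  apply: filter_app QtQ; apply: filter_app eqN.
  apply: filterS2 rtE StE => w rtw Stw eqw Qtw.
  have driverE t : 0 <= t <= T ->
      mx_integral `[t, T] (fun s => bsde_driver Lambda gamma (rho w s) (Sigma w s) (Q w s)) i j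
      = \int[mu]_(q in `[t, T]) driver Qt w q i j.
    move=> /andP[t0 tT]; rewrite mxE.
    have sub : (`[t, T]%classic : set R) `<=` `[0, T]%classic.
      by apply: subset_itvr; rewrite bnd_simp.
    apply: (@bm_ae_eq_int _ (measurableTypeR R) R mu) => //.
    - apply: (measurable_funS _ sub) => //.
      apply: (@entrywise_driver R R (fun g => measurable_fun (`[0, T]%classic : set R) g)) => //.
      + by move=> f g; exact: measurable_funD.
      + by move=> f g; exact: measurable_funM.
      + move=> k l; have := progressive_path w l l rho_prog.
        rewrite (_ : (fun q => diag_mx (rho w q) l l) = (fun q => rho w q k l))//.
        by apply/funext => q; rewrite mxE eqxx mulr1n (ord1 k).
      + by move=> k l; exact: progressive_path Sigma_prog.
      + by move=> k l; exact: progressive_path pQ.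
    - apply: (measurable_funS _ sub) => //.
      by have [] := jbm_path w jf.
    apply: filterS2 rtw Stw => q rtq Stq /=; rewrite in_itv/= => /andP[tq qT].
    have q0T : 0 <= q <= T by rewrite qT (le_trans t0).
    by rewrite /driver (rtq q0T) (Stq q0T); have [-> _] := Qtw q q0T.
  have Qij t : 0 <= t <= T -> Qt w t i j = bsde_terminal gamma n i j
      + \int[mu]_(q in `[t, T]) driver Qt w q i j - (N w T i j - N w t i j).
    move=> tT; have [-> _] := Qtw t tT.
    rewrite -driverE// eqw// !mxE//.
  rewrite /Z (Qij r r0T) (Qij s sT) (int_split sr rT); last first.
    have [_ [C _]] := jbm_path w jf.
    apply: bmS (jbm_path w jf) => //; apply: subset_itvr; rewrite bnd_simp//.
  by rewrite /I; ring.
have := ito_orthogonal F_def F_T W_bm (itoN i j) s0 sr rT bphi bZ ZN.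
have -> : (fun w => phi w * Z w) =
    (fun w => phi w * (Qt w r i j - Qt w s i j) + phi w * I w).
  by apply/funext => w; rewrite /Z mulrDr.
rewrite E_D; last 2 first.
- by apply: bmM => //; apply: bmB; exact: bQt.
- exact: bmM.
move/eqP; rewrite addr_eq0 => /eqP ->; congr (- _).
have bphi_f : bproc F s r (fun w q => phi w * driver Qt w q i j).
  by apply: bprocM => //; apply: (bproc_brv FF).
rewrite -(bproc_fubini P FF s0 sr rT bphi_f); congr Rintegral.
apply/funext => w; rewrite /I int_Z//; exact: jbm_path jfsr.
Qed.
End TruncatedBSDE.

(** * Algebra of the Riccati driver *)

Section PositiveDefinite.
Context (R : realType).

Lemma pd_unitmx n (A : 'M[R]_n) : pd_mx A -> A \in unitmx.
Proof.
move=> [AT pA]; rewrite -row_free_unit -kermx_eq0; apply/contraT => k0.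
have nz : nz_row (kermx A) != 0 by rewrite nz_row_eq0.
have /sub_kermxP vA : (nz_row (kermx A) <= kermx A)%MS by exact: nz_row_sub.
have := pA (nz_row (kermx A))^T; rewrite trmxK vA mul0mx mxE ltxx; apply.
by apply: contra nz => /eqP h; rewrite -[X in X == _]trmxK h trmx0.
Qed.

Lemma bilin_mull m (C A : 'M[R]_m) u v : bilin (C *m u) A v = bilin u (C^T *m A) v.
Proof. by rewrite /bilin trmx_mul !mulmxA. Qed.

Lemma bilin_mulr m (C A : 'M[R]_m) u v : bilin u A (C *m v) = bilin u (A *m C) v.
Proof. by rewrite /bilin !mulmxA. Qed.

Lemma bilin_block m (a b c e : 'M[R]_m) (x y x' y' : 'cV[R]_m) :
  bilin (col_mx x y) (block_mx a b c e) (col_mx x' y') =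
  bilin x a x' + bilin x b y' + bilin y c x' + bilin y e y'.
Proof.
rewrite /bilin tr_col_mx mul_row_block mul_row_col !mulmxDl !mxE.
by ring.
Qed.

Lemma bilin_quad_bound m (A : 'M[R]_m) c v : (forall i j, `|A i j| <= c) ->
  `|bilin v A v| <= c * m%:R * \sum_i v i 0 ^+ 2.
Proof.
move=> Ac; rewrite bilinE.
apply: (@le_trans _ _ (\sum_i \sum_j (c / 2 * (v i 0 ^+ 2 + v j 0 ^+ 2)))).
  apply: (le_trans (ler_norm_sum _ _ _)); apply: ler_sum => i _.
  apply: (le_trans (ler_norm_sum _ _ _)); apply: ler_sum => j _.
  have c0 : 0 <= c := le_trans (normr_ge0 _) (Ac i j).
  rewrite normrM; apply: (@le_trans _ _ (`|v i 0 * v j 0| * c)).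
    by rewrite ler_wpM2l.
  rewrite [leLHS]mulrC -mulrA ler_wpM2l// ler_pdivlMl ?ltr0n//.
  rewrite normrM -(real_normK (num_real (v i 0))) -(real_normK (num_real (v j 0))).
  by have := sqr_ge0 (`|v i 0| - `|v j 0|); nra.
set s := \sum_(i < m) v i 0 ^+ 2.
rewrite (eq_bigr (fun i => c / 2 * (m%:R * v i 0 ^+ 2 + s))) => [|i _]; last first.
  by rewrite -mulr_sumr big_split/= sumr_const card_ord -[_ *+ m]mulr_natl.
rewrite -mulr_sumr big_split/= -mulr_sumr sumr_const card_ord -/s -[s *+ m]mulr_natl.
by rewrite le_eqVlt; apply/orP; left; apply/eqP; field.
Qed.

Lemma bilin_scalar m (c : R) (u v : 'cV[R]_m) :
  bilin u c%:M v = c * \sum_i u i 0 * v i 0.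
Proof.
rewrite /bilin -mulmxA mul_scalar_mx -scalemxAr mxE; congr (_ * _).
by rewrite mxE; apply: eq_bigr => i _; rewrite mxE.
Qed.

Lemma bilin_diag m (g : 'rV[R]_m) (u v : 'cV[R]_m) :
  bilin u (diag_mx g) v = \sum_i g 0 i * (u i 0 * v i 0).
Proof.
rewrite /bilin -mulmxA mxE; apply: eq_bigr => i _.
by rewrite mul_diag_mx !mxE mulrCA.
Qed.
End PositiveDefinite.

Section Riccati.
Context (R : realType) (d : nat).
Variables (Lambda : 'M[R]_d) (gamma : 'rV[R]_d).
Hypotheses (Lambda_pd : pd_mx Lambda).
Local Notation Gamma := (diag_mx gamma).

(** With [Z = (X, Y)] the state equation of a control [xi] reads [dZ =
    (drift_mx rho Z + control_mx xi) dt], and the running cost is [Z^T cost_mx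
    Z + xi^T Lambda xi]. *)
Definition control_mx : 'M[R]_(d + d, d) := col_mx (- 1%:M) Gamma.
Definition drift_mx (rho : 'rV[R]_d) : 'M[R]_(d + d) := block_mx 0 0 0 (- diag_mx rho).
Definition cost_mx (rho : 'rV[R]_d) (Sigma : 'M[R]_d) : 'M[R]_(d + d) :=
  block_mx Sigma 0 0 (invmx Gamma *m diag_mx rho + diag_mx rho *m invmx Gamma).

Lemma control_mxT : control_mx^T = row_mx (- 1%:M) Gamma.
Proof. by rewrite /control_mx tr_col_mx linearN /= trmx1 tr_diag_mx. Qed.

Lemma drift_mxT rho : (drift_mx rho)^T = drift_mx rho.
Proof. by rewrite /drift_mx tr_block_mx !trmx0 linearN /= tr_diag_mx. Qed.

Lemma bsde_driverE rho Sigma Q :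
  bsde_driver Lambda gamma rho Sigma Q =
  - (Q *m control_mx *m invmx Lambda *m control_mx^T *m Q)
  + Q *m drift_mx rho + drift_mx rho *m Q + cost_mx rho Sigma.
Proof. by rewrite control_mxT. Qed.

(** Completion of the square: the driver is the minimum over [xi] of the terms
    without the last one, and the optimal feedback makes the last one vanish.
    *)
Lemma riccati_square rho Sigma Q v xi : Q^T = Q ->
  bilin v (bsde_driver Lambda gamma rho Sigma Q) v =
  bilin (drift_mx rho *m v + control_mx *m xi) Q v
  + bilin v Q (drift_mx rho *m v + control_mx *m xi)
  + bilin v (cost_mx rho Sigma) v + bilin xi Lambda xi
  - bilin (xi + invmx Lambda *m control_mx^T *m Q *m v) Lambda
          (xi + invmx Lambda *m control_mx^T *m Q *m v).
Proof.
move=> QT; have LT : Lambda^T = Lambda by case: Lambda_pd.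
have LU := pd_unitmx Lambda_pd.
have LIT : (invmx Lambda)^T = invmx Lambda by rewrite trmx_inv LT.
set w := control_mx^T *m Q *m v.
have -> : invmx Lambda *m control_mx^T *m Q *m v = invmx Lambda *m w.
  by rewrite /w !mulmxA.
rewrite bsde_driverE !bilinDm bilinNm.
rewrite !(bilinDl, bilinDr) bilin_mull bilin_mulr drift_mxT.
have e1 : bilin v (Q *m control_mx *m invmx Lambda *m control_mx^T *m Q) v =
    (w^T *m invmx Lambda *m w) 0 0.
  by rewrite /bilin /w !trmx_mul trmxK QT !mulmxA.
have e2 : bilin (control_mx *m xi) Q v = (xi^T *m w) 0 0.
  by rewrite /bilin /w trmx_mul !mulmxA.
have e3 : bilin v Q (control_mx *m xi) = (xi^T *m w) 0 0.
  by rewrite bilin_sym.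
have e4 : bilin xi Lambda (invmx Lambda *m w) = (xi^T *m w) 0 0.
  by rewrite bilin_mulr mulmxV// /bilin mulmx1.
have e5 : bilin (invmx Lambda *m w) Lambda xi = (xi^T *m w) 0 0.
  by rewrite bilin_sym.
have e6 : bilin (invmx Lambda *m w) Lambda (invmx Lambda *m w) =
    (w^T *m invmx Lambda *m w) 0 0.
  by rewrite bilin_mulr mulmxV// /bilin mulmx1 trmx_mul LIT.
by rewrite e1 e2 e3 e4 e5 e6; ring.
Qed.
End Riccati.

(** * Comparison of Riccati solutions *)

Section WeakAlgebra.
Context d (Omega : measurableType d) (R : realType) (P : probability Omega R).
Variables (F : R -> set (set Omega)) (T : R).
Hypothesis FF : filtration F T.
Local Notation mu := (@lebesgue_measure R).
Local Notation E f := (\int[P]_w f w).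

Lemma weak_equationB a b D1 f1 D2 f2 : 0 <= a -> b <= T ->
  bproc F a b D1 -> bproc F a b f1 -> bproc F a b D2 -> bproc F a b f2 ->
  weak_equation P F a b D1 f1 -> weak_equation P F a b D2 f2 ->
  weak_equation P F a b (fun w r => D1 w r - D2 w r) (fun w r => f1 w r - f2 w r).
Proof.
move=> a0 bT bD1 bf1 bD2 bf2 w1 w2 s r phi sa sr rb bphi.
have s0 := le_trans a0 sa; have rT := le_trans rb bT.
have sT : 0 <= s <= T by rewrite s0 (le_trans sr).
have r0T : 0 <= r <= T by rewrite rT (le_trans s0).
have bm t D : a <= t <= b -> bproc F a b D -> bounded_measurable [set: Omega] (D ^~ t).
  move=> tab bD; apply: (brv_bm FF (t := t)); last exact: bproc_time bD.
  by case/andP: tab => ta tb; rewrite (le_trans a0 ta) (le_trans tb).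
have sab : a <= s <= b by rewrite sa (le_trans sr).
have rab : a <= r <= b by rewrite rb (le_trans sa).
have bphi' := brv_bm FF sT bphi.
have bmi D : bproc F a b D ->
    bounded_measurable [set: Omega] (fun w => phi w * (D w r - D w s)).
  by move=> bD; apply: bmM => //; apply: bmB; exact: bm bD.
have bpf f : bproc F a b f -> bproc F s r (fun w q => phi w * f w q).
  move=> bf; apply: bprocM; first by apply: (bproc_brv FF).
  exact: bproc_sub bf.
have -> : (fun w => phi w * (D1 w r - D2 w r - (D1 w s - D2 w s))) =
    (fun w => phi w * (D1 w r - D1 w s) - phi w * (D2 w r - D2 w s)).
  by apply/funext => w; ring.
rewrite E_B; [|exact: bmi|exact: bmi].
rewrite (w1 s r)// (w2 s r)// -opprD; congr (- _).
rewrite -int_B; [|by apply: (bproc_mean P FF) => //; exact: bpf|by apply: (bproc_mean P FF) => //; exact: bpf].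
apply: eq_Rintegral => q /set_mem/=; rewrite in_itv/= => /andP[sq qr].
have q0T : 0 <= q <= T by rewrite (le_trans s0 sq) (le_trans qr).
have bq f : bproc F a b f -> bounded_measurable [set: Omega] (fun w => phi w * f w q).
  move=> bf; apply: (brv_bm FF q0T).
  by apply: (bproc_time (a := s) (b := r) _ (bpf f bf)); rewrite sq.
by rewrite -E_B//; [congr Rintegral; apply/funext => w; ring|exact: bq|exact: bq].
Qed.

Lemma weak_equation_deterministic a b (k g : R -> R) : 0 <= a -> b <= T ->
  bounded_measurable (`[a, b]%classic : set R) g ->
  (forall s r, a <= s -> s <= r -> r <= b ->
     k r - k s = - \int[mu]_(q in `[s, r]) g q) ->
  weak_equation P F a b (fun _ r => k r) (fun _ r => g r).
Proof.
move=> a0 bT bg kg s r phi sa sr rb bphi.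
have s0 := le_trans a0 sa; have rT := le_trans rb bT.
have sT : 0 <= s <= T by rewrite s0 (le_trans sr).
have bphi' := brv_bm FF sT bphi.
have swap c : E (fun w => phi w * c) = E phi * c.
  by rewrite -[RHS]mulrC -E_Z//; congr Rintegral; apply/funext => w; rewrite mulrC.
rewrite swap kg// mulrN; congr (- _); rewrite -int_Z; last first.
  apply: bmS bg => //; exact: (subset_itv _ _).
by congr Rintegral; apply/funext => q; rewrite swap.
Qed.
End WeakAlgebra.

Section RiccatiComparison.
Context dO (Omega : measurableType dO) (R : realType) (P : probability Omega R).
Variables (F : R -> set (set Omega)) (d : nat) (T : R).
Hypothesis FF : filtration F T.
Variables (Lambda : 'M[R]_d) (gamma : 'rV[R]_d).
Hypothesis Lambda_pd : pd_mx Lambda.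
Variables (rt : Omega -> R -> 'rV[R]_d) (St : Omega -> R -> 'M[R]_d).
Hypotheses (brt : mx_bproc F 0 T rt) (bSt : mx_bproc F 0 T St).
Local Notation mu := (@lebesgue_measure R).
Local Notation E f := (\int[P]_w f w).
Local Notation driver := (driver Lambda gamma rt St).
Local Notation B := (control_mx gamma).
Local Notation A w p := (drift_mx (rt w p)).
Local Notation H w p := (cost_mx gamma (rt w p) (St w p)).

Lemma pd_ge0 n (L : 'M[R]_n) v : pd_mx L -> 0 <= bilin v L v.
Proof.
move=> [_ pL]; have [->|v0] := eqVneq v 0; last exact/ltW/pL.
by rewrite /bilin mulmx0 mxE.
Qed.

Lemma mx_bproc_drift a b : 0 <= a -> b <= T -> mx_bproc F a b (fun w p => A w p).
Proof.
move=> a0 bT; have brt' := mx_bproc_sub a0 bT brt.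
have clos := @entrywise_block R (Omega * R) (fun g => bproc F a b (fun w r => g (w, r))).
apply: (clos d d d d (fun=> 0) (fun=> 0) (fun=> 0) (fun z => - diag_mx (rt z.1 z.2))).
- by move=> i j; exact: bproc_cst.
- by move=> i j; exact: bproc_cst.
- by move=> i j; exact: bproc_cst.
apply: mx_bprocN.
apply: (@entrywise_diag R (Omega * R) (fun g => bproc F a b (fun w r => g (w, r)))
  _ _ d (fun z => rt z.1 z.2)) => //.
- by move=> c; exact: bproc_cst.
- by move=> f g; exact: bprocM.
Qed.

(** Any feedback [L] costs at least the value. By completion of the square, [K
    - Q] satisfies the hypothesis of [linear_comparison] along the dynamics
    closed by [L]. *)
Lemma supersolution_comparison (s e : R) K g L Q V :
  0 <= s -> s <= e -> e <= T ->
  mx_bproc F s e K -> mx_bproc F s e g -> mx_bproc F s e L -> mx_bproc F s e Q ->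
  mx_weak_equation P F s e K g -> mx_weak_equation P F s e Q (driver Q) ->
  (\forall w \ae P, forall p : R, s <= p <= e -> (Q w p)^T = Q w p) ->
  (\forall w \ae P, \forall p \ae mu, s <= p <= e -> forall v,
    bilin (A w p *m v + B *m (L w p *m v)) (K w p) v
    + bilin v (K w p) (A w p *m v + B *m (L w p *m v))
    + bilin v (H w p) v + bilin (L w p *m v) Lambda (L w p *m v)
    <= bilin v (g w p) v) ->
  (\forall w \ae P, forall v, bilin v (Q w e) v <= bilin v (K w e) v) ->
  mx_brv F s V ->
  E (fun w => bilin (V w) (Q w s) (V w)) <= E (fun w => bilin (V w) (K w s) (V w)).
Proof.
move=> s0 se eT bK bg bL bQ Kg Qf symQ super term bV.
have bf := mx_bproc_driver Lambda gamma brt bSt s0 eT bQ.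
have bA := mx_bproc_drift s0 eT.
pose C w p := A w p + B *m L w p.
have bC : mx_bproc F s e C.
  by apply: mx_bprocD => //; apply: mx_bproc_mul => //; exact: mx_bproc_cst.
have bKQ : mx_bproc F s e (fun w p => K w p - Q w p).
  by apply: mx_bprocD => //; exact: mx_bprocN.
have bgf : mx_bproc F s e (fun w p => g w p - driver Q w p).
  by apply: mx_bprocD => //; exact: mx_bprocN.
have wKQ : mx_weak_equation P F s e (fun w p => K w p - Q w p)
    (fun w p => g w p - driver Q w p).
  move=> i j; have := weak_equationB FF s0 eT (bK i j) (bg i j) (bQ i j) (bf i j) (Kg i j) (Qf i j).
  have mxB (D1 D2 : Omega -> R -> 'M[R]_(d + d)) :
      (fun w r => D1 w r i j - D2 w r i j) = (fun w r => (D1 w r - D2 w r) i j).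
    by apply/funext => w; apply/funext => r; rewrite !mxE.
  by rewrite !mxB.
have := linear_comparison FF s0 se eT bKQ bgf bC wKQ _ _ bV.
have bilinB v D1 D2 : bilin v (D1 - D2) v = bilin v D1 v - bilin v D2 v :> R.
  by rewrite bilinDm bilinNm.
have -> : (fun w => bilin (V w) (K w s - Q w s) (V w)) =
    (fun w => bilin (V w) (K w s) (V w) - bilin (V w) (Q w s) (V w)).
  by apply/funext => w; rewrite bilinB.
have sT : 0 <= s <= T by rewrite s0 (le_trans se).
have ses : s <= s <= e by rewrite lexx.
rewrite E_B; last 2 first.
- by apply: (brv_bm FF sT); apply: brv_bilin => //; exact: mx_bproc_time bK.
- by apply: (brv_bm FF sT); apply: brv_bilin => //; exact: mx_bproc_time bQ.
rewrite subr_ge0; apply.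
  apply: filterS2 symQ super => w sw; apply: filterS => p h pse v.
  have := h pse v; rewrite /C mulmxDl -mulmxA.
  set z := A w p *m v + B *m (L w p *m v) => hz.
  rewrite bilinB bilinDm bilinNm.
  have -> : bilin v (K w p - Q w p) z = bilin v (K w p) z - bilin v (Q w p) z.
    by rewrite bilinDm bilinNm.
  rewrite /driver (riccati_square gamma Lambda_pd (rt w p) (St w p) v (L w p *m v) (sw p pse)).
  rewrite -/z; set q := bilin (_ + _) Lambda _.
  have : 0 <= q by exact: pd_ge0.
  by lra.
by apply: filterS term => w h v; rewrite bilinB subr_ge0.
Qed.

(** The optimal feedback of the larger solution makes it a supersolution for
    the smaller terminal condition. *)
Lemma riccati_monotone (s e : R) Q1 Q2 V : 0 <= s -> s <= e -> e <= T ->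
  mx_bproc F s e Q1 -> mx_bproc F s e Q2 ->
  mx_weak_equation P F s e Q1 (driver Q1) -> mx_weak_equation P F s e Q2 (driver Q2) ->
  (\forall w \ae P, forall p : R, s <= p <= e -> (Q1 w p)^T = Q1 w p) ->
  (\forall w \ae P, forall p : R, s <= p <= e -> (Q2 w p)^T = Q2 w p) ->
  (\forall w \ae P, forall v, bilin v (Q1 w e) v <= bilin v (Q2 w e) v) ->
  mx_brv F s V ->
  E (fun w => bilin (V w) (Q1 w s) (V w)) <= E (fun w => bilin (V w) (Q2 w s) (V w)).
Proof.
move=> s0 se eT bQ1 bQ2 wQ1 wQ2 sym1 sym2 term bV.
apply: (@supersolution_comparison s e Q2 (driver Q2)
  (fun w p => - (invmx Lambda *m B^T *m Q2 w p))) => //.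
- exact: mx_bproc_driver.
- apply: mx_bprocN; apply: mx_bproc_mul => //; exact: mx_bproc_cst.
apply: filterS sym2 => w sw; apply: nearW => p pse v.
rewrite /driver (riccati_square gamma Lambda_pd (rt w p) (St w p) v
  (- (invmx Lambda *m B^T *m Q2 w p) *m v) (sw p pse)).
rewrite mulNmx addNr.
have -> : bilin (0 : 'cV[R]_d) Lambda 0 = 0 by rewrite /bilin mulmx0 mxE.
by rewrite subr0.
Qed.
End RiccatiComparison.

(** * A supersolution exploding after the terminal time *)

Section PointwiseSupersolution.
Context (R : realType) (d : nat).
Variables (Lambda : 'M[R]_d) (gamma : 'rV[R]_d).
Hypothesis gamma_gt0 : forall i, 0 < gamma 0 i.

Lemma invmx_diag_pos : invmx (diag_mx gamma) = diag_mx (\row_i (gamma 0 i)^-1).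
Proof.
have h : diag_mx (\row_i (gamma 0 i)^-1) *m diag_mx gamma = 1%:M.
  rewrite mulmx_diag -diag_const_mx; congr diag_mx.
  by apply/rowP => i; rewrite !mxE mulVf// gt_eqF.
have gU : diag_mx gamma \in unitmx by case: (mulmx1_unit h).
by rewrite -[LHS]mul1mx -h -mulmxA mulmxV// mulmx1.
Qed.

Lemma bilin_cost (rho : 'rV[R]_d) Sigma (x y : 'cV[R]_d) :
  bilin (col_mx x y) (cost_mx gamma rho Sigma) (col_mx x y) =
  bilin x Sigma x + \sum_i 2 * (rho 0 i / gamma 0 i) * y i 0 ^+ 2.
Proof.
rewrite /cost_mx bilin_block !(bilinDm, invmx_diag_pos, mulmx_diag) !bilin_diag.
have b0 u v : bilin u (0 : 'M[R]_d) v = 0 by rewrite /bilin mulmx0 mul0mx mxE.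
rewrite !b0 !addr0 -big_split /=; congr (_ + _).
by apply: eq_bigr => i _; rewrite !mxE; ring.
Qed.

Lemma drift_control_col (rho : 'rV[R]_d) (x y xi : 'cV[R]_d) :
  drift_mx rho *m col_mx x y + control_mx gamma *m xi =
  col_mx (- xi) (diag_mx gamma *m xi - diag_mx rho *m y).
Proof.
rewrite /drift_mx /control_mx mul_block_col mul_col_mx !mul0mx !add0r.
by rewrite add_col_mx add0r mulNmx mul1mx mulNmx addrC.
Qed.

(** Trading at the rate [l * x] lowers [al * l * |x|^2] at the rate [2 * al *
    l^2 * |x|^2]. Half of this pays for the inventory, for the trades and for
    their effect on [y], which is the condition on [al]; the other half leaves
    room for the growth of [l]. *)
Lemma supersolution_pointwise (rho : 'rV[R]_d) (Sigma : 'M[R]_d) cS cL G al l m v :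
  (forall i, 0 <= rho 0 i) -> (forall i j, `|Sigma i j| <= cS) ->
  (forall i j, `|Lambda i j| <= cL) ->
  (forall i, (gamma 0 i)^-1 <= m) -> (forall i, gamma 0 i ^+ 2 <= G) ->
  cS * d%:R + cL * d%:R * l ^+ 2 + m ^+ 2 * G * l ^+ 2 <= al * l ^+ 2 ->
  let K := block_mx (al * l)%:M 0 0 m%:M in
  let xi := row_mx l%:M 0 *m v in
  let z := drift_mx rho *m v + control_mx gamma *m xi in
  bilin z K v + bilin v K z + bilin v (cost_mx gamma rho Sigma) v
    + bilin xi Lambda xi
  <= bilin v (block_mx (- (al * l ^+ 2))%:M 0 0 1%:M) v.
Proof.
move=> rho0 SigmaS LambdaL mg gG alb; cbv zeta.
rewrite -(vsubmxK v).
move: (usubmx v) (dsubmx v) => x y.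
rewrite mul_row_col mul_scalar_mx mul0mx addr0.
rewrite drift_control_col bilin_cost.
have b0 u u' : bilin u (0 : 'M[R]_d) u' = 0 by rewrite /bilin mulmx0 mul0mx mxE.
rewrite !bilin_block !b0 !addr0 !bilin_scalar bilinZl bilinZr.
have hS := bilin_quad_bound x SigmaS.
have hL := bilin_quad_bound x LambdaL.
have {}hS := le_trans (ler_norm _) hS; have {}hL := le_trans (ler_norm _) hL.
have l2 : 0 <= l ^+ 2 by exact: sqr_ge0.
have hL' : l * (l * bilin x Lambda x) <= l ^+ 2 * (cL * d%:R * \sum_i x i 0 ^+ 2).
  by rewrite mulrA -expr2 ler_wpM2l.
apply: (@le_trans _ _ (al * l * \sum_i (- (l *: x)) i 0 * x i 0 +
   m * \sum_i (diag_mx gamma *m (l *: x) - diag_mx rho *m y) i 0 * y i 0 +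
   (al * l * \sum_i x i 0 * (- (l *: x)) i 0 +
   m * \sum_i y i 0 * (diag_mx gamma *m (l *: x) - diag_mx rho *m y) i 0) +
   (cS * d%:R * \sum_i x i 0 ^+ 2 + \sum_i 2 * (rho 0 i / gamma 0 i) * y i 0 ^+ 2) +
   l ^+ 2 * (cL * d%:R * \sum_i x i 0 ^+ 2))).
  by apply: lerD => //; rewrite lerD2l lerD2r.
rewrite !mulr_sumr -!big_split /=; apply: ler_sum => i _.
rewrite !mul_diag_mx !mxE.
have := mg i; have := gG i; have := rho0 i; have := gamma_gt0 i.
move: (gamma 0 i) (rho 0 i) (x i 0) (y i 0) => g r a b g0 r0 gG' mgi.
have h1 : 0 <= 2 * r * (m - g^-1) * b ^+ 2.
  apply: mulr_ge0; last exact: sqr_ge0.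
  by apply: mulr_ge0; [exact: mulr_ge0|rewrite subr_ge0].
have h2 : 0 <= (al * l ^+ 2 - (cS * d%:R + cL * d%:R * l ^+ 2 + m ^+ 2 * G * l ^+ 2)) * a ^+ 2.
  by apply: mulr_ge0; [rewrite subr_ge0|exact: sqr_ge0].
have h3 : 0 <= (b - m * g * l * a) ^+ 2 by exact: sqr_ge0.
have h4 : 0 <= (m * l * a) ^+ 2 * (G - g ^+ 2).
  by apply: mulr_ge0; [exact: sqr_ge0|rewrite subr_ge0].
rewrite -subr_ge0.
set rhs := (X in 0 <= X).
have -> : rhs = 2 * r * (m - g^-1) * b ^+ 2 +
  (al * l ^+ 2 - (cS * d%:R + cL * d%:R * l ^+ 2 + m ^+ 2 * G * l ^+ 2)) * a ^+ 2 +
  (b - m * g * l * a) ^+ 2 + (m * l * a) ^+ 2 * (G - g ^+ 2).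
  by rewrite /rhs; ring.
by rewrite !addr_ge0.
Qed.

Lemma terminal_dominated n (k m : R) v : n%:R + 1 <= k ->
  (forall i, 1 + (gamma 0 i)^-1 <= m) ->
  bilin v (bsde_terminal gamma n) v <= bilin v (block_mx k%:M 0 0 m%:M) v.
Proof.
move=> nk gm; rewrite -(vsubmxK v) /bsde_terminal invmx_diag_pos.
move: (usubmx v) (dsubmx v) => x y.
have b0 u u' : bilin u (0 : 'M[R]_d) u' = 0 by rewrite /bilin mulmx0 mul0mx mxE.
rewrite !bilin_block !b0 !addr0 !bilin_scalar bilin_diag !mulr_sumr -!big_split /=.
apply: ler_sum => i _; rewrite !mxE.
have := gm i; move: (gamma 0 i)^-1 (x i 0) (y i 0) => g a b g1.
have h1 : 0 <= (k - (n%:R + 1)) * a ^+ 2.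
  by apply: mulr_ge0; [rewrite subr_ge0|exact: sqr_ge0].
have h2 : 0 <= (m - (1 + g)) * b ^+ 2.
  by apply: mulr_ge0; [rewrite subr_ge0|exact: sqr_ge0].
have h3 := sqr_ge0 (a - b).
rewrite -subr_ge0; set rhs := (X in 0 <= X).
have -> : rhs = (k - (n%:R + 1)) * a ^+ 2 + (m - (1 + g)) * b ^+ 2 + (a - b) ^+ 2.
  by rewrite /rhs; ring.
by rewrite !addr_ge0.
Qed.
End PointwiseSupersolution.

Section Blowup.
Context (R : realType).
Local Notation mu := (@lebesgue_measure R).
Variables (c : R).

Lemma inv_shift_derive (x : R) : x < c ->
  is_derive x 1 (fun r : R => (c - r)^-1) ((c - x) ^- 2).
Proof.
move=> xc; have cx : c - x != 0 by rewrite gt_eqF// subr_gt0.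
have h : is_derive x 1 (fun r : R => c - r) (-1).
  by apply: is_derive_eq; rewrite add0r mul1r.
have h1 := @is_deriveV R (fun r : R => c - r) x (-1) 1 cx h.
by apply: (is_derive_eq h1); rewrite scaleNr scalerN opprK scaler1.
Qed.

Lemma inv_shift_measurable (a b : R) : b < c ->
  measurable_fun (`[a, b]%classic : set R) (fun r => (c - r)^-1).
Proof.
move=> bc; apply: subspace_continuous_measurable_fun => //.
apply: continuous_in_subspaceT => x /set_mem/=; rewrite in_itv/= => /andP[_ xb].
apply: differentiable_continuous; apply/derivable1_diffP.
by have [] := inv_shift_derive (le_lt_trans xb bc).
Qed.

Lemma inv_shift_integral (a b : R) : a <= b -> b < c ->
  \int[mu]_(q in `[a, b]) (c - q) ^- 2 = (c - b)^-1 - (c - a)^-1.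
Proof.
rewrite le_eqVlt => /predU1P[<-|ab] bc; first by rewrite set_itv1 Rintegral_set1 subrr.
have cont f : (forall x, x < c -> {for x, continuous f}) ->
    {within `[a, b], continuous (f : R -> R)}.
  move=> cf; apply: continuous_in_subspaceT => x /set_mem/=; rewrite in_itv/= => /andP[_ xb].
  by apply: cf; exact: le_lt_trans bc.
have cinv x : x < c -> {for x, continuous (fun r : R => (c - r)^-1)}.
  by move=> xc; apply: differentiable_continuous; apply/derivable1_diffP; have [] := inv_shift_derive xc.
have := @continuous_FTC2 R (fun q => (c - q) ^- 2) (fun q => (c - q)^-1) a b ab.
rewrite /Rintegral => -> //.
- have -> : (fun q => (c - q) ^- 2) = (fun q => (c - q)^-1 * (c - q)^-1).
    by apply/funext => q; rewrite -exprVn expr2.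
  by apply: cont => x xc; apply: cvgM; exact: cinv.
- have := cont _ cinv => /(continuous_within_itvP _ ab)[_ ca cb].
  split => // x; rewrite in_itv/= => /andP[_ xb].
  by have [] := inv_shift_derive (lt_trans xb bc).
move=> x; rewrite in_itv/= => /andP[_ xb]; rewrite derive1E.
by have [_ ->] := inv_shift_derive (lt_trans xb bc).
Qed.
End Blowup.

(** * Bounds uniform in the penalty *)

Section UniformBound.
Context dO (Omega : measurableType dO) (R : realType) (P : probability Omega R).
Variables (F : R -> set (set Omega)) (d : nat) (T : R).
Hypothesis FF : filtration F T.
Hypothesis T_gt0 : 0 < T.
Variables (Lambda : 'M[R]_d) (gamma : 'rV[R]_d).
Hypothesis Lambda_pd : pd_mx Lambda.
Hypothesis gamma_gt0 : forall i, 0 < gamma 0 i.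
Variables (rt : Omega -> R -> 'rV[R]_d) (St : Omega -> R -> 'M[R]_d).
Hypotheses (brt : mx_bproc F 0 T rt) (bSt : mx_bproc F 0 T St).
Hypothesis rt_ge0 : forall w r i, 0 <= rt w r 0 i.
Local Notation mu := (@lebesgue_measure R).
Local Notation E f := (\int[P]_w f w).
Local Notation driver := (driver Lambda gamma rt St).

Definition solves_riccati (n : nat) (Q : Omega -> R -> 'M[R]_(d + d)) : Prop :=
  [/\ mx_bproc F 0 T Q, mx_weak_equation P F 0 T Q (driver Q),
      \forall w \ae P, forall s : R, 0 <= s <= T -> psd_mx (Q w s) &
      \forall w \ae P, Q w T = bsde_terminal gamma n].

Let pick_bounds : exists cS cL : R, [/\ 0 <= cS, 0 <= cL,
  forall w (p : R) i j, 0 <= p <= T -> `|St w p i j| <= cS & forall i j, `|Lambda i j| <= cL].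
Proof.
have [cS cS0 SS] := mx_bproc_bound FF (lexx 0) (ltW T_gt0) (lexx T) bSt.
have [cL cL0 LL] := @mx_brv_bound _ Omega R F d d 0 (fun=> Lambda)
  (fun i j => bm_cst _ _).
by exists cS, cL; split => // i j; exact: (LL point).
Qed.

Let scalar_diag (kx ky gx gy : R -> R) :
  let K r := block_mx (kx r)%:M 0 0 (ky r)%:M : 'M[R]_(d + d) in
  let G r := block_mx (gx r)%:M 0 0 (gy r)%:M : 'M[R]_(d + d) in
  bounded_measurable (`[0, T]%classic : set R) kx ->
  bounded_measurable (`[0, T]%classic : set R) ky ->
  bounded_measurable (`[0, T]%classic : set R) gx ->
  bounded_measurable (`[0, T]%classic : set R) gy ->
  (forall s r, 0 <= s -> s <= r -> r <= T -> kx r - kx s = - \int[mu]_(q in `[s, r]) gx q) ->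
  (forall s r, 0 <= s -> s <= r -> r <= T -> ky r - ky s = - \int[mu]_(q in `[s, r]) gy q) ->
  [/\ mx_bproc F 0 T (fun (_ : Omega) r => K r), mx_bproc F 0 T (fun (_ : Omega) r => G r) &
      mx_weak_equation P F 0 T (fun _ r => K r) (fun _ r => G r)].
Proof.
move=> K G bkx bky bgx bgy kgx kgy.
have entry (hx hy : R -> R) i j :
    [\/ (forall r, (block_mx (hx r)%:M 0 0 (hy r)%:M : 'M[R]_(d + d)) i j = hx r) /\
        (forall r, G r i j = gx r) /\ (forall r, K r i j = kx r),
      (forall r, (block_mx (hx r)%:M 0 0 (hy r)%:M : 'M[R]_(d + d)) i j = hy r) /\
        (forall r, G r i j = gy r) /\ (forall r, K r i j = ky r) |
      (forall r, (block_mx (hx r)%:M 0 0 (hy r)%:M : 'M[R]_(d + d)) i j = 0) /\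
        (forall r, G r i j = 0) /\ (forall r, K r i j = 0)].
  rewrite /G /K; case: (split_ordP i) => i' ->; case: (split_ordP j) => j' ->.
  - have [<-|ij] := eqVneq i' j'.
      by constructor 1; split; [|split]; move=> r; rewrite block_mxEul mxE eqxx mulr1n.
    by constructor 3; split; [|split]; move=> r; rewrite block_mxEul mxE (negbTE ij) mulr0n.
  - by constructor 3; split; [|split]; move=> r; rewrite block_mxEur mxE.
  - by constructor 3; split; [|split]; move=> r; rewrite block_mxEdl mxE.
  - have [<-|ij] := eqVneq i' j'.
      by constructor 2; split; [|split]; move=> r; rewrite block_mxEdr mxE eqxx mulr1n.
    by constructor 3; split; [|split]; move=> r; rewrite block_mxEdr mxE (negbTE ij) mulr0n.
have bnd hx hy : bounded_measurable (`[0, T]%classic : set R) hx ->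
    bounded_measurable (`[0, T]%classic : set R) hy ->
    mx_bproc F 0 T (fun (_ : Omega) r => block_mx (hx r)%:M 0 0 (hy r)%:M : 'M[R]_(d + d)).
  move=> bx by_ i j; case: (entry hx hy i j) => -[h _].
  - by under eq_fun do under eq_fun do rewrite h; exact: bproc_det.
  - by under eq_fun do under eq_fun do rewrite h; exact: bproc_det.
  - by under eq_fun do under eq_fun do rewrite h; exact: bproc_cst.
split; [exact: bnd|exact: bnd|].
have rw (h k : R -> R) i j (A : R -> 'M[R]_(d + d)) : (forall r, A r i j = k r) ->
    (fun (_ : Omega) r => A r i j) = (fun (_ : Omega) r => k r).
  by move=> e; apply/funext => w; apply/funext => r.
move=> i j; case: (entry kx ky i j) => -[_ [hG hK]].
- rewrite (rw kx _ _ _ _ hK) (rw kx _ _ _ _ hG).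
  exact: (weak_equation_deterministic P FF).
- rewrite (rw kx _ _ _ _ hK) (rw kx _ _ _ _ hG).
  exact: (weak_equation_deterministic P FF).
- rewrite (rw kx _ _ _ _ hK) (rw kx _ _ _ _ hG).
  apply: (weak_equation_deterministic P FF (k := fun=> 0) (g := fun=> 0)) => //.
    exact: bm_cst.
  by move=> s r s0 sr rT; rewrite int_cst// mul0r subrr oppr0.
Qed.

(** Every penalized solution lies below the block-diagonal supersolution with
    blocks [al / (T + eps - r)] and [m0 + T - r], which explodes only after
    [T]. *)
Lemma uniform_quadratic_bound : exists al m : R, [/\ 0 <= al, 0 <= m &
  forall n Q, solves_riccati n Q -> forall s V, 0 <= s -> s < T -> mx_brv F s V ->
  E (fun w => bilin (V w) (Q w s) (V w)) <=
  E (fun w => (al / (T - s) + m) * \sum_i V w i 0 ^+ 2)].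
Proof.
have [cS [cL [cS0 cL0 SS LL]]] := pick_bounds.
pose m0 := 1 + \sum_i (gamma 0 i)^-1.
have gi i : (gamma 0 i)^-1 <= \sum_i (gamma 0 i)^-1.
  by rewrite (bigD1 i)//= lerDl sumr_ge0// => j _; rewrite invr_ge0 ltW.
pose G := \sum_i gamma 0 i ^+ 2.
have gG i : gamma 0 i ^+ 2 <= G.
  by rewrite /G (bigD1 i)//= lerDl sumr_ge0// => j _; exact: sqr_ge0.
have G0 : 0 <= G by rewrite sumr_ge0// => i _; exact: sqr_ge0.
have m00 : 0 <= m0 by rewrite addr_ge0// sumr_ge0// => i _; rewrite invr_ge0 ltW.
pose al := 1 + cS * d%:R * (T + 1) ^+ 2 + cL * d%:R + (m0 + T) ^+ 2 * G.
have T0 := ltW T_gt0.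
have al0 : 0 < al.
  rewrite /al -!addrA ltr_pwDl// addr_ge0//.
    by rewrite mulr_ge0 ?sqr_ge0// mulr_ge0.
  by rewrite addr_ge0// mulr_ge0// sqr_ge0.
exists al, (m0 + T); split; [exact: ltW|exact: addr_ge0|].
move=> n Q [bQ wQ psdQ termQ] s V s0 sT bV.
(* With this [eps] the supersolution is [n + 1 + al] at time [T], above the
   penalty [n]; [eps <= 1] gives a lower bound on [l] that is uniform in [n]. *)
pose eps := al / (n%:R + 1 + al).
have den0 : 0 < n%:R + 1 + al by rewrite ltr_wpDl// addr_ge0.
have eps0 : 0 < eps by rewrite divr_gt0.
have eps1 : eps <= 1 by rewrite ler_pdivrMr// mul1r lerDr addr_ge0.
pose c := T + eps.
have Tc : T < c by rewrite ltrDl.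
pose l r := (c - r)^-1.
have l_gt0 r : r <= T -> 0 < l r.
  by move=> rT; rewrite invr_gt0 subr_gt0 (le_lt_trans rT).
have l_le r : r <= T -> l r <= eps^-1.
  move=> rT; rewrite lef_pV2 ?posrE ?subr_gt0 ?(le_lt_trans rT)//.
  by rewrite /c addrAC lerDr subr_ge0.
have l_ge r : 0 <= r -> r <= T -> (T + 1)^-1 <= l r.
  move=> r0 rT; rewrite lef_pV2 ?posrE ?subr_gt0 ?(le_lt_trans rT)//; last exact: ltr_wpDl.
  by rewrite /c lerBlDr -addrA lerD2l (le_trans eps1)// lerDl.
have ml : measurable_fun (`[0, T]%classic : set R) l by exact: inv_shift_measurable.
have bl : bounded_measurable (`[0, T]%classic : set R) l.
  split => //; exists eps^-1 => r /=; rewrite in_itv/= => /andP[r0 rT].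
  by rewrite ger0_norm ?l_le// ltW// l_gt0.
pose m r := m0 + T - r.
have bm : bounded_measurable (`[0, T]%classic : set R) m.
  apply: bmB; first exact: bm_cst.
  split => //; exists T => r /=; rewrite in_itv/= => /andP[r0 rT].
  by rewrite ger0_norm.
pose k r := al * l r.
have bk : bounded_measurable (`[0, T]%classic : set R) k.
  by apply: bmM => //; exact: bm_cst.
pose gx r := - (al * l r ^+ 2).
have bgx : bounded_measurable (`[0, T]%classic : set R) gx.
  apply: bmN; apply: bmM; first exact: bm_cst.
  exact: bm_sqr.
have kgx a b : 0 <= a -> a <= b -> b <= T -> k b - k a = - \int[mu]_(q in `[a, b]) gx q.
  move=> a0 ab bT.
  have bl2 : bounded_measurable (`[a, b]%classic : set R) (fun q => l q ^+ 2).
    apply: bm_sqr; apply: bmS bl => //; apply: subset_itv; by rewrite bnd_simp.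
  rewrite /gx int_N; last by apply: bmM => //; exact: bm_cst.
  rewrite opprK int_Z// /k -mulrBr; congr (_ * _).
  rewrite -inv_shift_integral//; last exact: le_lt_trans bT Tc.
  by congr Rintegral; apply/funext => q; rewrite /l exprVn.
have kgy a b : 0 <= a -> a <= b -> b <= T -> m b - m a = - \int[mu]_(q in `[a, b]) 1.
  by move=> a0 ab bT; rewrite int_cst// /m; ring.
have [bK bG wK] := scalar_diag bk bm bgx (bm_cst _ 1) kgx kgy.
pose L (_ : Omega) r := row_mx (l r)%:M 0 : 'M[R]_(d, d + d).
have bL : mx_bproc F 0 T L.
  move=> i j; rewrite /L; case: (split_ordP j) => j' ->.
    under eq_fun do under eq_fun do rewrite row_mxEl mxE.
    have [_|_] := eqVneq i j'; last exact: bproc_cst.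
    exact: bproc_det.
  by under eq_fun do under eq_fun do rewrite row_mxEr mxE; exact: bproc_cst.
have sT' := ltW sT.
have wsub (D f : Omega -> R -> 'M[R]_(d + d)) : mx_weak_equation P F 0 T D f -> mx_weak_equation P F s T D f.
  by move=> wD i j a b phi sa; apply: wD; exact: le_trans sa.
have := @supersolution_comparison _ _ _ P F d T FF Lambda gamma Lambda_pd rt St brt bSt s T
  _ _ L Q V s0 sT' (lexx T) (mx_bproc_sub s0 (lexx T) bK) (mx_bproc_sub s0 (lexx T) bG)
  (mx_bproc_sub s0 (lexx T) bL) (mx_bproc_sub s0 (lexx T) bQ) (wsub _ _ wK) (wsub _ _ wQ).
move=> cmp; apply: (le_trans (cmp _ _ _ bV)).
- apply: filterS psdQ => w psd p /andP[sp pT]; have [] := psd p => //.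
  by rewrite pT (le_trans s0).
- apply: nearW => w; apply: nearW => p /andP[sp pT] v.
  have p0 := le_trans s0 sp.
  have mm0 : m0 <= m p by rewrite /m -addrA lerDl subr_ge0.
  apply: (@supersolution_pointwise R d Lambda gamma gamma_gt0 (rt w p) (St w p) cS cL G al (l p) (m p) v) => //.
  + by move=> i j; apply: SS; rewrite p0.
  + by move=> i; rewrite (le_trans (gi i))// (le_trans _ mm0)// /m0 lerDr.
  have l2 : 1 <= (T + 1) ^+ 2 * l p ^+ 2.
    rewrite -exprMn exprn_ege1// -ler_pdivrMl ?mulr1 ?l_ge// ltr_wpDl//.
  have m2 : m p ^+ 2 <= (m0 + T) ^+ 2.
    have mT : m p <= m0 + T by rewrite /m gerBl.
    by rewrite lerXn2r ?nnegrE ?(le_trans m00 mm0)//; exact: addr_ge0.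
  have h1 : 0 <= (cS * d%:R) * ((T + 1) ^+ 2 * l p ^+ 2 - 1).
    by apply: mulr_ge0; rewrite ?subr_ge0// mulr_ge0.
  have h2 : 0 <= ((m0 + T) ^+ 2 - m p ^+ 2) * (G * l p ^+ 2).
    by apply: mulr_ge0; rewrite ?subr_ge0//; apply: mulr_ge0 => //; exact: sqr_ge0.
  have h3 : 0 <= l p ^+ 2 by exact: sqr_ge0.
  rewrite -subr_ge0 /al; set lhs := (X in 0 <= X).
  have -> : lhs = l p ^+ 2 + (cS * d%:R) * ((T + 1) ^+ 2 * l p ^+ 2 - 1)
     + ((m0 + T) ^+ 2 - m p ^+ 2) * (G * l p ^+ 2) by rewrite /lhs; ring.
  by rewrite !addr_ge0.
- apply: filterS termQ => w -> v; apply: terminal_dominated => //.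
    rewrite /k /l /c (_ : T + eps - T = eps); last by ring.
    by rewrite /eps invf_div mulrC divfK ?gt_eqF// lerDl ltW.
  by move=> i; rewrite /m addrK /m0 lerD2l.
have s0T : 0 <= s <= T by rewrite s0.
have bV2 i : bounded_measurable [set: Omega] (fun w => V w i 0 ^+ 2).
  by apply: bm_sqr; exact: (brv_bm FF s0T (bV i 0)).
apply: E_le.
- apply: (brv_bm FF s0T); apply: brv_bilin => //.
  by apply: (@mx_bproc_time _ _ _ F _ _ s T _ s _ (mx_bproc_sub s0 (lexx T) bK)); rewrite lexx.
- by apply: bmM; [exact: bm_cst|exact: bm_sum].
move=> w; move: (V w) => v {bV2}; rewrite -[X in bilin X _ X](vsubmxK v).
have b0 u u' : bilin u (0 : 'M[R]_d) u' = 0 by rewrite /bilin mulmx0 mul0mx mxE.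
rewrite bilin_block !b0 !addr0 !bilin_scalar.
rewrite (_ : \sum_(i < d + d) v i 0 ^+ 2 =
  \sum_i usubmx v i 0 ^+ 2 + \sum_i dsubmx v i 0 ^+ 2); last first.
  rewrite big_split_ord /=; congr (_ + _); apply: eq_bigr => i _; rewrite mxE//.
have ks : k s <= al / (T - s).
  rewrite /k ler_pM2l// lef_pV2 ?posrE ?subr_gt0// ?(lt_trans sT)//.
  by rewrite lerB// ltW.
have ms : m s <= m0 + T by rewrite /m gerBl.
have sq0 (u : 'cV[R]_d) : 0 <= \sum_i u i 0 ^+ 2 by rewrite sumr_ge0// => i _; exact: sqr_ge0.
have k0 : 0 <= al / (T - s) by rewrite divr_ge0 ?subr_ge0// ltW.
have mT0 : 0 <= m0 + T by exact: addr_ge0.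
have e2 (u : 'cV[R]_d) : \sum_i u i 0 * u i 0 = \sum_i u i 0 ^+ 2.
  by apply: eq_bigr => i _; rewrite expr2.
rewrite !e2; move: (sq0 (usubmx v)) (sq0 (dsubmx v)) => u0 d0.
rewrite mulrDr; apply: lerD; apply: ler_wpM2r => //.
- by apply: (le_trans ks); rewrite lerDl.
- by apply: (le_trans ms); rewrite lerDr.
Qed.
End UniformBound.

(** * From means to pointwise statements *)

Section MeasurableLimit.
Context d (S : measurableType d) (R : realType).

Lemma cvgn_of_limn_esup_einf (u : nat -> R) :
  limn_esup (EFin \o u) \is a fin_num ->
  limn_esup (EFin \o u) = limn_einf (EFin \o u) ->
  u n @[n --> \oo] --> fine (limn_esup (EFin \o u)).
Proof.
move=> fin eq_lim.
have : (EFin \o u) n @[n --> \oo] --> limn_esup (EFin \o u).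
  apply: (@squeeze_cvge _ _ _ _ (einfs (EFin \o u)) (EFin \o u) (esups (EFin \o u))).
  - apply: nearW => n; apply/andP; split.
      by apply: ereal_inf_lbound => /=; exists n => //=.
    by apply: ereal_sup_ubound => /=; exists n => //=.
  - rewrite eq_lim limn_einf_lim; exact: is_cvg_einfs.
  - rewrite limn_esup_lim; exact: is_cvg_esups.
by rewrite -{1}(fineK fin) => /fine_cvg.
Qed.

(** The sequence converges exactly where its upper and lower limits are finite
    and agree, a measurable set; elsewhere [lim] is a constant default value.
    *)
Lemma measurable_lim (D : set S) (h : nat -> S -> R) : measurable D ->
  (forall n, measurable_fun D (h n)) ->
  measurable_fun D (fun x => lim (h n x @[n --> \oo]) : R).
Proof.
move=> mD mh.
pose e1 x := limn_esup (EFin \o (h ^~ x)).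
pose e2 x := limn_einf (EFin \o (h ^~ x)).
have me1 : measurable_fun D e1.
  apply: (@measurable_fun_limn_esup _ _ _ D (fun n x => (h n x)%:E)) => n.
  exact/measurable_EFinP.
have me2 : measurable_fun D e2.
  rewrite /e2 /limn_einf; apply: measurableT_comp => //.
  apply: (@measurable_fun_limn_esup _ _ _ D (fun n x => (- (h n x)%:E)%E)) => n.
  by apply: measurableT_comp => //; exact/measurable_EFinP.
have mfine e : measurable_fun D e -> measurable_fun D (fun x => fine (e x) : R).
  by move=> me; apply: measurableT_comp me; exact: fine_measurable.
pose A := (D `&` [set x | e1 x \is a fin_num]) `&` (D `&` [set x | e2 x \is a fin_num])
  `&` (D `&` (fun x => fine (e1 x) - fine (e2 x)) @^-1` [set 0]).
have mA : measurable A.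
  apply: measurableI.
    by apply: measurableI; exact: emeasurable_fin_num.
  by apply: measurable_funB => //; exact: mfine.
pose g x : R := fine (e1 x) * \1_A x + (point : R) * \1_(~` A) x.
apply: (@eq_measurable_fun _ _ _ _ D g); last first.
  apply: measurable_funD; apply: measurable_funM.
  - exact: mfine.
  - exact: measurable_indic.
  - exact: measurable_cst.
  - by apply: measurable_indic; exact: measurableC.
move=> x /set_mem Dx; rewrite /g !indicE in_setC.
have [xA|xA] := boolP (x \in A); rewrite /= ?mulr1 ?mulr0 ?addr0 ?add0r.
  have [[[_ f1] [_ f2]] [_ /= e12]] := set_mem xA.
  apply/esym/cvg_lim => //; apply: cvgn_of_limn_esup_einf => //.
  move: f1 f2 e12; rewrite /e1 /e2 /=.
  case: (limn_esup _) => // r1 _; case: (limn_einf _) => // r2 _ /= /eqP.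
  by rewrite subr_eq0 => /eqP ->.
rewrite dvgP// => cv; move/negP: xA; apply; rewrite inE.
have cE : (EFin \o (h ^~ x)) n @[n --> \oo] --> (lim (h n x @[n --> \oo]))%:E.
  by apply/fine_cvgP; split; [exact: nearW|exact: cv].
have [E2 E1] := cvg_limn_einf_sup cE.
by rewrite /A /e1 /e2 /=; split; [split; split => //|split => //];
  rewrite ?E1 ?E2//= subrr.
Qed.
End MeasurableLimit.

Section NullIntegrals.
Context d (S : measurableType d) (R : realType).
Variables (m : {measure set S -> \bar R}) (D : set S).
Hypotheses (mD : measurable D) (fin : (m D < +oo)%E).

Lemma bm_int_eq0_ae f : bounded_measurable D f -> (forall x, D x -> 0 <= f x) ->
  \int[m]_(x in D) f x <= 0 -> \forall x \ae m, D x -> f x = 0.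
Proof.
move=> bf f0 If; have mf : measurable_fun D (EFin \o f) by apply/measurable_EFinP; case: bf.
have I0 : (\int[m]_(x in D) `|(EFin \o f) x| = 0)%E.
  have -> : (\int[m]_(x in D) `|(EFin \o f) x| = \int[m]_(x in D) (f x)%:E)%E.
    by apply: eq_integral => x /set_mem Dx /=; rewrite ger0_norm// f0.
  have fi : (\int[m]_(x in D) (f x)%:E)%E \is a fin_num.
    by apply: integrable_fin_num => //; exact: bm_integrable.
  rewrite -(fineK fi); congr EFin; apply/eqP; rewrite eq_le If/=.
  by apply: fine_ge0; apply: integral_ge0 => x Dx; rewrite lee_fin f0.
move/(ae_eq_integral_abs m mD mf).1 : I0; apply: filterS => x h Dx.
by have /= [] := h Dx.
Qed.
End NullIntegrals.

Section PsdEntries.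
Context (R : realType) (n : nat).

Lemma bilin_delta (Q : 'M[R]_n) i j : bilin (delta_mx i 0) Q (delta_mx j 0) = Q i j.
Proof. by rewrite /bilin trmx_delta -rowE -colE !mxE. Qed.

Lemma psd_entry_bound (Q : 'M[R]_n) c : psd_mx Q -> (forall i, Q i i <= c) ->
  forall i j, `|Q i j| <= c.
Proof.
move=> [QT Q0] Qc i j.
have QS : Q j i = Q i j by rewrite -[in LHS]QT mxE.
have := Q0 (delta_mx i 0 - delta_mx j 0); have := Q0 (delta_mx i 0 + delta_mx j 0).
rewrite -/(bilin _ _ _) -[X in _ -> 0 <= X -> _]/(bilin _ _ _).
rewrite !(bilinDl, bilinDr, bilinNl, bilinNr) !bilin_delta QS.
have := Qc i; have := Qc j.
by rewrite ler_norml => *; apply/andP; split; lra.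
Qed.
End PsdEntries.

Section EntryBound.
Context dO (Omega : measurableType dO) (R : realType) (P : probability Omega R).
Variables (F : R -> set (set Omega)) (d : nat) (T : R).
Hypothesis FF : filtration F T.
Local Notation mu := (@lebesgue_measure R).
Local Notation E f := (\int[P]_w f w).

(** Let [h] be the positive part of [Q i i - c]. Testing with [h] times the
    [i]-th basis vector yields that the mean of [h ^+ 3] is at most 0. The
    diagonal controls the other entries. *)
Lemma entry_bound_of_quadratic m s (Q : Omega -> 'M[R]_m) c : 0 <= s <= T ->
  mx_brv F s Q -> (\forall w \ae P, psd_mx (Q w)) ->
  (forall V, mx_brv F s V -> E (fun w => bilin (V w) (Q w) (V w)) <=
     E (fun w => c * \sum_i V w i 0 ^+ 2)) ->
  \forall w \ae P, forall i j, `|Q w i j| <= c.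
Proof.
move=> sT bQ psdQ QV.
have diag i : \forall w \ae P, Q w i i <= c.
  pose h w := Num.max (Q w i i - c) 0.
  have bh : brv F s h.
    have [mq [C qC]] : brv F s (fun w => Q w i i - c) by apply: brvB => //; exact: brv_cst.
    split; first exact: measurable_maxr.
    exists C => w _; apply: le_trans (qC w I).
    by rewrite ger0_norm ?le_max ?lexx ?orbT// ge_max ler_norm normr_ge0.
  pose V w : 'cV[R]_m := h w *: delta_mx i 0.
  have bV : mx_brv F s V.
    move=> k l; have -> : (fun w => V w k l) = (fun w => h w * (delta_mx i 0 : 'cV[R]_m) k l).
      by apply/funext => w; rewrite mxE.
    by apply: brvM => //; exact: brv_cst.
  have sumV w : \sum_k V w k 0 ^+ 2 = h w ^+ 2.
    rewrite (bigD1 i)//= big1 ?addr0; first by rewrite !mxE !eqxx mulr1.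
    by move=> k ki; rewrite !mxE (negbTE ki) mulr0 expr0n.
  have bilinV w : bilin (V w) (Q w) (V w) = h w ^+ 2 * Q w i i.
    by rewrite bilinZl bilinZr bilin_delta mulrA.
  have h0 w : 0 <= h w by rewrite le_max lexx orbT.
  have h3 w : h w ^+ 3 = h w ^+ 2 * Q w i i - c * h w ^+ 2.
    rewrite /h; have [q0|q0] := leP (Q w i i - c) 0; first by rewrite !expr0n /=; ring.
    by ring.
  have th := brv_bm FF sT bh.
  have bqi := brv_bm FF sT (bQ i i).
  have b3 : bounded_measurable [set: Omega] (fun w => h w ^+ 3).
    by have := bmM th (bm_sqr th); apply: eq_bm => w _; rewrite exprS.
  have := @bm_int_eq0_ae _ _ _ P setT measurableT (prob_fin P) _ b3.
  have h30 w : [set: Omega] w -> 0 <= h w ^+ 3 by move=> _; rewrite exprn_ge0.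
  move=> /(_ h30) H.
  have : \int[P]_w h w ^+ 3 <= 0.
    have -> : (fun w => h w ^+ 3) = (fun w => h w ^+ 2 * Q w i i - c * h w ^+ 2).
      by apply/funext.
    rewrite E_B; [|by apply: bmM => //; exact: bm_sqr|by apply: bmM; [exact: bm_cst|exact: bm_sqr]].
    rewrite subr_le0; have := QV V bV.
    under eq_Rintegral do rewrite bilinV.
    by under [X in _ <= X -> _]eq_Rintegral do rewrite sumV.
  move=> /H; apply: filterS => w /(_ I)/eqP; rewrite expf_eq0/= => /eqP hw.
  have : Q w i i - c <= h w by rewrite /h le_max lexx.
  by rewrite hw subr_le0.
have diag_all : \forall w \ae P, forall i, Q w i i <= c.
  exact: (@filter_forall _ _ _ _ _ diag).
by apply: filterS2 psdQ diag_all => w; exact: psd_entry_bound.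
Qed.

(** Fubini's theorem exchanges the exceptional sets: almost surely at each
    time becomes at almost every time, for almost every path. *)
Lemma bproc_null_sections u g : 0 <= u -> u <= T -> bproc F 0 u g ->
  (forall s, 0 <= s <= u -> \forall w \ae P, g w s = 0) ->
  \forall w \ae P, \forall s \ae mu, 0 <= s <= u -> g w s = 0.
Proof.
move=> u0 uT bg g0.
have bn : bproc F 0 u (fun w s => `|g w s|).
  move=> r rab; have [mg [C gC]] := bg r rab; split.
    exact: measurableT_comp.
  by exists C => z zD; rewrite normr_id gC.
have jn := bproc_joint FF (lexx 0) u0 uT bn.
have bI : bounded_measurable [set: Omega] (fun w => \int[mu]_(s in `[0, u]) `|g w s|).
  exact: bm_path_integral.
have := @bm_int_eq0_ae _ _ _ P setT measurableT (prob_fin P) _ bI.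
have I0 w : [set: Omega] w -> 0 <= \int[mu]_(s in `[0, u]) `|g w s|.
  by move=> _; apply: Rintegral_ge0 => s _.
move=> /(_ I0) H.
have : \int[P]_w \int[mu]_(s in `[0, u]) `|g w s| <= 0.
  rewrite (bproc_fubini P FF (lexx 0) u0 uT bn).
  have -> : \int[mu]_(r in `[0, u]) E (fun w => `|g w r|) = \int[mu]_(r in `[0, u]) 0.
    apply: eq_Rintegral => r /set_mem/=; rewrite in_itv/= => ru.
    rewrite -(E_cst P 0); apply: E_ae_eq.
    - apply: (brv_bm FF (t := r)).
        by case/andP: ru => -> /le_trans ->.
      exact: (bproc_time (a := 0) (b := u) ru bn).
    - exact: bm_cst.
    - by apply: filterS (g0 r ru) => w ->; rewrite normr0.
  by rewrite int_cst// mul0r.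
move=> /H; apply: filterS => w /(_ I) Iw.
have := @bm_int_eq0_ae _ (measurableTypeR R) R mu (`[0, u]%classic : set R)
  (measurable_itv _) (lebesgue_itv_fin _ _) _ (jbm_path w jn).
have n0 r : (`[0, u]%classic : set R) r -> 0 <= `|g w r| by [].
move=> /(_ n0); rewrite Iw lexx => /(_ isT).
apply: filterS => s h su; apply/eqP; rewrite -normr_eq0; apply/eqP.
by apply: h; rewrite /= in_itv.
Qed.
End EntryBound.

(** * The limit of the penalized solutions *)

Section EntrywiseLimits.
Context (R : realType) (T : Type) (G : set_system T).
Hypothesis FG : Filter G.

(** The point [None] carries the limit, so that convergence along [G] becomes
    a property of one function and is covered by [entrywise]. *)
Definition tends_to_none (g : option T -> R) : Prop := g (Some l) @[l --> G] --> g None.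

Lemma tends_cst c : tends_to_none (fun=> c). Proof. exact: cvg_cst. Qed.
Lemma tendsD f g : tends_to_none f -> tends_to_none g ->
  tends_to_none (fun x => f x + g x).
Proof. exact: cvgD. Qed.
Lemma tendsM f g : tends_to_none f -> tends_to_none g ->
  tends_to_none (fun x => f x * g x).
Proof. exact: cvgM. Qed.

Lemma cvg_bilin m (Q : T -> 'M[R]_m) (v : T -> 'cV[R]_m) (Q0 : 'M[R]_m) (v0 : 'cV[R]_m) :
  (forall i j, Q l i j @[l --> G] --> Q0 i j) ->
  (forall i, v l i 0 @[l --> G] --> v0 i 0) ->
  bilin (v l) (Q l) (v l) @[l --> G] --> bilin v0 Q0 v0.
Proof.
move=> cQ cv.
pose Qo o := if o is Some l then Q l else Q0.
pose vo o := if o is Some l then v l else v0.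
have cvo : entrywise tends_to_none vo by move=> i j; rewrite (ord1 j); exact: cv.
have cvoT : entrywise tends_to_none (fun o => (vo o)^T).
  move=> i j; rewrite (_ : (fun x => _) = (fun x => vo x j i)); first exact: cvo.
  by apply/funext => o; rewrite mxE.
have cQo : entrywise tends_to_none Qo by exact: cQ.
have M := entrywiseM tends_cst tendsD tendsM.
exact: (M _ _ _ _ _ (M _ _ _ _ _ cvoT cQo) cvo 0 0).
Qed.
End EntrywiseLimits.

Section LimitEquation.
Context dO (Omega : measurableType dO) (R : realType) (P : probability Omega R).
Variables (F : R -> set (set Omega)) (d : nat) (T : R).
Hypothesis FF : filtration F T.
Hypothesis T_gt0 : 0 < T.
Variables (Lambda : 'M[R]_d) (gamma : 'rV[R]_d).
Hypothesis Lambda_pd : pd_mx Lambda.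
Variables (rt : Omega -> R -> 'rV[R]_d) (St : Omega -> R -> 'M[R]_d).
Hypotheses (brt : mx_bproc F 0 T rt) (bSt : mx_bproc F 0 T St).
Local Notation mu := (@lebesgue_measure R).
Local Notation E f := (\int[P]_w f w).
Local Notation driver := (driver Lambda gamma rt St).

Variables (nk : nat -> nat) (Qt : nat -> Omega -> R -> 'M[R]_(d + d)).
Hypothesis nk_mono : forall k l, (k <= l)%N -> (nk k <= nk l)%N.
Hypothesis Qt_sol : forall k, solves_riccati P F T Lambda gamma rt St (nk k) (Qt k).
Variable Ql : Omega -> R -> 'M[R]_(d + d).
Hypothesis Ql_prog : mx_progressive F `[0, T] Ql.
Variables (u c : R) (u0 : 0 <= u) (uT : u < T) (c0 : 0 <= c).
Hypothesis Qt_cvg : \forall w \ae P, forall s : R, 0 <= s <= u -> forall i j,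
  Qt k w s i j @[k --> \oo] --> Ql w s i j.
Hypothesis Qt_bound : forall k (s : R), 0 <= s <= u ->
  \forall w \ae P, forall i j, `|Qt k w s i j| <= c.

Let uT' : u <= T := ltW uT.
Let Qh k w s : 'M[R]_(d + d) := \matrix_(i, j) clip c (Qt k w s i j).

(** At each fixed time this is almost surely the limit itself, by the bound on
    the approximations, but it is bounded for every outcome and time. *)
Definition clipped_limit w s : 'M[R]_(d + d) := \matrix_(i, j) clip c (Ql w s i j).

Lemma clipped_limit_bound w s i j : `|clipped_limit w s i j| <= c.
Proof. by rewrite mxE clip_norm. Qed.

Lemma clipped_limit_bproc : mx_bproc F 0 u clipped_limit.
Proof.
apply: mx_clip Ql_prog => //; apply: subset_itvl; rewrite bnd_simp//.
Qed.

Lemma riccati_sol_mono k l s V : 0 <= s <= T -> (k <= l)%N -> mx_brv F s V ->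
  E (fun w => bilin (V w) (Qt k w s) (V w)) <= E (fun w => bilin (V w) (Qt l w s) (V w)).
Proof.
move=> /andP[s0 sT] kl bV.
have [bk wk psdk termk] := Qt_sol k; have [bl wl psdl terml] := Qt_sol l.
have wsub (D f : Omega -> R -> 'M[R]_(d + d)) :
    mx_weak_equation P F 0 T D f -> mx_weak_equation P F s T D f.
  by move=> wD i j a b phi sa; apply: wD; exact: le_trans sa.
have sym (Q : Omega -> R -> 'M[R]_(d + d)) :
    (\forall w \ae P, forall s : R, 0 <= s <= T -> psd_mx (Q w s)) ->
    \forall w \ae P, forall p : R, s <= p <= T -> (Q w p)^T = Q w p.
  apply: filterS => w h p /andP[sp pT]; have [] := h p => //.
  by rewrite pT (le_trans s0).
apply: (riccati_monotone FF Lambda_pd brt bSt s0 sT (lexx T)) => //.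
- exact: mx_bproc_sub bk.
- exact: mx_bproc_sub bl.
- exact: wsub wk.
- exact: wsub wl.
- exact: sym psdk.
- exact: sym psdl.
apply: filterS2 termk terml => w -> -> v.
rewrite -(vsubmxK v) /bsde_terminal !bilin_block !lerD2r !bilin_scalar ler_wpM2r//.
  by rewrite sumr_ge0// => i _; rewrite -expr2 sqr_ge0.
by rewrite ler_nat nk_mono.
Qed.

Lemma fixed_time_limit s : 0 <= s <= u -> \forall w \ae P,
  [/\ forall k, Qh k w s = Qt k w s, clipped_limit w s = Ql w s &
      forall i j, Qt k w s i j @[k --> \oo] --> clipped_limit w s i j].
Proof.
move=> su; have bnd : \forall w \ae P, forall k i j, `|Qt k w s i j| <= c.
  by apply: ae_foralln => k; exact: Qt_bound.
apply: filterS2 Qt_cvg bnd => w cv bd.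
have lim_bound i j : `|Ql w s i j| <= c.
  have cn : `|Qt k w s i j| @[k --> \oo] --> `|Ql w s i j|.
    by apply: cvg_norm; exact: cv.
  rewrite -(cvg_lim _ cn)//; apply: limr_le; first by apply/cvg_ex; eexists; exact: cn.
  by apply: nearW => k; exact: bd.
have limE : clipped_limit w s = Ql w s.
  by apply/matrixP => i j; rewrite mxE clip_id.
split=> [k|//|i j]; first by apply/matrixP => i j; rewrite mxE clip_id.
by rewrite limE; exact: cv.
Qed.

Lemma clipped_limit_ae : \forall w \ae P, \forall s \ae mu, 0 <= s <= u ->
  clipped_limit w s = Ql w s.
Proof.
pose g i j w s := Num.max (`|clip (c + 1) (Ql w s i j)| - c) 0.
have bg i j : bproc F 0 u (g i j).
  have sub : (`[0, u]%classic : set R) `<=` `[0, T]%classic.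
    by apply: subset_itvl; rewrite bnd_simp.
  have c10 : 0 <= c + 1 by rewrite addr_ge0.
  have bclip := bproc_clip (measurable_itv `[0, T]) sub c10 (Ql_prog i j).
  move=> r ru; have [mc _] := bclip r ru; split.
    by apply: measurable_maxr => //; apply: measurable_funB => //; exact: measurableT_comp.
  exists (c + 1) => z _; rewrite ger0_norm ?le_max ?lexx ?orbT// ge_max c10 andbT.
  by rewrite lerBlDr (le_trans (clip_norm _ c10))// lerDl.
have g0 i j s : 0 <= s <= u -> \forall w \ae P, g i j w s = 0.
  move=> su; apply: filterS (fixed_time_limit su) => w [_ limE _].
  apply/max_idPr; rewrite subr_le0 -limE clip_id.
    exact: clipped_limit_bound.
  by rewrite (le_trans (clipped_limit_bound _ _ _ _))// lerDl.
have h i j := bproc_null_sections FF u0 uT' (bg i j) (g0 i j).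
have hall : \forall w \ae P, forall ij : 'I_(d + d) * 'I_(d + d),
    \forall s \ae mu, 0 <= s <= u -> g ij.1 ij.2 w s = 0.
  by apply: filter_forall => ij; exact: h.
apply: filterS hall => w hw.
have hw2 : \forall s \ae mu, forall ij : 'I_(d + d) * 'I_(d + d),
    0 <= s <= u -> g ij.1 ij.2 w s = 0.
  by apply: filter_forall => ij; exact: hw.
apply: filterS hw2 => s hs su; apply/matrixP => i j; rewrite mxE clip_id//.
have gs : g i j w s = 0 := hs (i, j) su.
have : `|clip (c + 1) (Ql w s i j)| - c <= g i j w s by rewrite le_max lexx.
rewrite gs subr_le0 => cl.
have [qc|/ltW qc] := leP `|Ql w s i j| (c + 1).
  by rewrite clip_id in cl.
move: cl; rewrite /clip; have [q0|q0] := leP 0 (Ql w s i j).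
  rewrite ger0_norm in qc => //.
  rewrite (min_idPr qc) (max_idPr _); last by rewrite ge0_cp// addr_ge0.
  by rewrite ger0_norm ?addr_ge0// gerDl ler10.
rewrite ltr0_norm in qc => //.
rewrite (min_idPl _); last by rewrite (le_trans (ltW q0))// addr_ge0.
rewrite (max_idPl _); last by rewrite lerNr.
by rewrite normrN ger0_norm ?addr_ge0// gerDl ler10.
Qed.

Lemma limit_psd : \forall w \ae P, forall s : R, 0 <= s <= u -> psd_mx (Ql w s).
Proof.
have psd_all : \forall w \ae P, forall k (s : R), 0 <= s <= T -> psd_mx (Qt k w s).
  by apply: ae_foralln => k; have [] := Qt_sol k.
apply: filterS2 Qt_cvg psd_all => w cv psd s su.
have sT : 0 <= s <= T by case/andP: su => -> /le_trans ->.
split.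
  apply/matrixP => i j; rewrite mxE.
  apply: (@cvg_unique _ _ _ _ _ _ _ (cv s su i j)) => //.
  have := cv s su j i; have eqji k : Qt k w s j i = Qt k w s i j.
    by have [e _] := psd k s sT; rewrite -[in LHS]e mxE.
  by under eq_cvg do rewrite eqji.
move=> v; have cb : bilin v (Qt k w s) v @[k --> \oo] --> bilin v (Ql w s) v.
  apply: (@cvg_bilin R nat \oo _ _ (fun k => Qt k w s) (fun=> v)) => [i j|i].
    exact: cv.
  exact: cvg_cst.
have -> : (v^T *m Ql w s *m v) 0 0 = lim (bilin v (Qt k w s) v @[k --> \oo]).
  by rewrite (cvg_lim _ cb).
apply: limr_ge; first by apply/cvg_ex; eexists; exact: cb.
by apply: nearW => k; have [_] := psd k s sT; exact.
Qed.

(** The quadratic forms increase with [k] by comparison, and they converge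
    boundedly. *)
Lemma limit_dominates k s V : 0 <= s <= u -> mx_brv F s V ->
  E (fun w => bilin (V w) (Qt k w s) (V w)) <=
  E (fun w => bilin (V w) (clipped_limit w s) (V w)).
Proof.
move=> su bV; have sT : 0 <= s <= T by case/andP: su => -> /le_trans ->.
have bQh l : mx_brv F s (fun w => Qh l w s).
  have [bl _ _ _] := Qt_sol l.
  move=> i j; have [mq _] : brv F s (fun w => Qt l w s i j).
    by apply: (bproc_time (a := 0) (b := T) sT (bl i j)).
  rewrite (_ : (fun w => Qh l w s i j) = fun w => clip c (Qt l w s i j)); last first.
    by apply/funext => w; rewrite mxE.
  split; last by exists c => w _; exact: clip_norm.
  by apply: measurable_maxr => //; exact: measurable_minr.
have bQl : mx_brv F s (fun w => clipped_limit w s).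
  exact: mx_bproc_time su clipped_limit_bproc.
have tb (Q : Omega -> 'M[R]_(d + d)) : mx_brv F s Q ->
    bounded_measurable [set: Omega] (fun w => bilin (V w) (Q w) (V w)).
  by move=> bQ; apply: (brv_bm FF sT); exact: brv_bilin.
have QhE l : E (fun w => bilin (V w) (Qt l w s) (V w)) =
    E (fun w => bilin (V w) (Qh l w s) (V w)).
  have [bl _ _ _] := Qt_sol l.
  apply: E_ae_eq; [apply: tb; exact: mx_bproc_time sT bl|exact: tb|].
  by apply: filterS (fixed_time_limit su) => w [-> _ _].
have [V0 V00 VV0] := mx_brv_bound bV.
have cv : E (fun w => bilin (V w) (Qh l w s) (V w)) @[l --> \oo] -->
    E (fun w => bilin (V w) (clipped_limit w s) (V w)).
  apply: (@bm_cvg_int _ _ _ P setT measurableT (prob_fin P)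
    (fun l w => bilin (V w) (Qh l w s) (V w)) _ (\sum_(i < d + d) \sum_(j < d + d) V0 * V0 * c)).
  - by move=> l; have [] := tb _ (bQh l).
  - by have [] := tb _ bQl.
  - apply: filterS (fixed_time_limit su) => w [QhQt _ cvw] _.
    apply: (@cvg_bilin R nat \oo _ _ (fun k => Qh k w s) (fun=> V w)) => [i j|i].
      by under eq_cvg do rewrite QhQt; exact: cvw.
    exact: cvg_cst.
  move=> l w _; rewrite bilinE (le_trans (ler_norm_sum _ _ _))//.
  apply: ler_sum => i _; rewrite (le_trans (ler_norm_sum _ _ _))//.
  apply: ler_sum => j _; rewrite !normrM !ler_pM ?mulr_ge0//.
  by rewrite mxE clip_norm.
rewrite -(cvg_lim _ cv)//; apply: limr_ge; first by apply/cvg_ex; eexists; exact: cv.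
near=> l; rewrite -QhE; apply: riccati_sol_mono => //.
by near: l; exact: nbhs_infty_ge.
Unshelve. all: by end_near. Qed.

(** The driver is polynomial in the entries of [Q], hence continuous along
    bounded convergence, and the weak form contains no martingale part. *)
Lemma limit_weak_equation :
  mx_weak_equation P F 0 u clipped_limit (driver clipped_limit).
Proof.
move=> i j s r phi s0 sr ru bphi.
have rT := le_trans ru uT'; have r0 := le_trans s0 sr.
have su : 0 <= s <= u by rewrite s0 (le_trans sr).
have ru' : 0 <= r <= u by rewrite r0.
have sT : 0 <= s <= T by rewrite s0 (le_trans sr).
have rT' : 0 <= r <= T by rewrite r0.
have bphi' := brv_bm FF sT bphi; have [mphi [Cp phiC]] := bphi'.
have Cp0 : 0 <= Cp := le_trans (normr_ge0 _) (phiC point I).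
have bQh l : mx_bproc F 0 T (Qh l).
  have [bl _ _ _] := Qt_sol l.
  move=> a b q qT; have [mq _] := bl a b q qT.
  rewrite /jointly_bm (_ : (fun z => Qh l z.1 z.2 a b) =
    fun z : g_sigma_algebraType (F q) * R => clip c (Qt l z.1 z.2 a b)); last first.
    by apply/funext => w; rewrite mxE.
  split; last by exists c => w _; exact: clip_norm.
  by apply: measurable_maxr => //; exact: measurable_minr.
have bfh l := mx_bproc_driver Lambda gamma brt bSt (lexx 0) (lexx T) (bQh l).
have bfl := mx_bproc_driver Lambda gamma brt bSt (lexx 0) uT' clipped_limit_bproc.
have [Cf fC] : exists C, forall l w q, 0 <= q <= T -> `|driver (Qh l) w q i j| <= C.
  have [Cr Cr0 rC] := mx_bproc_bound FF (lexx 0) (ltW T_gt0) (lexx T) brt.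
  have [Cs Cs0 sC] := mx_bproc_bound FF (lexx 0) (ltW T_gt0) (lexx T) bSt.
  pose bd (g : nat * Omega * R -> R) := exists C, forall l w q, 0 <= q <= T -> `|g (l, w, q)| <= C.
  apply: (@entrywise_driver R (nat * Omega * R) bd _ _ _ d Lambda gamma
    (fun z => rt z.1.2 z.2) (fun z => St z.1.2 z.2) (fun z => Qh z.1.1 z.1.2 z.2)).
  - by move=> a; exists `|a|.
  - move=> f g [A fA] [B gB]; exists (A + B) => l w q qT.
    by rewrite (le_trans (ler_normD _ _))// lerD ?fA ?gB.
  - move=> f g [A fA] [B gB]; exists (A * B) => l w q qT.
    by rewrite normrM ler_pM ?fA ?gB.
  - by move=> a b; exists Cr => l w q qT; exact: rC.
  - by move=> a b; exists Cs => l w q qT; exact: sC.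
  - by move=> a b; exists c => l w q qT; rewrite mxE clip_norm.
have bphif l : bproc F s r (fun w q => phi w * driver (Qh l) w q i j).
  apply: bprocM; first by apply: (bproc_brv FF).
  exact: bproc_sub (bfh l i j).
have bphil : bproc F s r (fun w q => phi w * driver clipped_limit w q i j).
  apply: bprocM; first by apply: (bproc_brv FF).
  exact: bproc_sub (bfl i j).
have tQ l t : 0 <= t <= T -> bounded_measurable [set: Omega] (fun w => Qh l w t i j).
  by move=> tT; apply: (brv_bm FF tT); exact: bproc_time (bQh l i j).
have tQl t : 0 <= t <= u -> bounded_measurable [set: Omega] (fun w => clipped_limit w t i j).
  move=> tu; apply: (brv_bm FF (t := t)); last exact: bproc_time (clipped_limit_bproc i j).
  by case/andP: tu => -> /le_trans ->.
have eq_h l : E (fun w => phi w * (Qh l w r i j - Qh l w s i j)) =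
    - \int[mu]_(q in `[s, r]) E (fun w => phi w * driver (Qh l) w q i j).
  have [bl wl _ _] := Qt_sol l.
  have tQt t : 0 <= t <= T -> bounded_measurable [set: Omega] (fun w => Qt l w t i j).
    by move=> tT; apply: (brv_bm FF tT); exact: bproc_time (bl i j).
  have bfd := mx_bproc_driver Lambda gamma brt bSt (lexx 0) (lexx T) bl.
  transitivity (E (fun w => phi w * (Qt l w r i j - Qt l w s i j))).
    apply: E_ae_eq.
    - by apply: bmM => //; apply: bmB; exact: tQ.
    - by apply: bmM => //; apply: bmB; exact: tQt.
    by apply: filterS2 (fixed_time_limit su) (fixed_time_limit ru') => w [-> _ _] [-> _ _].
  rewrite (wl i j s r phi s0 sr rT bphi); apply: (congr1 -%R).
  apply: eq_Rintegral => q /set_mem/=; rewrite in_itv/= => /andP[sq qr].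
  have qu : 0 <= q <= u by rewrite (le_trans s0 sq) (le_trans qr).
  have qT : 0 <= q <= T by rewrite (le_trans s0 sq) (le_trans qr).
  apply: E_ae_eq.
  - by apply: bmM => //; apply: (brv_bm FF qT); exact: bproc_time (bfd i j).
  - by apply: bmM => //; apply: (brv_bm FF qT); exact: bproc_time (bfh l i j).
  by apply: filterS (fixed_time_limit qu) => w [e _ _]; rewrite /driver e.
have lhs : E (fun w => phi w * (Qh l w r i j - Qh l w s i j)) @[l --> \oo] -->
    E (fun w => phi w * (clipped_limit w r i j - clipped_limit w s i j)).
  apply: (@bm_cvg_int _ _ _ P setT measurableT (prob_fin P)
    (fun l w => phi w * (Qh l w r i j - Qh l w s i j)) _ (Cp * (c + c))).
  - by move=> l; have [] := bmM bphi' (bmB (tQ l r rT') (tQ l s sT)).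
  - by have [] := bmM bphi' (bmB (tQl r ru') (tQl s su)).
  - apply: filterS2 (fixed_time_limit su) (fixed_time_limit ru') => w [es _ cs] [er _ cr] _.
    apply: cvgM; first exact: cvg_cst.
    by apply: cvgB; [under eq_cvg do rewrite er|under eq_cvg do rewrite es]; [exact: cr|exact: cs].
  move=> l w _; rewrite normrM ler_pM ?phiC// (le_trans (ler_normB _ _))//.
  by rewrite lerD// mxE clip_norm.
have rhs : \int[mu]_(q in `[s, r]) E (fun w => phi w * driver (Qh l) w q i j) @[l --> \oo] -->
    \int[mu]_(q in `[s, r]) E (fun w => phi w * driver clipped_limit w q i j).
  apply: (@bm_cvg_int _ (measurableTypeR R) R mu (`[s, r]%classic : set R)
    (measurable_itv _) (lebesgue_itv_fin _ _)
    (fun l q => E (fun w => phi w * driver (Qh l) w q i j)) _ (Cp * Cf)).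
  - by move=> l; have [] := bproc_mean P FF s0 sr rT (bphif l).
  - by have [] := bproc_mean P FF s0 sr rT bphil.
  - apply: nearW => q /=; rewrite in_itv/= => /andP[sq qr].
    have qu : 0 <= q <= u by rewrite (le_trans s0 sq) (le_trans qr).
    have qT : 0 <= q <= T by rewrite (le_trans s0 sq) (le_trans qr).
    have srq : s <= q <= r by rewrite sq.
    apply: (@bm_cvg_int _ _ _ P setT measurableT (prob_fin P)
      (fun l w => phi w * driver (Qh l) w q i j) _ (Cp * Cf)).
    + by move=> l; have [] := brv_bm FF qT (bproc_time srq (bphif l)).
    + by have [] := brv_bm FF qT (bproc_time srq bphil).
    + apply: filterS (fixed_time_limit qu) => w [e _ cw] _.
      apply: cvgM; first exact: cvg_cst.
      apply: (@entrywise_driver R (option nat) (@tends_to_none R nat \oo)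
        (@tends_cst _ _ _ _) (@tendsD _ _ _ _) (@tendsM _ _ _ _) d Lambda gamma
        (fun=> rt w q) (fun=> St w q)
        (fun o => if o is Some l then Qh l w q else clipped_limit w q)).
      * by move=> a b; exact: tends_cst.
      * by move=> a b; exact: tends_cst.
      * by move=> a b; rewrite /tends_to_none; under eq_cvg do rewrite e; exact: cw.
    + by move=> l w _; rewrite normrM ler_pM ?phiC ?fC.
  move=> l q /=; rewrite in_itv/= => /andP[sq qr].
  have qT : 0 <= q <= T by rewrite (le_trans s0 sq) (le_trans qr).
  have srq : s <= q <= r by rewrite sq.
  apply: E_norm; first exact: (brv_bm FF qT (bproc_time srq (bphif l))).
  by move=> w; rewrite normrM ler_pM ?phiC ?fC.
have lhs' : E (fun w => phi w * (Qh l w r i j - Qh l w s i j)) @[l --> \oo] -->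
    - \int[mu]_(q in `[s, r]) E (fun w => phi w * driver clipped_limit w q i j).
  by under eq_cvg do rewrite eq_h; exact: cvgN.
exact: (cvg_unique _ lhs lhs').
Qed.
End LimitEquation.

(** * Gronwall's inequality *)

Lemma cvg_sum_seq (R : realType) (X : Type) (G : set_system X) (I : Type)
    (r : seq I) (f : I -> X -> R) (l : I -> R) : Filter G ->
  (forall i, f i x @[x --> G] --> l i) ->
  (\sum_(i <- r) f i x) @[x --> G] --> \sum_(i <- r) l i.
Proof.
move=> FG fl; elim: r => [|i r ih].
  by rewrite big_nil; under eq_cvg do rewrite big_nil; exact: cvg_cst.
by rewrite big_cons; under eq_cvg do rewrite big_cons; exact: cvgD.
Qed.

Section Gronwall.
Context (R : realType) (m : nat).
Local Notation mu := (@lebesgue_measure R).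

(** Over a step so short that the growth is at most half of the supremum, that
    supremum is at most twice the initial value; there are [N + 1] such steps.
    *)
Lemma linear_growth_bound (f : R -> 'cV[R]_m) (t u K : R) (N : nat) : t <= u ->
  0 <= K -> m%:R * K * ((u - t) / N.+1%:R) <= 2^-1 ->
  (forall i, {within `[t, u], continuous (fun s => f s i 0)}) ->
  (forall s r b, t <= s -> s <= r -> r <= u ->
     (forall q j, s <= q <= r -> `|f q j 0| <= b) ->
     forall i, `|f r i 0 - f s i 0| <= K * b * (r - s)) ->
  forall s, t <= s <= u -> \sum_i `|f s i 0| <= 2 ^+ N.+1 * \sum_i `|f t i 0|.
Proof.
move=> tu K0 KN cf fK.
pose g s := \sum_i `|f s i 0|.
have cg : {within `[t, u], continuous g}.
  move=> x; apply: cvg_sum_seq => i; apply: cvg_norm; exact: cf.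
have fg q j : `|f q j 0| <= g q.
  by rewrite /g (bigD1 j)//= lerDl sumr_ge0.
have g0 q : 0 <= g q by exact: sumr_ge0.
set h := (u - t) / N.+1%:R in KN.
have h0 : 0 <= h by rewrite divr_ge0// subr_ge0.
have Nh : N.+1%:R * h = u - t by rewrite mulrC divfK// pnatr_eq0.
pose s_ (k : nat) := t + k%:R * h.
have sS k : s_ k.+1 = s_ k + h by rewrite /s_ -natr1; ring.
have ts k : t <= s_ k by rewrite lerDl mulr_ge0.
have su k : (k <= N.+1)%N -> s_ k <= u.
  by move=> kN; rewrite /s_ -lerBrDl -Nh ler_wpM2r// ler_nat.
have step k : (k < N.+1)%N -> forall s, s_ k <= s <= s_ k.+1 -> g s <= 2 * g (s_ k).
  move=> kN s ss.
  have skk : s_ k <= s_ k.+1 by rewrite sS lerDl.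
  have cgk : {within `[s_ k, s_ k.+1], continuous g}.
    apply: continuous_subspaceW cg; apply: subset_itv; rewrite bnd_simp ?ts//.
    exact: su.
  have [p pk pmax] := EVT_max skk cgk.
  have /andP[skp psk] : s_ k <= p <= s_ k.+1 by rewrite in_itv/= in pk.
  apply: (@le_trans _ _ (g p)); first by apply: pmax; rewrite in_itv/=.
  have pu : p <= u by rewrite (le_trans psk)// su.
  have inc i : `|f p i 0| <= `|f (s_ k) i 0| + K * g p * h.
    have := fK (s_ k) p (g p) (ts k) skp pu => /(_ _ i) hi.
    rewrite -[f p i 0](subrK (f (s_ k) i 0)) addrC (le_trans (ler_normD _ _))// lerD2l.
    apply: (le_trans (hi _)) => [q j /andP[sq qp]|].
      apply: (le_trans (fg q j)); apply: pmax.
      by rewrite in_itv/= sq (le_trans qp).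
    by rewrite ler_wpM2l ?mulr_ge0// lerBlDl -sS.
  have : g p <= g (s_ k) + m%:R * K * h * g p.
    apply: (@le_trans _ _ (\sum_(i < m) (`|f (s_ k) i 0| + K * g p * h))).
      by apply: ler_sum => i _.
    rewrite big_split/= sumr_const card_ord -[_ *+ m]mulr_natl.
    by rewrite lerD2l le_eqVlt; apply/orP; left; apply/eqP; ring.
  have : m%:R * K * h * g p <= 2^-1 * g p by rewrite ler_wpM2r.
  by lra.
have at_grid k : (k <= N.+1)%N -> g (s_ k) <= 2 ^+ k * g t.
  elim: k => [_|k ih kN]; first by rewrite /s_ mul0r addr0 expr0 mul1r.
  apply: (le_trans (step k kN _ _)); first by rewrite lexx sS lerDl h0.
  by rewrite exprS -mulrA ler_wpM2l// ih// ltnW.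
move=> s /andP[ts' su'].
have [k kN sk] : exists2 k : nat, (k < N.+1)%N & s_ k <= s <= s_ k.+1.
  have s0 : s_ 0%N = t by rewrite /s_ mul0r addr0.
  have [->|st] := eqVneq s t; first by exists 0%N => //; rewrite sS s0 lexx lerDl.
  have : s <= s_ N.+1 by rewrite (_ : s_ N.+1 = u)//; rewrite /s_ Nh; ring.
  elim: N.+1 => [|n ih] ssn.
    by rewrite s0 in ssn; move: st; rewrite eq_le ssn ts'.
  have [sn|sn] := leP s (s_ n).
    by have [k kn ks] := ih sn; exists k => //; exact: ltnW.
  by exists n => //; rewrite (ltW sn).
apply: (le_trans (step k kN s sk)).
rewrite -/(g t); apply: (@le_trans _ _ (2 * (2 ^+ k * g t))).
  by rewrite ler_wpM2l// at_grid// ltnW.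
by rewrite mulrA -exprS ler_wpM2r// ler_weXn2l// ler1n.
Qed.
End Gronwall.

(** * The closed-loop state and its energy *)

Lemma continuous_bounded_measurable (R : realType) (a b : R) (f : R -> R) : a <= b ->
  {within `[a, b], continuous f} -> bounded_measurable (`[a, b]%classic : set R) f.
Proof.
move=> ab cf; split; first exact: subspace_continuous_measurable_fun.
have cn : {within `[a, b], continuous (fun x => `|f x|)}.
  by move=> x; apply: cvg_norm; exact: cf.
have [c _ cmax] := EVT_max ab cn.
by exists `|f c| => x xab; apply: cmax.
Qed.

Lemma bilin_bound (R : realType) m (u v : 'cV[R]_m) (A : 'M[R]_m) (a b c : R) :
  (forall i, `|u i 0| <= a) -> (forall i j, `|A i j| <= b) -> (forall i, `|v i 0| <= c) ->
  `|bilin u A v| <= (m * m)%:R * (a * b * c).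
Proof.
move=> ua Ab vc; rewrite bilinE.
have -> : (m * m)%:R * (a * b * c) = \sum_(i < m) \sum_(j < m) a * c * b.
  by rewrite !sumr_const !card_ord -mulrnA -[RHS]mulr_natl mulrAC.
apply: (le_trans (ler_norm_sum _ _ _)); apply: ler_sum => i _.
apply: (le_trans (ler_norm_sum _ _ _)); apply: ler_sum => j _.
by rewrite !normrM; do 2 (apply: ler_pM => //); rewrite mulr_ge0.
Qed.

Section Verification.
Context dO (Omega : measurableType dO) (R : realType) (P : probability Omega R).
Variables (F : R -> set (set Omega)) (d : nat) (T : R).
Hypothesis FF : filtration F T.
Hypothesis T_gt0 : 0 < T.
Variables (Lambda : 'M[R]_d) (gamma : 'rV[R]_d).
Hypotheses (Lambda_pd : pd_mx Lambda) (gamma_gt0 : forall i, 0 < gamma 0 i).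
Variables (rho : Omega -> R -> 'rV[R]_d).
Hypothesis rho_prog : mx_progressive F `[0, T] (fun w s => diag_mx (rho w s)).
Variables (rt : Omega -> R -> 'rV[R]_d) (St : Omega -> R -> 'M[R]_d).
Hypotheses (brt : mx_bproc F 0 T rt) (bSt : mx_bproc F 0 T St).
Hypothesis rt_ge0 : forall w r i, 0 <= rt w r 0 i.
Local Notation mu := (@lebesgue_measure R).
Hypothesis rtE : \forall w \ae P, \forall r \ae mu, 0 <= r <= T -> rt w r = rho w r.
Hypothesis St_psd : \forall w \ae P, \forall r \ae mu, 0 <= r <= T ->
  forall v, 0 <= bilin v (St w r) v.
Local Notation E f := (\int[P]_w f w).
Local Notation driver := (driver Lambda gamma rt St).
Local Notation B := (control_mx gamma).

Variables (t u : R) (t0 : 0 <= t) (tu : t <= u) (uT : u < T).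
Variables (Ql Qu : Omega -> R -> 'M[R]_(d + d)).
Hypotheses (Ql_prog : mx_progressive F `[0, T] Ql) (bQu : mx_bproc F 0 u Qu).
Hypothesis wQu : mx_weak_equation P F 0 u Qu (driver Qu).
Hypothesis QuE : \forall w \ae P, \forall s \ae mu, 0 <= s <= u -> Qu w s = Ql w s.
Hypothesis Qu_sym : \forall w \ae P, \forall s \ae mu, 0 <= s <= u -> (Qu w s)^T = Qu w s.

Variables (x y : 'cV[R]_d) (X Y xi : Omega -> R -> 'cV[R]_d).
Hypothesis xi_def : forall w s, xi w s =
  feedback_control Lambda gamma Ql w s (X w s) (Y w s).
Hypothesis state_XY : state_process P F T gamma rho xi t x y X Y.

Definition joint_state w s : 'cV[R]_(d + d) := col_mx (X w s) (Y w s).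
Local Notation Z := joint_state.

Definition feedback_mx w s : 'M[R]_(d, d + d) := - (invmx Lambda *m B^T *m Qu w s).
Local Notation L := feedback_mx.

Definition closed_loop w s : 'M[R]_(d + d) := drift_mx (rt w s) + B *m L w s.
Local Notation G := closed_loop.

Let u0 : 0 <= u := le_trans t0 tu.
Let uT' : u <= T := ltW uT.

Lemma feedback_bproc : mx_bproc F 0 u L.
Proof. by apply: mx_bprocN; apply: mx_bproc_mul => //; exact: mx_bproc_cst. Qed.

Lemma closed_loop_bproc : mx_bproc F 0 u G.
Proof.
apply: mx_bprocD; first exact: (mx_bproc_drift brt (lexx 0) uT').
by apply: mx_bproc_mul; [exact: mx_bproc_cst|exact: feedback_bproc].
Qed.

Lemma feedback_stateE w s : Qu w s = Ql w s -> xi w s = L w s *m Z w s.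
Proof.
by move=> e; rewrite xi_def /feedback_control /L /Z e control_mxT mulNmx.
Qed.

Lemma closed_loopE w s :
  G w s *m Z w s = col_mx (- (L w s *m Z w s))
    (diag_mx gamma *m (L w s *m Z w s) - diag_mx (rt w s) *m Y w s).
Proof. by rewrite /G mulmxDl -mulmxA; exact: drift_control_col. Qed.

(** The feedback turns the state equation into a linear one. Its coefficients
    may be replaced by bounded versions, because they agree at almost every
    time. *)
Lemma state_path_linear : \forall w \ae P,
  [/\ forall i, {within `[t, u], continuous (fun s => Z w s i 0)},
      forall i, bounded_measurable (`[t, u]%classic : set R) (fun s => (G w s *m Z w s) i 0) &
      forall s, t <= s <= u ->
        Z w s = col_mx x y + mx_integral `[t, s] (fun q => G w q *m Z w q)].
Proof.
have [_ _ cXY eqXY] := state_XY.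
apply: filter_app cXY; apply: filter_app eqXY.
apply: filterS2 rtE QuE => w rtw Quw eqw [cX cY].
have sub : (`[t, u]%classic : set R) `<=` `[t, T[%classic.
  by apply: subset_itvl; rewrite bnd_simp.
have subT : (`[t, u]%classic : set R) `<=` `[0, T]%classic.
  by apply: subset_itv; rewrite bnd_simp.
have cZ i : {within `[t, u], continuous (fun s => Z w s i 0)}.
  rewrite /Z; case: (split_ordP i) => i' ->.
    rewrite (_ : (fun s => _) = fun s => X w s i' 0); last first.
      by apply/funext => s; rewrite col_mxEu.
    exact: continuous_subspaceW sub (cX i' 0).
  rewrite (_ : (fun s => _) = fun s => Y w s i' 0); last first.
    by apply/funext => s; rewrite col_mxEd.
  exact: continuous_subspaceW sub (cY i' 0).
have bZ i : bounded_measurable (`[t, u]%classic : set R) (fun s => Z w s i 0).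
  exact: continuous_bounded_measurable.
have bpath m n (A : Omega -> R -> 'M[R]_(m, n)) i j : mx_bproc F 0 u A ->
    bounded_measurable (`[t, u]%classic : set R) (fun s => A w s i j).
  move=> bA; have jA := bproc_joint FF t0 tu uT' (bproc_sub t0 (lexx u) (bA i j)).
  exact: jbm_path jA.
pose bm (g : R -> R) := bounded_measurable (`[t, u]%classic : set R) g.
have bmc c : bm (fun=> c) by exact: bm_cst.
have bmd f g : bm f -> bm g -> bm (fun s => f s + g s) by exact: bmD.
have bmm f g : bm f -> bm g -> bm (fun s => f s * g s) by exact: bmM.
have bmM' := @entrywiseM R R bm bmc bmd bmm.
have bZ' : entrywise bm (Z w) by move=> i j; rewrite (ord1 j); exact: bZ.
have bLZ : entrywise bm (fun s => L w s *m Z w s).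
  apply: bmM' => // i j; exact: bpath feedback_bproc.
have bGZ : entrywise bm (fun s => G w s *m Z w s).
  by apply: bmM' => // i j; exact: bpath closed_loop_bproc.
pose mf (g : R -> R) := measurable_fun (`[t, u]%classic : set R) g.
have mf_cst c : mf (fun=> c) by exact: measurable_cst.
have mf_D f g : mf f -> mf g -> mf (fun s => f s + g s) by exact: measurable_funD.
have mf_M f g : mf f -> mf g -> mf (fun s => f s * g s) by exact: measurable_funM.
have mZ : entrywise mf (Z w) by move=> i j; have [] := bZ' i j.
have mY : entrywise mf (Y w).
  move=> i j; have [] := bZ' (rshift d i) j.
  by rewrite (_ : (fun s => _) = fun s => Y w s i j)//; apply/funext => s; rewrite col_mxEd.
have mxi : entrywise mf (xi w).
  have -> : xi w = fun s => - (invmx Lambda *m row_mx (- 1%:M) (diag_mx gamma) *m Ql w s *m Z w s).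
    by apply/funext => s; rewrite xi_def.
  apply: (entrywiseN mf_cst mf_M); apply: (entrywiseM mf_cst mf_D mf_M) => //.
  apply: (entrywiseM mf_cst mf_D mf_M); first exact: (entrywise_cst mf_cst).
  by move=> i j; apply: (measurable_funS _ subT) => //; exact: (progressive_path T_gt0).
have mrho : entrywise mf (fun s => diag_mx (rho w s)).
  by move=> i j; apply: (measurable_funS _ subT) => //; exact: (progressive_path T_gt0 w i j rho_prog).
split=> // [i|s /andP[ts su]]; first exact: bGZ.
have sT : t <= s < T by rewrite ts (le_lt_trans su).
have [eX eY] := eqw s sT.
have subs : (`[t, s]%classic : set R) `<=` `[t, u]%classic.
  by apply: subset_itvl; rewrite bnd_simp.
have range q : (`[t, s]%classic : set R) q -> (0 <= q <= u) && (0 <= q <= T).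
  rewrite /= in_itv/= => /andP[tq qs].
  by rewrite (le_trans t0 tq) (le_trans qs su) (le_trans (le_trans qs su) uT').
apply/matrixP => i j; rewrite (ord1 j) [RHS]mxE [mx_integral _ _ i 0]mxE.
rewrite /Z; case: (split_ordP i) => i' ->.
  rewrite !col_mxEu eX !mxE; congr (_ + _).
  have -> : \int[mu]_(q in `[t, s]) xi w q i' 0 = \int[mu]_(q in `[t, s]) (L w q *m Z w q) i' 0.
    apply: (@bm_ae_eq_int _ (measurableTypeR R) R mu) => //.
    - exact: (measurable_funS _ subs (mxi i' 0)).
    - by have [mLZ _] := bLZ i' 0; exact: (measurable_funS _ subs mLZ).
    apply: filterS Quw => q Qq /range/andP[qu qT].
    by rewrite feedback_stateE// Qq.
  rewrite -int_N; last by apply: bmS (bLZ i' 0).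
  by congr Rintegral; apply/funext => q; rewrite closed_loopE col_mxEu [in RHS]mxE.
rewrite !col_mxEd eY !mxE; congr (_ + _).
apply: (@bm_ae_eq_int _ (measurableTypeR R) R mu) => //.
- apply: (measurable_funS _ subs) => //.
  apply: (entrywiseD mf_D).
    apply: (entrywiseN mf_cst mf_M); exact: (entrywiseM mf_cst mf_D mf_M).
  by apply: (entrywiseM mf_cst mf_D mf_M) => //; exact: (entrywise_cst mf_cst).
- by have [mGZ _] := bGZ (rshift d i') 0; exact: (measurable_funS _ subs mGZ).
apply: filterS2 rtw Quw => q rtq Qq /range/andP[qu qT].
by rewrite closed_loopE col_mxEd feedback_stateE ?Qq// rtq// addrC.
Qed.

Lemma state_increment : \forall w \ae P,
  [/\ Z w t = col_mx x y,
      forall i, {within `[t, u], continuous (fun s => Z w s i 0)} &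
      forall s r, t <= s -> s <= r -> r <= u ->
        Z w r = Z w s + mx_integral `[s, r] (fun q => G w q *m Z w q) /\
        forall i, bounded_measurable (`[s, r]%classic : set R) (fun q => (G w q *m Z w q) i 0)].
Proof.
apply: filterS state_path_linear => w [cZ bGZ eqZ]; split => //.
  rewrite eqZ ?lexx//; apply/matrixP => i j.
  by rewrite mxE [mx_integral _ _ i j]mxE set_itv1 Rintegral_set1 addr0.
move=> s r ts sr ru.
have b a c i : t <= a -> c <= u ->
    bounded_measurable (`[a, c]%classic : set R) (fun q => (G w q *m Z w q) i 0).
  by move=> ta cu; apply: bmS (bGZ i) => //; apply: subset_itv; rewrite bnd_simp.
split=> [|i]; last exact: b.
rewrite (eqZ r) ?(le_trans ts)// (eqZ s) ?ts ?(le_trans sr)//.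
rewrite -addrA; congr (_ + _); apply/matrixP => i j; rewrite (ord1 j) !mxE.
apply: int_split => //; exact: b.
Qed.

(** The coefficients are bounded uniformly in the outcome, hence so is the
    state on [[t, u]]; the bound is lost as [u] tends to [T]. *)
Lemma state_bounded : exists2 M, 0 <= M & \forall w \ae P,
  forall s, t <= s <= u -> forall i j, `|Z w s i j| <= M.
Proof.
have [CG CG0 GC] := mx_bproc_bound FF (lexx 0) u0 uT' closed_loop_bproc.
pose K := (d + d)%:R * CG; have K0 : 0 <= K by rewrite mulr_ge0.
pose A := (d + d)%:R * K * (u - t) * 2.
have [N AN] : exists N : nat, A <= N.+1%:R.
  by exists (Num.truncn A); apply: ltW; exact: truncnS_gt.
exists (2 ^+ N.+1 * \sum_i `|col_mx x y i 0|); first by rewrite mulr_ge0 ?exprn_ge0// sumr_ge0.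
apply: filterS state_increment => w [Zt cZ incZ] s su i j.
have := @linear_growth_bound R (d + d) (Z w) t u K N tu K0 _ cZ _ s su.
rewrite Zt (ord1 j); move=> h; apply: (@le_trans _ _ (\sum_k `|Z w s k 0|)).
  by rewrite (bigD1 i)//= lerDl sumr_ge0.
apply: h.
  by rewrite mulrA ler_pdivrMr// ler_pdivlMl// mulrC.
move=> a r b ta ar ru Zb k; have [-> bGZ] := incZ a r ta ar ru.
rewrite [in X in X - _]mxE addrAC subrr add0r mxE.
apply: int_norm => // q /andP[aq qr].
have q0u : 0 <= q <= u by rewrite (le_trans t0 (le_trans ta aq)) (le_trans qr).
rewrite /K -mulrA; apply: mulmx_bound => // [i1 j1|i1 j1]; first exact: GC.
by rewrite (ord1 j1); apply: Zb; rewrite aq.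
Qed.

(** The feedback attains the minimum in the completed square, so that only the
    running cost of the state remains. *)
Lemma closed_loop_square w p v : (Qu w p)^T = Qu w p ->
  bilin (G w p *m v) (Qu w p) v + bilin v (Qu w p) (G w p *m v)
  - bilin v (driver Qu w p) v + bilin (L w p *m v) Lambda (L w p *m v)
  = - bilin v (cost_mx gamma (rt w p) (St w p)) v.
Proof.
move=> Qsym; rewrite /driver (riccati_square gamma Lambda_pd (rt w p) (St w p) v (L w p *m v) Qsym).
have -> : L w p *m v + invmx Lambda *m B^T *m Qu w p *m v = 0.
  by rewrite /L mulNmx addNr.
have -> : bilin 0 Lambda 0 = 0 by rewrite /bilin mulmx0 mxE.
have -> : drift_mx (rt w p) *m v + B *m (L w p *m v) = G w p *m v.
  by rewrite /G mulmxDl mulmxA.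
by ring.
Qed.

Lemma running_cost_ge0 w p v : (forall z, 0 <= bilin z (St w p) z) ->
  0 <= bilin v (cost_mx gamma (rt w p) (St w p)) v.
Proof.
move=> psd; rewrite -(vsubmxK v) bilin_cost// addr_ge0// sumr_ge0// => i _.
by rewrite mulr_ge0 ?sqr_ge0// mulr_ge0// divr_ge0// ltW.
Qed.

Lemma joint_state_prog : mx_progressive F `[t, T[ Z.
Proof.
have [pX pY _ _] := state_XY; move=> i j; rewrite /Z.
case: (split_ordP i) => i' ->.
  rewrite (_ : (fun w s => _) = fun w s => X w s i' j); first exact: pX.
  by apply/funext => w; apply/funext => s; rewrite col_mxEu.
rewrite (_ : (fun w s => _) = fun w s => Y w s i' j); first exact: pY.
by apply/funext => w; apply/funext => s; rewrite col_mxEd.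
Qed.

(** Along the closed loop, the mean of [Z^T Q Z] plus the accumulated cost of
    trading decreases at the rate of the running cost of the state. Over one
    step [quadratic_step] applies with the state frozen at the beginning;
    since the state moves at bounded speed, releasing it again costs another
    quadratic error. *)
Lemma energy_inequality : exists Zt : Omega -> R -> 'cV[R]_(d + d),
  [/\ mx_bproc F t u Zt,
      \forall w \ae P, forall s, t <= s <= u -> Zt w s = Z w s &
      E (fun w => bilin (Zt w u) (Qu w u) (Zt w u)) +
      \int[mu]_(p in `[t, u])
        E (fun w => bilin (L w p *m Zt w p) Lambda (L w p *m Zt w p)) <=
      E (fun w => bilin (Zt w t) (Qu w t) (Zt w t))].
Proof.
have [Mz Mz0 ZM] := state_bounded.
pose Zt w s : 'cV[R]_(d + d) := \matrix_(i, j) clip Mz (Z w s i j).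
have bZ : mx_bproc F t u Zt.
  apply: mx_clip joint_state_prog => //; apply: subset_itvl; by rewrite bnd_simp.
have ZtE : \forall w \ae P, forall s, t <= s <= u -> Zt w s = Z w s.
  apply: filterS ZM => w h s su; apply/matrixP => i j; rewrite mxE clip_id//; exact: h.
exists Zt; split => //.
have bQ := mx_bproc_sub t0 (lexx u) bQu.
have bL := mx_bproc_sub t0 (lexx u) feedback_bproc.
have bG := mx_bproc_sub t0 (lexx u) closed_loop_bproc.
have bf := mx_bproc_sub t0 (lexx u) (mx_bproc_driver Lambda gamma brt bSt (lexx 0) uT' bQu).
have bGZ := mx_bproc_mul bG bZ; have bLZ := mx_bproc_mul bL bZ.
have bLambda : mx_bproc F t u (fun _ _ => Lambda) by exact: mx_bproc_cst.
have bc := bproc_bilin bLZ bLambda bLZ.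
have [M1 M10 QM] := mx_bproc_bound FF t0 tu uT' bQ.
have [M2 M20 fM] := mx_bproc_bound FF t0 tu uT' bf.
have [M3 M30 GZM] := mx_bproc_bound FF t0 tu uT' bGZ.
pose M := M1 + M2 + M3 + Mz.
have M0 : 0 <= M by rewrite !addr_ge0.
have M1M : M1 <= M by rewrite /M -!addrA lerDl !addr_ge0.
have M2M : M2 <= M by rewrite /M -!addrA addrCA lerDl !addr_ge0.
have M3M : M3 <= M by rewrite /M addrAC lerDr !addr_ge0.
have MzM : Mz <= M by rewrite /M lerDr !addr_ge0.
set m := (d + d)%N.
pose c w p := bilin (L w p *m Zt w p) Lambda (L w p *m Zt w p).
pose Ec p := E (fun w => c w p).
have bEc : bounded_measurable (`[t, u]%classic : set R) Ec by exact: (bproc_mean P FF).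
pose Psi s := E (fun w => bilin (Zt w s) (Qu w s) (Zt w s)) + \int[mu]_(p in `[t, s]) Ec p.
suff h : Psi u <= Psi t.
  by move: h; rewrite /Psi set_itv1 Rintegral_set1 addr0.
apply: (@quadratic_increment_nonincreasing _ _
  ((m * m)%:R * (3 * M ^+ 3) + 4 * ((m * m)%:R * (M * M * M)))) => //.
move=> s r ts sr ru.
have tr := le_trans ts sr; have rT := le_trans ru uT'; have s0 := le_trans t0 ts.
have su : t <= s <= u by rewrite ts (le_trans sr).
have ru' : t <= r <= u by rewrite tr.
have range p : s <= p <= r -> t <= p <= u.
  by case/andP=> sp pr; rewrite (le_trans ts sp) (le_trans pr ru).
pose V w := Zt w s; pose K := 4 * ((m * m)%:R * (M * M * M)) * (r - s).
have bV : mx_brv F s V by exact: mx_bproc_time su bZ.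
have bVc : mx_bproc F s r (fun w _ => V w) by apply: (mx_bproc_brv FF).
have sub n k (A : Omega -> R -> 'M[R]_(n, k)) : mx_bproc F t u A -> mx_bproc F s r A.
  exact: mx_bproc_sub.
pose I w p := bilin (G w p *m Zt w p) (Qu w p) (V w) + bilin (V w) (Qu w p) (G w p *m Zt w p)
  - bilin (V w) (driver Qu w p) (V w).
have bI : bproc F s r I.
  apply: bprocB; last by apply: bproc_bilin => //; exact: sub.
  by apply: bprocD; apply: bproc_bilin => //; exact: sub.
have bcs : bproc F s r c by exact: bproc_sub bc.
have incr : \forall w \ae P, forall a b, t <= a -> a <= b -> b <= u ->
    Zt w b = Zt w a + mx_integral `[a, b] (fun p => G w p *m Zt w p).
  apply: filterS2 state_increment ZtE => w [_ _ inc] ze a b ta ab bu.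
  have [e _] := inc a b ta ab bu.
  rewrite !ze ?ta ?bu ?(le_trans ta ab) ?(le_trans ab bu)// e; congr (_ + _).
  apply/matrixP => i j; rewrite !mxE; apply: eq_Rintegral => p /set_mem/=.
  rewrite in_itv/= => /andP[ap pb]; rewrite ze// (le_trans ta ap)/=.
  exact: le_trans pb bu.
have stepQ := @quadratic_step _ _ _ P F T FF m s r M Qu (driver Qu) V (Zt ^~ r)
  (fun w p => G w p *m Zt w p) s0 sr rT M0 (sub _ _ _ bQ) (sub _ _ _ bf) (sub _ _ _ bGZ)
  bV (mx_bproc_time ru' bZ).
have {}stepQ : E (fun w => bilin (Zt w r) (Qu w r) (Zt w r)) -
    E (fun w => bilin (Zt w s) (Qu w s) (Zt w s)) <=
    \int[mu]_(p in `[s, r]) E (fun w => I w p) + (m * m)%:R * (3 * M ^+ 3) * (r - s) ^+ 2.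
  rewrite -lerBlDl; apply: le_trans (ler_norm _) _; apply: stepQ.
  - move=> i j a b phi sa ab br; apply: wQu => //; first exact: le_trans sa.
    exact: le_trans ru.
  - by move=> w p i j sp; apply: le_trans M1M; apply: QM; exact: range.
  - by move=> w p i j sp; apply: le_trans M2M; apply: fM; exact: range.
  - by move=> w p i j sp; apply: le_trans M3M; apply: GZM; exact: range.
  - by move=> w i j; apply: le_trans MzM; rewrite mxE clip_norm.
  by apply: filterS incr => w h; exact: h.
(* Here the state frozen at [s] is compared with the state at [p]: the four
   bilinear terms in the increment [D] account for the constant [K]. *)
have frozen : \int[mu]_(p in `[s, r]) E (fun w => I w p + c w p - K) <= 0.
  apply: (@int_mean_le0 _ _ _ P F T FF s r (fun w p => I w p + c w p - K)) => //.
    by apply: bprocB; [exact: bprocD|exact: bproc_cst].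
  apply: filter_app incr; apply: filterS2 Qu_sym St_psd => w symw psdw inc.
  apply: filterS2 symw psdw => p symp psdp sp.
  have tp := range p sp; case/andP: (sp) => sp1 pr1.
  have pu0 : 0 <= p <= u by case/andP: tp => /(le_trans t0) ->.
  have pT0 : 0 <= p <= T by case/andP: pu0 => -> /le_trans ->.
  have := closed_loop_square (Zt w p) (symp pu0).
  have := running_cost_ge0 (Zt w p) (psdp pT0).
  have e : Zt w p = V w + mx_integral `[s, p] (fun q => G w q *m Zt w q).
    by apply: inc => //; case/andP: tp.
  set D := mx_integral _ _ in e.
  have DM i : `|D i 0| <= M * (r - s).
    rewrite mxE; apply: (@le_trans _ _ (M3 * (p - s))).
      apply: int_norm => //.
        have jG := bproc_joint FF s0 sr rT (sub _ _ _ bGZ i 0).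
        apply: bmS (jbm_path w jG) => //; apply: subset_itvl; by rewrite bnd_simp.
      move=> q /andP[sq qp]; apply: GZM; apply: range; by rewrite sq (le_trans qp).
    by apply: ler_pM => //; rewrite ?subr_ge0// lerB.
  have gM i j : `|(G w p *m Zt w p) i j| <= M by apply: le_trans M3M; exact: GZM.
  have QpM i j : `|Qu w p i j| <= M by apply: le_trans M1M; exact: QM.
  have fpM i j : `|driver Qu w p i j| <= M by apply: le_trans M2M; exact: fM.
  have ZpM q i : `|Zt w q i 0| <= M by apply: le_trans MzM; rewrite mxE clip_norm.
  set g := G w p *m Zt w p; rewrite -/g in gM.
  have b1 := bilin_bound (fun i => gM i 0) QpM DM.
  have b2 := bilin_bound DM QpM (fun i => gM i 0).
  have b3 := bilin_bound (ZpM p) fpM DM.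
  have b4 := bilin_bound DM fpM (ZpM s).
  rewrite /I /c -/g /K => cost0 sq.
  have eI : bilin g (Qu w p) (V w) + bilin (V w) (Qu w p) g - bilin (V w) (driver Qu w p) (V w) =
    bilin g (Qu w p) (Zt w p) + bilin (Zt w p) (Qu w p) g - bilin (Zt w p) (driver Qu w p) (Zt w p)
    - bilin g (Qu w p) D - bilin D (Qu w p) g + bilin (Zt w p) (driver Qu w p) D
    + bilin D (driver Qu w p) (Zt w s).
    rewrite -/(V w) e !(bilinDl, bilinDr); ring.
  set k := (m * m)%:R * (M * M * M) * (r - s).
  have k1 : (m * m)%:R * (M * M * (M * (r - s))) = k by rewrite /k; ring.
  have k2 : (m * m)%:R * (M * (r - s) * M * M) = k by rewrite /k; ring.
  have -> : 4 * ((m * m)%:R * (M * M * M)) * (r - s) = 4 * k by rewrite /k; ring.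
  rewrite {}eI; move: b1 b2 b3 b4 cost0 sq; rewrite k1 k2 !ler_norml.
  move=> /andP[b1 _] /andP[b2 _] /andP[_ b3] /andP[_ b4].
  lra.
have mean_split : \int[mu]_(p in `[s, r]) E (fun w => I w p + c w p - K) =
    \int[mu]_(p in `[s, r]) E (fun w => I w p) + \int[mu]_(p in `[s, r]) Ec p - K * (r - s).
  have bEI : bounded_measurable (`[s, r]%classic : set R) (fun p => E (fun w => I w p)).
    exact: (bproc_mean P FF).
  have bEcs : bounded_measurable (`[s, r]%classic : set R) Ec.
    by apply: bmS bEc => //; apply: subset_itv; rewrite bnd_simp.
  rewrite -int_D// -int_cst// -int_B//; [|exact: bmD|exact: bm_cst].
  apply: eq_Rintegral => p /set_mem/=; rewrite in_itv/= => sp.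
  have pT0 : 0 <= p <= T by case/andP: sp => sp pr; rewrite (le_trans s0 sp) (le_trans pr).
  have bIp : bounded_measurable [set: Omega] (fun w => I w p).
    by apply: (brv_bm FF pT0); exact: bproc_time sp bI.
  have bcp : bounded_measurable [set: Omega] (fun w => c w p).
    by apply: (brv_bm FF pT0); exact: bproc_time sp bcs.
  rewrite [LHS](@E_B _ _ _ P (fun w => I w p + c w p) (fun=> K)); [|exact: bmD|exact: bm_cst].
  by rewrite E_cst (@E_D _ _ _ P (fun w => I w p) (fun w => c w p)).
have split_c : \int[mu]_(p in `[t, r]) Ec p =
    \int[mu]_(p in `[t, s]) Ec p + \int[mu]_(p in `[s, r]) Ec p.
  apply: int_split => //; apply: bmS bEc => //; apply: subset_itvl; by rewrite bnd_simp.
rewrite /Psi split_c; move: stepQ frozen; rewrite mean_split /K.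
rewrite subr_le0 => stepQ frozen.
apply: (@le_trans _ _ ((m * m)%:R * (3 * M ^+ 3) * (r - s) ^+ 2
  + 4 * ((m * m)%:R * (M * M * M)) * (r - s) * (r - s))); last first.
  by rewrite le_eqVlt; apply/orP; left; apply/eqP; ring.
apply: le_trans (lerD (lexx _) frozen).
move: stepQ; rewrite lerBlDr => stepQ.
apply: (@le_trans _ _ (\int[P]_w bilin (Zt w r) (Qu w r) (Zt w r)
  - \int[P]_w bilin (Zt w s) (Qu w s) (Zt w s) + \int[mu]_(p in `[s, r]) Ec p)).
  by rewrite le_eqVlt; apply/orP; left; apply/eqP; ring.
rewrite addrA lerD2r lerBlDr (le_trans stepQ)//.
by rewrite lerD2r addrC.
Qed.
End Verification.

(** * Approaching the terminal time *)

Section TowardTerminalTime.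
Context (R : realType) (t T : R).
Hypothesis tT : t < T.

Definition toward (n : nat) : R := T - (T - t) / n.+1%:R.

Lemma toward_lt n : toward n < T.
Proof. by rewrite gtrBl divr_gt0// subr_gt0. Qed.

Lemma toward_ge n : t <= toward n.
Proof.
rewrite /toward lerBrDr -lerBrDl ler_pdivrMr// ler_peMr ?ler1n//.
by rewrite subr_ge0 ltW.
Qed.

Lemma toward_mono m n : (m <= n)%N -> toward m <= toward n.
Proof.
move=> mn; apply: lerB => //; apply: ler_wpM2l; first by rewrite subr_ge0 ltW.
by rewrite lef_pV2 ?posrE ?ltr0n// ler_nat ltnS.
Qed.

Lemma toward_cvg : toward n @[n --> \oo] --> T.
Proof.
rewrite -[X in _ --> X](subr0 T); apply: cvgB; first exact: cvg_cst.
rewrite -(mulr0 (T - t)); apply: cvgM; first exact: cvg_cst.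
exact: cvg_harmonic.
Qed.

Lemma bigcup_toward : \bigcup_n `[t, toward n]%classic = `[t, T[%classic.
Proof.
apply/seteqP; split => [q [n _]|q] /=; rewrite !in_itv/=.
  by move=> /andP[-> /le_lt_trans]; apply; exact: toward_lt.
move=> /andP[tq qT].
have [n] : exists n : nat, (T - t) / (T - q) < n.+1%:R.
  by exists (Num.truncn ((T - t) / (T - q))); exact: truncnS_gt.
rewrite ltr_pdivrMr ?subr_gt0// => h; exists n => //=; rewrite in_itv/= tq/=.
by rewrite /toward lerBrDl -lerBrDr ler_pdivrMr// mulrC ltW.
Qed.
End TowardTerminalTime.

Section GrowingHorizon.
Context d (S : measurableType d) (R : realType) (P : probability S R).
Local Notation mu := (@lebesgue_measure R).

Lemma measurable_path_integral (I : set R) (f : S -> R -> R) : measurable I ->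
  measurable_fun ([set: S] `*` I) (fun z : S * R => f z.1 z.2) ->
  (forall w r, 0 <= f w r) ->
  measurable_fun [set: S] (fun w => \int[mu]_(r in I) (f w r)%:E)%E.
Proof.
move=> mI mf f0.
pose g (z : S * R) : R := ((fun z => f z.1 z.2) \_ ([set: S] `*` I)) z.
have mg : measurable_fun setT g.
  by apply: (measurable_restrictT _ _).1 => //; exact: measurableX.
have gE w : (\int[mu]_(r in I) (f w r)%:E = \int[mu]_r (g (w, r))%:E)%E.
  rewrite integral_mkcond; apply: eq_integral => r _.
  rewrite restrict_EFin /= /g /patch; congr (if _ then _ else _)%:E.
  by apply/idP/idP; rewrite !inE => // -[].
under eq_fun do rewrite gE.
apply: (@measurable_fun_fubini_tonelli_F _ _ S (measurableTypeR R) R mu (EFin \o g)).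
  exact/measurable_EFinP.
by move=> z; rewrite lee_fin /g /patch; case: ifP.
Qed.

Lemma integral_toward_le (t T C : R) (f : S -> R -> R) : t < T ->
  measurable_fun ([set: S] `*` `[t, T[) (fun z : S * R => f z.1 z.2) ->
  (forall w r, 0 <= f w r) ->
  (forall n, (\int[P]_w \int[mu]_(r in `[t, toward t T n]) (f w r)%:E <= C%:E)%E) ->
  (\int[P]_w \int[mu]_(r in `[t, T[) (f w r)%:E <= C%:E)%E.
Proof.
move=> tT mf f0 fC.
have sub n : `[t, toward t T n]%classic `<=` `[t, T[%classic.
  by apply: subset_itvl; rewrite bnd_simp; exact: toward_lt.
have mfn n : measurable_fun ([set: S] `*` `[t, toward t T n]) (fun z : S * R => f z.1 z.2).
  apply: measurable_funS mf; first exact: measurableX.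
  by move=> [w r] [_ /= rn]; split => //=; exact: sub rn.
have mpath w n : measurable_fun (`[t, toward t T n]%classic : set R) (fun r => (f w r)%:E).
  by apply/measurable_EFinP; exact: measurable_path_section (mfn n).
have nd : nondecreasing_seq (fun n => `[t, toward t T n]%classic : set R).
  move=> m n mn; rewrite subsetEset; apply: subset_itvl.
  by rewrite bnd_simp; exact: toward_mono.
have pathcvg w : (\int[mu]_(r in `[t, toward t T n]) (f w r)%:E @[n --> \oo] -->
    \int[mu]_(r in `[t, T[) (f w r)%:E)%E.
  rewrite -(bigcup_toward tT).
  apply: (@ge0_nondecreasing_set_cvg_integral _ (measurableTypeR R) R
    (fun n => `[t, toward t T n]%classic)) => //.
    by move=> n; exact: mpath.
  by move=> n r _; rewrite lee_fin.
rewrite (eq_integral (fun w => limn (fun n => (\int[mu]_(r in `[t, toward t T n]) (f w r)%:E)%E))); last first.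
  by move=> w _; rewrite (cvg_lim _ (pathcvg w)).
rewrite monotone_convergence//.
- apply: lime_le; last by apply: nearW.
  apply: ereal_nondecreasing_is_cvgn => m n mn; apply: ge0_le_integral => //.
  + by move=> w _; apply: integral_ge0 => r _; rewrite lee_fin.
  + exact: measurable_path_integral.
  + exact: measurable_path_integral.
  move=> w _; apply: ge0_subset_integral => //.
  + exact: mpath.
  + by move=> r _; rewrite lee_fin.
  by have := nd m n mn; rewrite subsetEset.
- by move=> n; exact: measurable_path_integral.
- by move=> n w _; apply: integral_ge0 => r _; rewrite lee_fin.
move=> w _ m n mn; apply: ge0_subset_integral => //.
- exact: mpath.
- by move=> r _; rewrite lee_fin.
by have := nd m n mn; rewrite subsetEset.
Qed.

Lemma progressive_joint (F : R -> set (set S)) (t T : R) (f : S -> R -> R) :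
  filtration F T -> 0 <= t -> t < T -> progressive F `[t, T[ f ->
  measurable_fun ([set: S] `*` `[t, T[) (fun z : S * R => f z.1 z.2).
Proof.
move=> FF t0 tT pf.
have -> : [set: S] `*` `[t, T[%classic = \bigcup_n ([set: S] `*` `[t, toward t T n]%classic).
  by rewrite -(bigcup_toward tT) -setX_bigcupr.
apply/measurable_fun_bigcup => [n|n]; first exact: measurableX.
have In : `[t, T[%classic (toward t T n) by rewrite /= in_itv/= toward_ge// toward_lt.
have := pf _ In; rewrite (_ : `[t, T[ `&` `]-oo, toward t T n] = `[t, toward t T n])%classic.
  apply: jointly_measurable_identity => //; apply: FF.1.
  by rewrite (le_trans t0) ?toward_ge//= ltW// toward_lt.
apply/seteqP; split => q /=; rewrite !in_itv/=.
  by move=> [/andP[-> _] ->].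
by move=> /andP[-> qn]; rewrite qn (le_lt_trans qn)// toward_lt.
Qed.
End GrowingHorizon.

(** The Cauchy-Schwarz inequality for the inner product of [A], between [v]
    and [invmx A e_i], bounds the coordinate [v i]. *)
Lemma pd_controls_norm (R : realType) n (A : 'M[R]_n) : pd_mx A ->
  exists2 k : R, 0 <= k & forall v : 'cV[R]_n, \sum_i v i 0 ^+ 2 <= k * bilin v A v.
Proof.
move=> Apd; have AT : A^T = A by case: Apd.
pose q i := bilin (invmx A *m delta_mx i 0) A (invmx A *m delta_mx i 0).
have q0 i : 0 <= q i by exact: pd_ge0.
(* [q i + 1] in place of [q i] avoids dividing by zero. *)
exists (\sum_i (q i + 1)); first by apply: sumr_ge0 => i _; rewrite addr_ge0.
move=> v; rewrite mulr_suml; apply: ler_sum => i _.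
have cross : bilin v A (invmx A *m delta_mx i 0) = v i 0.
  by rewrite bilin_mulr mulmxV ?pd_unitmx// /bilin mulmx1 -colE !mxE.
have := pd_ge0 (v - (v i 0 / (q i + 1)) *: (invmx A *m delta_mx i 0)) Apd.
rewrite !(bilinDl, bilinDr, bilinNl, bilinNr, bilinZl, bilinZr) -/(q i) cross.
rewrite (bilin_sym _ _ AT) cross.
have := q0 i; move: (q i) (v i 0) (bilin v A v) => {}q a b {}q0 h.
have q1 : 0 < q + 1 by rewrite ltr_wpDl.
have e : b - (a ^+ 2 / (q + 1) + a ^+ 2 / (q + 1) ^+ 2) >= 0.
  apply: le_trans h _; rewrite le_eqVlt; apply/orP; left; apply/eqP; field.
  by rewrite gt_eqF.
have : a ^+ 2 / (q + 1) <= b.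
  move: e; rewrite subr_ge0; apply: le_trans; rewrite lerDl.
  by rewrite divr_ge0 ?sqr_ge0.
by rewrite ler_pdivrMr// mulrC.
Qed.

(** * Estimates uniform up to the terminal time *)

Section LiquidationEstimate.
Context dO (Omega : measurableType dO) (R : realType) (P : probability Omega R).
Variables (F : R -> set (set Omega)) (d : nat) (T : R).
Hypothesis FF : filtration F T.
Hypothesis T_gt0 : 0 < T.
Variables (Lambda : 'M[R]_d) (gamma : 'rV[R]_d).
Hypotheses (Lambda_pd : pd_mx Lambda) (gamma_gt0 : forall i, 0 < gamma 0 i).
Variables (rho : Omega -> R -> 'rV[R]_d).
Hypothesis rho_prog : mx_progressive F `[0, T] (fun w s => diag_mx (rho w s)).
Variables (rt : Omega -> R -> 'rV[R]_d) (St : Omega -> R -> 'M[R]_d).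
Hypotheses (brt : mx_bproc F 0 T rt) (bSt : mx_bproc F 0 T St).
Hypothesis rt_ge0 : forall w r i, 0 <= rt w r 0 i.
Local Notation mu := (@lebesgue_measure R).
Hypothesis rtE : \forall w \ae P, \forall r \ae mu, 0 <= r <= T -> rt w r = rho w r.
Hypothesis St_psd : \forall w \ae P, \forall r \ae mu, 0 <= r <= T ->
  forall v, 0 <= bilin v (St w r) v.
Local Notation E f := (\int[P]_w f w).

Variables (nk : nat -> nat) (Qt : nat -> Omega -> R -> 'M[R]_(d + d)).
Hypothesis nk_mono : forall k l, (k <= l)%N -> (nk k <= nk l)%N.
Hypothesis Qt_sol : forall k, solves_riccati P F T Lambda gamma rt St (nk k) (Qt k).
Variable Ql : Omega -> R -> 'M[R]_(d + d).
Hypothesis Ql_prog : mx_progressive F `[0, T] Ql.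
Hypothesis Qt_cvg : \forall w \ae P, forall s : R, 0 <= s < T -> forall i j,
  Qt k w s i j @[k --> \oo] --> Ql w s i j.
Variable c : R -> R.
Hypothesis c_ge0 : forall u, u < T -> 0 <= c u.
Hypothesis Qt_bound : forall u k (s : R), u < T -> 0 <= s <= u ->
  \forall w \ae P, forall i j, `|Qt k w s i j| <= c u.

Variables (t : R) (t0 : 0 <= t) (tT : t < T).
Variables (x y : 'cV[R]_d) (X Y xi : Omega -> R -> 'cV[R]_d).
Hypothesis xi_def : forall w s, xi w s =
  feedback_control Lambda gamma Ql w s (X w s) (Y w s).
Hypothesis state_XY : state_process P F T gamma rho xi t x y X Y.

Lemma feedback_adapted i j : adapted F `[t, T[ (fun w r => xi w r i j).
Proof.
move=> r; rewrite /= in_itv/= => /andP[tr rT].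
have [pX pY _ _] := state_XY.
pose C (g : Omega -> R) := measurable_at F r g.
have C_cst a : C (fun=> a) by exact: measurable_cst.
have C_add f g : C f -> C g -> C (fun w => f w + g w) by exact: measurable_funD.
have C_mul f g : C f -> C g -> C (fun w => f w * g w) by exact: measurable_funM.
have at_r (I : set R) f : measurable I -> I r -> progressive F I f -> C (f ^~ r).
  move=> mI Ir pf.
  apply: (measurable_time_section (S := g_sigma_algebraType (F r)) (I := I `&` `]-oo, r]) _ (pf r Ir)).
    exact: measurableI.
  by split => //=; rewrite in_itv/=.
have CX : entrywise C (fun w => X w r).
  by move=> a b; apply: (at_r _ _ _ _ (pX a b)) => //=; rewrite in_itv/= tr.
have CY : entrywise C (fun w => Y w r).
  by move=> a b; apply: (at_r _ _ _ _ (pY a b)) => //=; rewrite in_itv/= tr.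
have CQ : entrywise C (fun w => Ql w r).
  move=> a b; apply: (at_r _ _ _ _ (Ql_prog a b)) => //=.
  by rewrite in_itv/= (le_trans t0 tr) ltW.
have CXY : entrywise C (fun w => col_mx (X w r) (Y w r)).
  move=> a b; case: (split_ordP a) => a' ->.
    by under eq_fun do rewrite col_mxEu; exact: CX.
  by under eq_fun do rewrite col_mxEd; exact: CY.
have M := entrywiseM C_cst C_add C_mul.
suff : entrywise C (fun w => xi w r) by exact.
rewrite (_ : (fun w => xi w r) = fun w => - (invmx Lambda *m row_mx (- 1%:M) (diag_mx gamma)
  *m Ql w r *m col_mx (X w r) (Y w r))); last by apply/funext => w; rewrite xi_def.
apply: (entrywiseN C_cst C_mul); apply: (M _ _ _ _ _ _ CXY).
by apply: (M _ _ _ _ _ _ CQ); exact: entrywise_cst.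
Qed.

Lemma feedback_joint i j :
  measurable_fun ([set: Omega] `*` `[t, T[) (fun z : Omega * R => xi z.1 z.2 i j).
Proof.
have [pX pY _ _] := state_XY.
pose C (g : Omega * R -> R) := measurable_fun ([set: Omega] `*` `[t, T[) g.
have C_cst a : C (fun=> a) by exact: measurable_cst.
have C_add f g : C f -> C g -> C (fun w => f w + g w) by exact: measurable_funD.
have C_mul f g : C f -> C g -> C (fun w => f w * g w) by exact: measurable_funM.
have CX : entrywise C (fun z => X z.1 z.2).
  by move=> a b; exact: (progressive_joint FF t0 tT (pX a b)).
have CY : entrywise C (fun z => Y z.1 z.2).
  by move=> a b; exact: (progressive_joint FF t0 tT (pY a b)).
have CQ : entrywise C (fun z => Ql z.1 z.2).
  move=> a b; have IT : `[0, T]%classic T by rewrite /= in_itv/= lexx ltW.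
  have h := jointly_measurable_identity (f := fun w r => Ql w r a b) _ _ (Ql_prog a b IT).
  apply: (measurable_funS _ _ (h _ _)).
  - by apply: measurableX => //; exact: measurableI.
  - move=> [w r] [_ /=]; rewrite in_itv/= => /andP[tr rT]; split => //=.
    by rewrite !in_itv/= (le_trans t0 tr) ltW.
  - exact: measurableI.
  - by apply: FF.1; rewrite lexx ltW.
have CXY : entrywise C (fun z => col_mx (X z.1 z.2) (Y z.1 z.2)).
  move=> a b; case: (split_ordP a) => a' ->.
    by under eq_fun do rewrite col_mxEu; exact: CX.
  by under eq_fun do rewrite col_mxEd; exact: CY.
have M := entrywiseM C_cst C_add C_mul.
suff : entrywise C (fun z => xi z.1 z.2) by exact.
rewrite (_ : (fun z : Omega * R => xi z.1 z.2) = fun z => - (invmx Lambda *m row_mx (- 1%:M) (diag_mx gamma)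
  *m Ql z.1 z.2 *m col_mx (X z.1 z.2) (Y z.1 z.2))); last by apply/funext => z; rewrite xi_def.
apply: (entrywiseN C_cst C_mul); apply: (M _ _ _ _ _ _ CXY).
by apply: (M _ _ _ _ _ _ CQ); exact: entrywise_cst.
Qed.

Lemma feedback_energy_joint :
  measurable_fun ([set: Omega] `*` `[t, T[) (fun z : Omega * R => sqr_frobenius (xi z.1 z.2)).
Proof.
rewrite /sqr_frobenius.
apply: measurable_sum => i; apply: measurable_sum => j.
by apply: measurable_funX; exact: feedback_joint.
Qed.

(** The energy inequality on [[t, u]], with a right-hand side given by the
    value at the initial state and hence free of [u]. The second part inserts
    that the limit dominates every penalized solution. *)
Lemma liquidation_estimate : exists C0 : R, 0 <= C0 /\ forall u, t <= u -> u < T ->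
  (\int[P]_w \int[mu]_(r in `[t, u]) (sqr_frobenius (xi w r))%:E <= C0%:E)%E /\
  exists V : Omega -> 'cV[R]_(d + d),
    [/\ mx_brv F u V, \forall w \ae P, V w = joint_state X Y w u &
        forall k, E (fun w => bilin (V w) (Qt k w u) (V w)) <= C0].
Proof.
have [kL kL0 kLE] := pd_controls_norm Lambda_pd.
pose z := col_mx x y.
pose C0 := c t * (d + d)%:R * \sum_i z i 0 ^+ 2.
have C00 : 0 <= C0.
  by rewrite !mulr_ge0 ?c_ge0// sumr_ge0// => i _; exact: sqr_ge0.
exists (C0 + kL * C0); split; first by rewrite addr_ge0// mulr_ge0.
move=> u tu uT; have u0 := le_trans t0 tu; have uT' := ltW uT.
have cvg_u v : v < T -> \forall w \ae P, forall s : R, 0 <= s <= v -> forall i j,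
    Qt k w s i j @[k --> \oo] --> Ql w s i j.
  move=> vT; apply: filterS Qt_cvg => w h s /andP[s0 sv]; apply: h.
  by rewrite s0 (le_lt_trans sv).
have bnd_u v vT k s sv := Qt_bound (u := v) k (s := s) vT sv.
pose Qu := clipped_limit Ql (c u).
have bQu : mx_bproc F 0 u Qu := clipped_limit_bproc Ql_prog uT (c_ge0 uT).
have wQu := limit_weak_equation FF T_gt0 brt bSt Qt_sol Ql_prog uT (c_ge0 uT)
  (cvg_u u uT) (bnd_u u uT).
have QuE := clipped_limit_ae FF Ql_prog u0 uT (c_ge0 uT) (cvg_u u uT) (bnd_u u uT).
have Ql_psd := limit_psd Qt_sol uT (cvg_u u uT).
have Qu_sym : \forall w \ae P, \forall s \ae mu, 0 <= s <= u -> (Qu w s)^T = Qu w s.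
  apply: filterS2 QuE Ql_psd => w e psd; apply: filterS e => s e su.
  by rewrite /Qu e//; have [] := psd s su.
have [Zt [bZt ZtE energy]] := energy_inequality FF T_gt0 Lambda_pd gamma_gt0 rho_prog
  brt bSt rt_ge0 rtE St_psd t0 tu uT Ql_prog bQu wQu QuE Qu_sym xi_def state_XY.
have incr := state_increment FF T_gt0 rho_prog brt rtE t0 tu uT Ql_prog bQu QuE xi_def state_XY.
set L := feedback_mx Lambda gamma Qu in energy.
have bL : mx_bproc F t u L.
  by apply: (mx_bproc_sub t0 (lexx u)); exact: feedback_bproc.
have bLZ := mx_bproc_mul bL bZt.
have bLambda : mx_bproc F t u (fun _ _ => Lambda) by exact: mx_bproc_cst.
have bcost := bproc_bilin bLZ bLambda bLZ.
have tt : t <= t <= u by rewrite lexx tu.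
have uu : t <= u <= u by rewrite lexx tu.
have range p : t <= p <= u -> 0 <= p <= u.
  by case/andP => /(le_trans t0) -> ->.
have rangeT p : t <= p <= u -> 0 <= p <= T.
  by case/andP => tp pu; rewrite (le_trans t0 tp) (le_trans pu).
have bquad s : t <= s <= u ->
    bounded_measurable [set: Omega] (fun w => bilin (Zt w s) (Qu w s) (Zt w s)).
  move=> su; apply: (brv_bm FF (rangeT s su)); apply: brv_bilin.
  - exact: mx_bproc_time bZt.
  - exact: mx_bproc_time (range s su) bQu.
  - exact: mx_bproc_time bZt.
have initial : E (fun w => bilin (Zt w t) (Qu w t) (Zt w t)) <= C0.
  rewrite -[leRHS](E_cst P); apply: E_ae_le; [exact: bquad|exact: bm_cst|].
  have ltt : 0 <= t <= t by rewrite t0 lexx.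
  apply: filter_app (fixed_time_limit (cvg_u t tT) (bnd_u t tT) ltt).
  apply: filter_app (fixed_time_limit (cvg_u u uT) (bnd_u u uT) (range t tt)).
  apply: filterS2 incr ZtE => w [Zz _ _] ze [_ e1 _] [_ e2 _].
  rewrite ze// Zz (le_trans (ler_norm _))//; apply: bilin_quad_bound => i j.
  by rewrite /Qu e1 -e2 clipped_limit_bound// c_ge0.
have final0 : 0 <= E (fun w => bilin (Zt w u) (Qu w u) (Zt w u)).
  rewrite -[leLHS](E_cst P); apply: E_ae_le; [exact: bm_cst|exact: bquad|].
  apply: filterS2 Ql_psd (fixed_time_limit (cvg_u u uT) (bnd_u u uT) (range u uu)) => w psd [_ e _].
  by rewrite /Qu e; have [_] := psd u (range u uu); exact.
have cost_mean : bounded_measurable (`[t, u]%classic : set R)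
    (fun p => E (fun w => bilin (L w p *m Zt w p) Lambda (L w p *m Zt w p))).
  exact: (bproc_mean P FF t0 tu uT' bcost).
have cost0 : 0 <= \int[mu]_(p in `[t, u])
    E (fun w => bilin (L w p *m Zt w p) Lambda (L w p *m Zt w p)).
  rewrite -[leLHS](mul0r (u - t)) -int_cst//; apply: int_le => //; first exact: bm_cst.
  move=> p pu; rewrite -[leLHS](E_cst P); apply: E_le; first exact: bm_cst.
    by apply: (brv_bm FF (rangeT p pu)); exact: bproc_time pu bcost.
  by move=> w; exact: pd_ge0.
split; last first.
  exists (Zt ^~ u); split.
  - exact: mx_bproc_time uu bZt.
  - by apply: filterS ZtE => w; exact.
  move=> k; apply: le_trans (limit_dominates FF Lambda_pd brt bSt nk_mono Qt_sol Ql_prog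
    uT (c_ge0 uT) (cvg_u u uT) (bnd_u u uT) k (range u uu) (mx_bproc_time uu bZt)) _.
  have : 0 <= kL * C0 by exact: mulr_ge0.
  by move: energy initial cost0; rewrite -/Qu; lra.
pose sq w p := sqr_frobenius (L w p *m Zt w p).
have bsq : bproc F t u sq.
  apply: bproc_sum => i; apply: bproc_sum => j.
  by apply: (eq_bproc (f := fun w p => (L w p *m Zt w p) i j * (L w p *m Zt w p) i j)) => //;
    exact: bprocM.
have jsq := bproc_joint FF t0 tu uT' bsq.
have sub : (`[t, u]%classic : set R) `<=` `[t, T[%classic.
  by apply: subset_itvl; rewrite bnd_simp.
have mxi : measurable_fun ([set: Omega] `*` `[t, u]) (fun z : Omega * R => sqr_frobenius (xi z.1 z.2)).
  apply: measurable_funS feedback_energy_joint; first exact: measurableX.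
  by move=> [w r] [_ /= h]; split => //=; exact: sub.
have sqr0 (A : 'cV[R]_d) : 0 <= sqr_frobenius A.
  by apply: sumr_ge0 => i _; apply: sumr_ge0 => j _; exact: sqr_ge0.
have pathE : \forall w \ae P, (\int[mu]_(r in `[t, u]) (sqr_frobenius (xi w r))%:E =
    (\int[mu]_(r in `[t, u]) sq w r)%:E)%E.
  apply: filterS2 QuE ZtE => w qe ze.
  rewrite /Rintegral fineK; last first.
    apply: integrable_fin_num => //; apply: (@bm_integrable _ (measurableTypeR R) R mu) => //.
      exact: lebesgue_itv_fin.
    exact: jbm_path jsq.
  apply: (@ae_eq_integral _ (measurableTypeR R) R mu) => //.
  - by apply/measurable_EFinP; exact: (measurable_path_section (f := fun w r => sqr_frobenius (xi w r)) w _ mxi).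
  - by apply/measurable_EFinP; have [] := jbm_path w jsq.
  apply: filterS qe => r qe /=; rewrite in_itv/= => ru.
  have e : Qu w r = Ql w r by apply: qe; exact: range.
  by rewrite (feedback_stateE (Qu := Qu) xi_def e) /sq ze.
apply: (@le_trans _ _ (\int[P]_w (\int[mu]_(r in `[t, u]) sq w r)%:E)%E).
  rewrite le_eqVlt; apply/orP; left; apply/eqP; apply: ae_eq_integral => //.
  - exact: (measurable_path_integral (f := fun w r => sqr_frobenius (xi w r))).
  - by apply/measurable_EFinP; have [] := bm_path_integral tu jsq.
  by apply: filterS pathE => w h _.
have bpath := bm_path_integral tu jsq.
have <- : ((\int[P]_w \int[mu]_(r in `[t, u]) sq w r)%:E = \int[P]_w (\int[mu]_(r in `[t, u]) sq w r)%:E)%E.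
  rewrite /Rintegral fineK//; apply: integrable_fin_num => //.
  by apply: bm_integrable => //; exact: prob_fin.
rewrite lee_fin (bproc_fubini P FF t0 tu uT' bsq).
apply: (@le_trans _ _ (kL * C0)); last by rewrite lerDr.
apply: (@le_trans _ _ (\int[mu]_(p in `[t, u])
  (kL * E (fun w => bilin (L w p *m Zt w p) Lambda (L w p *m Zt w p))))); last first.
  rewrite int_Z// ler_wpM2l//; move: energy initial final0; rewrite -/Qu; lra.
apply: int_le => //.
- exact: (bproc_mean P FF t0 tu uT' bsq).
- by apply: bmM => //; exact: bm_cst.
move=> p pu.
have bcp : bounded_measurable [set: Omega] (fun w => bilin (L w p *m Zt w p) Lambda (L w p *m Zt w p)).
  by apply: (brv_bm FF (rangeT p pu)); exact: bproc_time pu bcost.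
rewrite -E_Z//; apply: E_le.
- by apply: (brv_bm FF (rangeT p pu)); exact: bproc_time pu bsq.
- by apply: bmM => //; exact: bm_cst.
move=> w; apply: le_trans (kLE _).
by rewrite /sq /sqr_frobenius; apply: ler_sum => i _; rewrite big_ord1.
Qed.
End LiquidationEstimate.

(** * The terminal constraint *)

Lemma cvg_min1 (R : realType) (X : Type) (G : set_system X) (f : X -> R) (l : R) : Filter G ->
  f x @[x --> G] --> l -> Num.min 1 (f x) @[x --> G] --> Num.min 1 l.
Proof.
move=> FG fl; rewrite minr_absE; under eq_cvg do rewrite minr_absE.
have c1 : (fun=> 1 : R) @ G --> (1 : R) by exact: cvg_cst.
apply: cvgM; last exact: cvg_cst.
by apply: cvgB; [exact: cvgD|apply: cvg_norm; exact: cvgB].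
Qed.

Section Penalization.
Context (R : realType) (d : nat).
Variables (gamma : 'rV[R]_d) (gm : R).
Hypotheses (gamma_gt0 : forall i, 0 < gamma 0 i) (gm_gt0 : 0 < gm)
  (gamma_le : forall i, gamma 0 i <= gm).

(** The mixed term [2 x y] is absorbed by [2 gm x^2 + y^2 / (2 gm)], at most
    half of the weight of [y]. *)
Lemma terminal_coercive n v : (n%:R - 2 * gm) * \sum_i usubmx v i 0 ^+ 2
    + (2 * gm)^-1 * \sum_i dsubmx v i 0 ^+ 2 <= bilin v (bsde_terminal gamma n) v.
Proof.
rewrite -[X in _ <= bilin X _ X](vsubmxK v) /bsde_terminal invmx_diag_pos//.
move: (usubmx v) (dsubmx v) => x y.
rewrite !bilin_block !bilin_scalar bilin_diag !mulr_sumr -!big_split /=.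
apply: ler_sum => i _; rewrite !mxE.
have gi : gm^-1 <= (gamma 0 i)^-1 by rewrite lef_pV2 ?posrE// gamma_le.
move: (gamma 0 i)^-1 (x i 0) (y i 0) gi => g a b g1.
have h1 : 0 <= (g - gm^-1) * b ^+ 2.
  by apply: mulr_ge0; [rewrite subr_ge0|exact: sqr_ge0].
have h2 : 0 <= (2 * gm * a + b) ^+ 2 / (2 * gm).
  by rewrite divr_ge0 ?sqr_ge0// mulr_ge0// ltW.
rewrite -subr_ge0; set rhs := (X in 0 <= X).
have -> : rhs = (g - gm^-1) * b ^+ 2 + (2 * gm * a + b) ^+ 2 / (2 * gm).
  by rewrite /rhs; field; rewrite gt_eqF.
exact: addr_ge0.
Qed.

(** If [Q] is close to its terminal value, the coercivity of the latter
    decides; if not, the last minimum equals 1 and [Q >= 0] suffices. *)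
Lemma penalization (n : nat) (Q : 'M[R]_(d + d)) (e : R) v :
  2 * gm + 1 <= n%:R -> psd_mx Q ->
  (forall i j, `|Q i j - bsde_terminal gamma n i j| <= e) -> 0 <= e ->
  (n%:R - 2 * gm - 1) * Num.min 1 (\sum_i usubmx v i 0 ^+ 2) <=
  bilin v Q v + (n%:R - 2 * gm - 1) * Num.min 1 (e * (d + d)%:R * (1 + 2 * gm)).
Proof.
move=> ngm [_ Q0] Qe e0.
set a := n%:R - 2 * gm - 1; have a0 : 0 <= a by rewrite /a -addrA -opprD subr_ge0.
set S := \sum_i usubmx v i 0 ^+ 2.
have S0 : 0 <= S by apply: sumr_ge0 => i _; exact: sqr_ge0.
set del := e * (d + d)%:R; have del0 : 0 <= del by rewrite mulr_ge0.
have [big|small] := leP 1 (del * (1 + 2 * gm)).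
  rewrite mulr1 (le_trans (_ : _ <= a))//.
    by rewrite -[leRHS]mulr1 ler_wpM2l// ge_min lexx.
  by rewrite lerDr; exact: Q0.
have -> : bilin v Q v = bilin v (bsde_terminal gamma n) v + bilin v (Q - bsde_terminal gamma n) v.
  by rewrite -bilinDm addrC subrK.
have := terminal_coercive n v; rewrite -/S; set S' := \sum_i dsubmx v i 0 ^+ 2.
have S'0 : 0 <= S' by apply: sumr_ge0 => i _; exact: sqr_ge0.
have : `|bilin v (Q - bsde_terminal gamma n) v| <= del * (S + S').
  rewrite /del (_ : S + S' = \sum_i v i 0 ^+ 2).
    by apply: bilin_quad_bound => i j; have := Qe i j; rewrite !mxE.
  rewrite big_split_ord/= /S /S'; congr (_ + _); apply: eq_bigr => i _.
    by rewrite mxE.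
  by rewrite mxE.
rewrite ler_norml => /andP[close _] coer.
have gm2 : 0 < 2 * gm by rewrite mulr_gt0.
have d1 : del <= 1.
  by apply: le_trans (ltW small); rewrite ler_peMr// lerDl ltW.
have d2 : del <= (2 * gm)^-1.
  rewrite -[leRHS]mul1r ler_pdivlMr//; apply: le_trans (ltW small).
  by rewrite ler_wpM2l// lerDr.
have h1 : del * S <= S by rewrite ler_piMl.
have h2 : del * S' <= (2 * gm)^-1 * S' by rewrite ler_wpM2r.
have h3 : a * Num.min 1 S <= a * S by rewrite ler_wpM2l// ge_min lexx orbT.
have h4 : 0 <= a * (del * (1 + 2 * gm)) by rewrite !mulr_ge0// addr_ge0// ltW.
have h5 : a * S = (n%:R - 2 * gm) * S - S by rewrite /a; ring.
have h6 : del * (S + S') = del * S + del * S' by ring.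
rewrite h6 in close; lra.
Qed.
End Penalization.

Section TerminalConstraint.
Context dO (Omega : measurableType dO) (R : realType) (P : probability Omega R).
Variables (F : R -> set (set Omega)) (d : nat) (T : R).
Hypothesis FF : filtration F T.
Variables (Lambda : 'M[R]_d) (gamma : 'rV[R]_d) (gm : R).
Hypotheses (gamma_gt0 : forall i, 0 < gamma 0 i) (gm_gt0 : 0 < gm)
  (gamma_le : forall i, gamma 0 i <= gm).
Variables (rt : Omega -> R -> 'rV[R]_d) (St : Omega -> R -> 'M[R]_d).
Local Notation E f := (\int[P]_w f w).
Variables (nk : nat -> nat) (Qt : nat -> Omega -> R -> 'M[R]_(d + d)).
Hypothesis nk_ge : forall k, (k <= nk k)%N.
Hypothesis Qt_sol : forall k, solves_riccati P F T Lambda gamma rt St (nk k) (Qt k).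
Variables (u_ : nat -> R).
Hypotheses (u0 : forall n, 0 <= u_ n) (uT : forall n, u_ n < T).
Hypothesis Qt_left : forall k, \forall w \ae P, forall i j,
  Qt k w (u_ n) i j @[n --> \oo] --> bsde_terminal gamma (nk k) i j.
Variables (V : nat -> Omega -> 'cV[R]_(d + d)) (C0 : R).
Hypotheses (bV : forall n, mx_brv F (u_ n) (V n))
  (VC : forall n k, E (fun w => bilin (V n w) (Qt k w (u_ n)) (V n w)) <= C0)
  (V_cvg : \forall w \ae P, forall i, cvg (usubmx (V n w) i 0 @[n --> \oo])).

Let h n w : R := Num.min 1 (\sum_i usubmx (V n w) i 0 ^+ 2).
Let hl w : R := Num.max 0 (clip 1 (lim (h n w @[n --> \oo]))).

Let uu n : 0 <= u_ n <= T. Proof. by rewrite u0 ltW. Qed.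

Let h01 n w : 0 <= h n w <= 1.
Proof.
rewrite /h ge_min lexx andbT le_min ler01/=.
by apply: sumr_ge0 => i _; exact: sqr_ge0.
Qed.

Let bh n : bounded_measurable [set: Omega] (h n).
Proof.
split; last by exists 1 => w _; rewrite ger0_norm; case/andP: (h01 n w).
apply: measurable_minr => //; apply: measurable_sum => i; apply: measurable_funX.
have [mV _] := brv_bm FF (uu n) (bV n (lshift d i) 0).
by apply: (eq_measurable_fun _ _ mV) => w _; rewrite mxE.
Qed.

Let bhl : bounded_measurable [set: Omega] hl.
Proof.
split; last first.
  exists 1 => w _; rewrite ger0_norm ?le_max ?lexx// ge_max ler01/=.
  by rewrite (le_trans (ler_norm _))// clip_norm.
apply: measurable_maxr => //; apply: measurable_maxr => //; apply: measurable_minr => //.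
by apply: measurable_lim => // n; have [] := bh n.
Qed.

Let h_lim : \forall w \ae P, exists2 l : 'I_d -> R,
  (forall i, usubmx (V n w) i 0 @[n --> \oo] --> l i) &
  hl w = Num.min 1 (\sum_i l i ^+ 2) /\ h n w @[n --> \oo] --> hl w.
Proof.
apply: filterS V_cvg => w cV.
exists (fun i => lim (usubmx (V n w) i 0 @[n --> \oo])); first exact: cV.
set l := \sum_i _.
have ch : h n w @[n --> \oo] --> Num.min 1 l.
  by apply: cvg_min1; apply: cvg_sum_seq => i; apply: cvgM; exact: cV.
have l0 : 0 <= l by apply: sumr_ge0 => i _; exact: sqr_ge0.
have hlE : hl w = Num.min 1 l.
  rewrite /hl (cvg_lim _ ch)// clip_id; first by apply/max_idPr; rewrite le_min ler01.
  by rewrite ger0_norm ?le_min ?ler01// ge_min lexx.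
by rewrite hlE.
Qed.

Let penalized k : 2 * gm + 1 <= (nk k)%:R -> ((nk k)%:R - 2 * gm - 1) * E hl <= C0.
Proof.
move=> kgm; set a := _ - 1.
have a0 : 0 <= a by rewrite /a -addrA -opprD subr_ge0.
pose e n w : R := \sum_i \sum_j `|Qt k w (u_ n) i j - bsde_terminal gamma (nk k) i j|.
have e0 n w : 0 <= e n w by do 2 (apply: sumr_ge0 => ? _).
pose g n w : R := Num.min 1 (e n w * (d + d)%:R * (1 + 2 * gm)).
have [bQ _ psdQ _] := Qt_sol k.
have bQu n i j : bounded_measurable [set: Omega] (fun w => Qt k w (u_ n) i j).
  by apply: (brv_bm FF (uu n)); exact: bproc_time (uu n) (bQ i j).
have bg n : bounded_measurable [set: Omega] (g n).
  split.
    apply: measurable_minr => //; apply: measurable_funM => //; apply: measurable_funM => //.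
    apply: measurable_sum => i; apply: measurable_sum => j.
    apply: measurableT_comp => //; apply: measurable_funB => //; by have [] := bQu n i j.
  exists 1 => w _; rewrite ger0_norm ?ge_min ?lexx// le_min ler01/=.
  by rewrite !mulr_ge0// addr_ge0// mulr_ge0// ltW.
have cvg_h : E (h n) @[n --> \oo] --> E hl.
  apply: (@bm_cvg_int _ _ _ P setT measurableT (prob_fin P) h hl 1).
  - by move=> n; have [] := bh n.
  - by have [] := bhl.
  - by apply: filterS h_lim => w [l _ [_ ch]] _.
  by move=> n w _; rewrite ger0_norm; case/andP: (h01 n w).
have cvg_g : E (g n) @[n --> \oo] --> 0.
  rewrite -[X in _ --> X](E_cst P 0).
  apply: (@bm_cvg_int _ _ _ P setT measurableT (prob_fin P) g (fun=> 0) 1) => //.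
  - by move=> n; have [] := bg n.
  - apply: filterS (Qt_left k) => w cQ _.
    rewrite (_ : 0 = Num.min 1 (0 * (d + d)%:R * (1 + 2 * gm))); last first.
      by rewrite !mul0r; apply/esym/min_idPr.
    apply: cvg_min1; apply: cvgM; last exact: cvg_cst; apply: cvgM; last exact: cvg_cst.
    rewrite (_ : 0 = \sum_(i < d + d) \sum_(j < d + d) `|0 : R|); last first.
      by rewrite big1// => i _; rewrite big1// => j _; rewrite normr0.
    apply: cvg_sum_seq => i; apply: cvg_sum_seq => j; apply: cvg_norm.
    by apply/subr_cvg0; exact: cQ.
  by move=> n w _; rewrite ger0_norm ?ge_min ?lexx// le_min ler01/= !mulr_ge0// addr_ge0// mulr_ge0// ltW.
have step n : a * E (h n) <= C0 + a * E (g n).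
  have bb : bounded_measurable [set: Omega] (fun w => bilin (V n w) (Qt k w (u_ n)) (V n w)).
    apply: (brv_bm FF (uu n)); apply: brv_bilin => //.
    exact: mx_bproc_time (uu n) bQ.
  apply: (@le_trans _ _ (E (fun w => bilin (V n w) (Qt k w (u_ n)) (V n w)) + a * E (g n))); last first.
    by rewrite lerD2r.
  rewrite -!E_Z// -E_D//; last by apply: bmM => //; exact: bm_cst.
  apply: E_ae_le.
  - by apply: bmM => //; exact: bm_cst.
  - by apply: bmD => //; apply: bmM => //; exact: bm_cst.
  apply: filterS psdQ => w psd; apply: penalization => //; first exact: psd.
  move=> i j; rewrite /e (bigD1 i)//= (bigD1 j)//= -addrA lerDl addr_ge0//.
    by apply: sumr_ge0.
  by apply: sumr_ge0 => ? _; apply: sumr_ge0.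
have c1 : a * E (h n) @[n --> \oo] --> a * E hl by apply: cvgM => //; exact: cvg_cst.
have c2 : C0 + a * E (g n) @[n --> \oo] --> C0 + a * 0.
  by apply: cvgD; [exact: cvg_cst|apply: cvgM => //; exact: cvg_cst].
rewrite mulr0 addr0 in c2.
by apply: (ler_cvg_to c1 c2); apply: nearW.
Qed.

(** Along [u_ n -> T] the penalized solution tends to its terminal value, so
    [penalization] yields that the mean of the squared terminal position, cut
    off at 1, is at most [C0] divided by a quantity of the order of the
    penalty, which is arbitrary. *)
Lemma terminal_constraint : \forall w \ae P, forall i,
  usubmx (V n w) i 0 @[n --> \oo] --> (0 : R).
Proof.
have hl0 w : 0 <= hl w by rewrite /hl le_max lexx.
have E0 : E hl <= 0.
  rewrite leNgt; apply/negP => Epos.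
  (* A penalty this large contradicts the bound [C0]. *)
  pose k := (Num.truncn (C0 / E hl + 2 * gm + 1)).+1.
  have kb : C0 / E hl + 2 * gm + 1 < (nk k)%:R.
    by apply: (lt_le_trans (truncnS_gt _)); rewrite ler_nat nk_ge.
  have C00 : 0 <= C0.
    have [bQ _ psdQ _] := Qt_sol 0.
    apply: le_trans (VC 0 0); rewrite -[leLHS](E_cst P); apply: E_ae_le; first exact: bm_cst.
      apply: (brv_bm FF (uu 0)); apply: brv_bilin => //.
      exact: mx_bproc_time (uu 0) bQ.
    by apply: filterS psdQ => w psd; have [_] := psd _ (uu 0); exact.
  have q0 : 0 <= C0 / E hl by rewrite divr_ge0// ltW.
  have pk : 2 * gm + 1 <= (nk k)%:R by lra.
  have := penalized pk; apply/negP; rewrite -ltNge -ltr_pdivrMr//; lra.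
have hl_eq0 := bm_int_eq0_ae measurableT (prob_fin P) bhl (fun w _ => hl0 w) E0.
apply: filterS2 hl_eq0 h_lim => w /(_ I) hw0 [l cl [hlE _]] i.
have S0 : 0 <= \sum_i l i ^+ 2 by apply: sumr_ge0 => j _; exact: sqr_ge0.
have : \sum_i l i ^+ 2 = 0.
  move: hlE; rewrite hw0; case: (leP 1 (\sum_i l i ^+ 2)) => // _ one0.
  by move/eqP: one0; rewrite eq_sym oner_eq0.
move/eqP; rewrite psumr_eq0 => [/allP/(_ i (mem_index_enum i))/=|j _]; last exact: sqr_ge0.
by rewrite sqrf_eq0 => /eqP <-; exact: cl.
Qed.
End TerminalConstraint.

(** * Admissibility of the feedback control *)

(** Also valid without convergence, where both sides are the default value of
    [lim]. *)
Lemma lim_shift (R : realType) (N : nat) (u : nat -> R) :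
  lim (u (n + N)%N @[n --> \oo]) = lim (u n @[n --> \oo]).
Proof. by rewrite /lim; congr get; apply/funext => l; rewrite -(cvg_shiftn N u (nbhs l)). Qed.

Section SquareIntegrableControl.
Context (R : realType).
Local Notation mu := (@lebesgue_measure R).

Lemma square_integrable_path_limit (t T : R) (f : R -> R) : t < T ->
  measurable_fun (`[t, T[%classic : set R) f ->
  (\int[mu]_(r in `[t, T[) (f r ^+ 2)%:E < +oo)%E ->
  cvg ((\int[mu]_(r in `[t, s]) f r) @[s --> T^'-]).
Proof.
move=> tT mf fsq.
have fint : mu.-integrable `[t, T[ (EFin \o f).
  apply/integrableP; split; first exact/measurable_EFinP.
  apply: (@le_lt_trans _ _ (\int[mu]_(r in `[t, T[) (1 + (f r ^+ 2)%:E))%E).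
    apply: (@ge0_le_integral _ (measurableTypeR R) R mu) => //.
    - by apply/measurable_EFinP; exact: measurableT_comp.
    - apply: emeasurable_funD; first exact: measurable_cst.
      by apply/measurable_EFinP; exact: measurable_funX.
    move=> r _ /=; rewrite -EFinD lee_fin.
    have := sqr_ge0 (`|f r| - 1); rewrite -(real_normK (num_real (f r))).
    by have := normr_ge0 (f r); nra.
  rewrite (@ge0_integralD _ (measurableTypeR R) R mu)//.
  - rewrite integral_cst//= mul1e lte_add_pinfty//.
    by rewrite lebesgue_measure_itv/=; case: ifP => _; rewrite ltry.
  - by move=> r _; rewrite lee_fin sqr_ge0.
  - by apply/measurable_EFinP; exact: measurable_funX.
pose g := f \_ (`[t, T[%classic : set R).
have gint : mu.-integrable `[t, T] (EFin \o g).
  apply: (@integrableS _ (measurableTypeR R) R mu setT) => //.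
  rewrite -restrict_EFin.
  exact: (iffLR (@integrable_mkcond _ (measurableTypeR R) R mu _ _ (measurable_itv _)) fint).
apply/cvg_ex; exists (\int[mu]_(r in `[t, T]) g r).
apply: cvg_trans (parameterized_integral_cvg_at_left tT gint).
apply: near_eq_cvg; near=> s; rewrite /parameterized_integral.
apply: eq_Rintegral => r /set_mem/=; rewrite in_itv/= => /andP[tr rs].
rewrite /g patchE mem_set//= in_itv/= tr (le_lt_trans rs)//.
Unshelve. all: by end_near. Qed.

Lemma path_limit_along (t T : R) (f : R -> R) (l : R) : t < T ->
  f s @[s --> T^'-] --> l -> f (toward t T n) @[n --> \oo] --> l.
Proof.
move=> tT /cvg_at_leftP; apply; split; last exact: toward_cvg.
by move=> n; exact: toward_lt.
Qed.
End SquareIntegrableControl.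

Lemma ae_finite_path_energy d (S : measurableType d) (R : realType) (P : probability S R)
    (I : set R) (f : S -> R -> R) : measurable I ->
  measurable_fun ([set: S] `*` I) (fun z : S * R => f z.1 z.2) ->
  (forall w r, 0 <= f w r) ->
  (\int[P]_w \int[@lebesgue_measure R]_(r in I) (f w r)%:E < +oo)%E ->
  \forall w \ae P, (\int[@lebesgue_measure R]_(r in I) (f w r)%:E < +oo)%E.
Proof.
move=> mI mf f0 fin.
have g0 w : (0 <= \int[@lebesgue_measure R]_(r in I) (f w r)%:E)%E.
  by apply: integral_ge0 => r _; rewrite lee_fin.
have gi : P.-integrable setT (fun w => \int[@lebesgue_measure R]_(r in I) (f w r)%:E)%E.
  apply/integrableP; split; first exact: measurable_path_integral.
  by under eq_integral do rewrite gee0_abs//.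
have := integrable_ae measurableT gi.
by apply: filterS => w /(_ Logic.I); rewrite ge0_fin_numE.
Qed.

Theorem proposition3p9
  (dO : measure_display) (Omega : measurableType dO) (R : realType)
  (P : probability Omega R) (F : R -> set (set Omega))
  (W : Omega -> R -> R) (d : nat) (T : R)
  (Lambda : 'M[R]_d) (gamma : 'rV[R]_d)
  (rho : Omega -> R -> 'rV[R]_d) (Sigma : Omega -> R -> 'M[R]_d)
  (Qn Mn : nat -> Omega -> R -> 'M[R]_(d + d))
  (d_gt0 : (0 < d)%N) (T_gt0 : 0 < T)
  (F_def : forall t, F t = brownian_filtration P W t)
  (F_T : F T = @measurable dO Omega)
  (W_bm : brownian_motion P F T W)
  (Lambda_pd : pd_mx Lambda) (gamma_pd : pd_mx (diag_mx gamma))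
  (rho_bnd : ess_bounded_process P F T (@psd_mx R d)
               (fun w s => diag_mx (rho w s)))
  (Sigma_bnd : ess_bounded_process P F T (@psd_mx R d) Sigma)
  (Qn_sol : forall n : nat, gamma_max gamma <= n%:R ->
     bsde_solution P F T Lambda gamma rho Sigma W n (Qn n) (Mn n))
  (Qn_cvg : \forall w \ae P, forall u, 0 <= u < T -> forall i j,
     {uniform `[0, u], (fun n s => Qn n w s i j) @ \oo -->
                       (fun s => bsde_limit Qn w s i j)})
  (t : R) (x y : 'cV[R]_d) (t_ge0 : 0 <= t) (t_ltT : t < T)
  (X Y xi : Omega -> R -> 'cV[R]_d)
  (xi_def : forall w s, xi w s =
     feedback_control Lambda gamma (bsde_limit Qn) w s (X w s) (Y w s))
  (state_XY : state_process P F T gamma rho xi t x y X Y) :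
  admissible_liquidation P F T t xi X.
Proof.
have FF := brownian_is_filtration F_def F_T.
have gamma_gt0 i : 0 < gamma 0 i.
  have := gamma_pd.2 (delta_mx i 0); rewrite -/(bilin _ _ _) bilin_delta mxE eqxx; apply.
  apply/eqP => /matrixP/(_ i 0); rewrite !mxE !eqxx => /eqP.
  by rewrite oner_eq0.
have gamma_le i : gamma 0 i <= gamma_max gamma by exact: le_bigmax.
have gm_gt0 : 0 < gamma_max gamma by apply: lt_le_trans (gamma_le (Ordinal d_gt0)).
(* The equation of [Qn n] is only known for [gamma_max gamma <= n]; shifting
   the index by [N0] does not change the limit. *)
pose N0 := (Num.truncn (gamma_max gamma)).+1; pose nk k := (k + N0)%N.
have nk_gm k : gamma_max gamma <= (nk k)%:R.
  by apply/ltW/(lt_le_trans (truncnS_gt _)); rewrite ler_nat leq_addl.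
have solk k := Qn_sol _ (nk_gm k).
have [rho_prog _ _] := rho_bnd; have [Sigma_prog _ _] := Sigma_bnd.
have [rt [brt rt_ge0 rtE]] := truncate_diag rho_bnd.
have [St [bSt StE]] := truncate_ess_bounded Sigma_bnd.
have StS : \forall w \ae P, \forall r \ae lebesgue_measure, 0 <= r <= T -> St w r = Sigma w r.
  by apply: filterS StE => w; apply: filterS => r h /h[].
have St_psd : \forall w \ae P, \forall r \ae lebesgue_measure, 0 <= r <= T ->
    forall v, 0 <= bilin v (St w r) v.
  by apply: filterS StE => w; apply: filterS => r h /h[-> [_ psd]] v; exact: psd.
have /choice[Qt QtP] : forall k, exists Q : Omega -> R -> 'M[R]_(d + d),
    solves_riccati P F T Lambda gamma rt St (nk k) Q /\
    \forall w \ae P, forall s : R, 0 <= s <= T -> Q w s = Qn (nk k) w s.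
  move=> k; have [Q [bQ wQ QE QT]] :=
    truncated_bsde T_gt0 F_def F_T W_bm rho_prog Sigma_prog brt bSt rtE StS (solk k).
  exists Q; split; first by split => //; apply: filterS QE => w h s /h[].
  by apply: filterS QE => w h s /h[].
have Qt_sol k := (QtP k).1; have QtE k := (QtP k).2.
have Qn_path k : Linf_continuous_process P F T (@psd_mx R (d + d)) (Qn (nk k)).
  by have [] := solk k.
set Ql := bsde_limit Qn in xi_def Qn_cvg.
have Ql_prog : mx_progressive F `[0, T] Ql.
  move=> i j r r0T.
  rewrite (_ : (fun z : g_sigma_algebraType (F r) * R => Ql z.1 z.2 i j) =
    fun z => lim (Qn (nk k) z.1 z.2 i j @[k --> \oo])).
    apply: measurable_lim => [|k].
      by apply: measurableX => //; exact: measurableI.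
    by have [pQ _ _ _] := Qn_path k; exact: pQ.
  by apply/funext => z; rewrite mxE (lim_shift N0 (fun n => Qn n z.1 z.2 i j)).
have Qt_cvg : \forall w \ae P, forall s : R, 0 <= s < T -> forall i j,
    Qt k w s i j @[k --> \oo] --> Ql w s i j.
  have QtE' : \forall w \ae P, forall k (s : R), 0 <= s <= T -> Qt k w s = Qn (nk k) w s.
    by apply: ae_foralln => k; exact: QtE.
  apply: filterS2 Qn_cvg QtE' => w cvgw e s sT i j.
  have s0T : 0 <= s <= T by case/andP: sT => -> /ltW ->.
  under eq_cvg do rewrite e//.
  have su : [set s] `<=` `[0, s]%classic.
    by move=> _ ->; rewrite /= in_itv/= lexx andbT; case/andP: sT.
  have := uniform_subset_cvg _ su (cvgw s sT i j); rewrite uniform_set1 => h.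
  have {}h : Qn n w s i j @[n --> \oo] --> Ql w s i j by exact: h.
  by move: h; rewrite -(cvg_shiftn N0 (fun n => Qn n w s i j)).
have [al [m [al0 m0 quad]]] := uniform_quadratic_bound P FF T_gt0 Lambda_pd gamma_gt0 brt bSt rt_ge0.
pose c u := al / (T - u) + m.
have c_ge0 u : u < T -> 0 <= c u.
  by move=> uT; rewrite addr_ge0// divr_ge0// subr_ge0 ltW.
have Qt_bound u k (s : R) : u < T -> 0 <= s <= u ->
    \forall w \ae P, forall i j, `|Qt k w s i j| <= c u.
  move=> uT /andP[s0 su]; have sT := le_lt_trans su uT.
  have s0T : 0 <= s <= T by rewrite s0 ltW.
  have [bQ _ psdQ _] := Qt_sol k.
  have psd_s : \forall w \ae P, psd_mx (Qt k w s) by apply: filterS psdQ => w; exact.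
  have := @entry_bound_of_quadratic _ _ _ P F T FF _ s (Qt k ^~ s) (c s) s0T
    (mx_bproc_time s0T bQ) psd_s (fun V bV => quad _ _ (Qt_sol k) s V s0 sT bV).
  apply: filterS => w h i j; apply: le_trans (h i j) _.
  rewrite /c lerD2r ler_wpM2l// lef_pV2 ?posrE ?subr_gt0//.
  exact: lerB.
have [C0 [C00 estimate]] := liquidation_estimate FF T_gt0 Lambda_pd gamma_gt0 rho_prog
  brt bSt rt_ge0 rtE St_psd (fun k l kl => leq_add kl (leqnn N0)) Qt_sol Ql_prog Qt_cvg
  c_ge0 Qt_bound t_ge0 t_ltT xi_def state_XY.
have mxi := feedback_energy_joint FF T_gt0 Ql_prog t_ge0 t_ltT xi_def state_XY.
have sqr0 (A : 'cV[R]_d) : 0 <= sqr_frobenius A.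
  by apply: sumr_ge0 => i _; apply: sumr_ge0 => j _; exact: sqr_ge0.
have tge n : t <= toward t T n by exact: toward_ge.
have tlt n : toward t T n < T by exact: toward_lt.
have energy : (\int[P]_w \int[lebesgue_measure]_(r in `[t, T[) (sqr_frobenius (xi w r))%:E < +oo)%E.
  apply: (@le_lt_trans _ _ C0%:E); last exact: ltry.
  apply: (@integral_toward_le _ _ _ P t T C0 (fun w r => sqr_frobenius (xi w r))) => // n.
  by have [] := estimate _ (tge n) (tlt n).
split.
  split.
  - exact: (feedback_adapted Ql_prog t_ge0 xi_def state_XY).
  - exact: (feedback_joint FF T_gt0 Ql_prog t_ge0 t_ltT xi_def state_XY).
  - exact: aeW.
  - exact: energy.
have X_lim : \forall w \ae P, forall i, cvg (X w s i 0 @[s --> T^'-]).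
  have [_ _ _ eqXY] := state_XY.
  have fin := ae_finite_path_energy (measurable_itv _) mxi (fun w r => sqr0 (xi w r)) energy.
  apply: filterS2 fin eqXY => w finw eqw i.
  have mxii : measurable_fun (`[t, T[%classic : set R) (fun r => xi w r i 0).
    have := feedback_joint FF T_gt0 Ql_prog t_ge0 t_ltT xi_def state_XY i 0.
    by apply: (measurable_path_section (f := fun w r => xi w r i 0)).
  have : cvg ((\int[lebesgue_measure]_(r in `[t, s]) xi w r i 0) @[s --> T^'-]).
    apply: square_integrable_path_limit => //; apply: le_lt_trans finw.
    apply: (@ge0_le_integral _ (measurableTypeR R) R lebesgue_measure) => //.
    - by move=> r _; rewrite lee_fin sqr_ge0.
    - by apply/measurable_EFinP; exact: measurable_funX.
    - apply/measurable_EFinP.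
      exact: (measurable_path_section (f := fun w r => sqr_frobenius (xi w r)) w _ mxi).
    move=> r _; rewrite lee_fin /sqr_frobenius (bigD1 i)//= big_ord1 lerDl.
    by apply: sumr_ge0 => j _; apply: sumr_ge0 => k _; exact: sqr_ge0.
  move=> /cvg_ex[l cl]; apply/cvg_ex; exists (x i 0 - l).
  apply: cvg_trans (cvgB (cvg_cst (x i 0)) cl).
  apply: near_eq_cvg; near=> s.
  have sT : t <= s < T.
    apply/andP; split; last by near: s; exact: nbhs_left_lt.
    by near: s; exact: nbhs_left_ge.
  by have [-> _] := eqw s sT; rewrite !mxE.
have /choice[V VP] : forall n, exists V : Omega -> 'cV[R]_(d + d),
    [/\ mx_brv F (toward t T n) V,
        \forall w \ae P, V w = joint_state X Y w (toward t T n) &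
        forall k, \int[P]_w bilin (V w) (Qt k w (toward t T n)) (V w) <= C0].
  by move=> n; have [_] := estimate _ (tge n) (tlt n).
have VX : \forall w \ae P, forall n, V n w = joint_state X Y w (toward t T n).
  by apply: ae_foralln => n; have [] := VP n.
have Qt_left k : \forall w \ae P, forall i j,
    Qt k w (toward t T n) i j @[n --> \oo] --> bsde_terminal gamma (nk k) i j.
  have [_ _ _ QtT] := Qt_sol k; have [_ cQ _ _] := Qn_path k.
  apply: filter_app QtT; apply: filterS2 (QtE k) cQ => w e cw eT i j.
  have T0T : 0 <= T <= T by rewrite lexx ltW.
  rewrite -eT e//; under eq_cvg => n.
    rewrite e; last by rewrite (le_trans t_ge0 (tge n)) ltW.
    over.
  apply: (path_limit_along (f := fun s => Qn (nk k) w s i j) t_ltT).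
  by have /(continuous_within_itvP _ T_gt0)[] := cw i j.
have V_cvg : \forall w \ae P, forall i, cvg (usubmx (V n w) i 0 @[n --> \oo]).
  apply: filterS2 X_lim VX => w cX e i.
  apply/cvg_ex; exists (lim (X w s i 0 @[s --> T^'-])).
  under eq_cvg do rewrite e /joint_state col_mxKu.
  exact: (path_limit_along (f := fun s => X w s i 0) t_ltT (cX i)).
have bV n : mx_brv F (toward t T n) (V n) by have [] := VP n.
have VC n k : \int[P]_w bilin (V n w) (Qt k w (toward t T n)) (V n w) <= C0.
  by have [_ _] := VP n; exact.
have Vn0 := terminal_constraint FF gamma_gt0 gm_gt0 gamma_le (fun k => leq_addr N0 k) Qt_sol
  (fun n => le_trans t_ge0 (tge n)) tlt Qt_left bV VC V_cvg.
apply: filter_app X_lim; apply: filterS2 Vn0 VX => w V0 e cX i; have cXi := cX i.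
suff <- : lim (X w s i 0 @[s --> T^'-]) = 0 by [].
have h1 := path_limit_along (f := fun s => X w s i 0) t_ltT cXi.
have h2 : X w (toward t T n) i 0 @[n --> \oo] --> (0 : R).
  by have := V0 i; under eq_cvg do rewrite e /joint_state col_mxKu.
exact: (cvg_unique _ h1 h2).
Unshelve. all: by end_near. Qed.
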